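(* Let $k,n\in\mathbb N$. There exists $\varepsilon=\varepsilon(k,n)>0$ such that if $G$ is an infinite, connected, $n$-quasitransitive graph with all degrees at most $k$ and with superlinear volume growth, then $p_c(G)\le 1-\varepsilon$. In particular every infinite, connected, $n$-quasitransitive graph of degree at most $k$ has either $p_c(G)\le1-\varepsilon$ or $p_c(G)=1$.
   Context: For an infinite, connected, locally finite graph $G$, $p_c(G)=\sup\{p\in[0,1]:\text{every cluster is finite }\mathbb P_p\text{-a.s.}\}$, where $\mathbb P_p$ is the law of Bernoulli-$p$ bond percolation (each edge open independently with probability $p$). $G$ is $n$-quasitransitive if $\mathrm{Aut}(G)$ acting on the vertex set has at most $n$ orbits. $G$ has superlinear volume growth if $\limsup_{m\to\infty}\frac1m|B(o,m)|=\infty$ for a vertex $o$, where $B(o,m)$ is the graph-distance ball of radius $m$ about $o$. *)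

(* Defs.v *)
From HB Require Import structures.
From mathcomp Require Import all_boot all_order all_algebra.
From mathcomp Require Import all_classical all_reals all_analysis.
From mathcomp Require Import Rstruct.
From Stdlib Require Import List Relations.

Set Implicit Arguments.
Unset Strict Implicit.
Unset Printing Implicit Defensive.
Import Order.TTheory GRing.Theory Num.Theory.
Local Open Scope classical_set_scope.
Local Open Scope ring_scope.

Notation RR := Rdefinitions.R.

Definition simple_graph (V : Type) (adj : V -> V -> Prop) : Prop :=
  (forall x y, adj x y -> adj y x) /\ (forall x, ~ adj x x).

Definition max_degree_le (V : Type) (adj : V -> V -> Prop) (k : nat) : Prop :=
  forall v, exists s : list V, (length s <= k)%N /\ (forall w, adj v w -> In w s).

Definition graph_connected (V : Type) (adj : V -> V -> Prop) : Prop :=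
  forall x y, clos_refl_trans V adj x y.

Definition infinite_vertex_set (V : Type) : Prop := ~ finite_set [set: V].

Definition is_aut (V : Type) (adj : V -> V -> Prop) (f : V -> V) : Prop :=
  bijective f /\ (forall x y, adj x y <-> adj (f x) (f y)).

Definition quasitransitive (V : Type) (adj : V -> V -> Prop) (n : nat) : Prop :=
  exists reps : list V, (length reps <= n)%N /\
    forall v, exists r f, In r reps /\ is_aut adj f /\ f r = v.

Fixpoint ball (V : Type) (adj : V -> V -> Prop) (o : V) (m : nat) : set V :=
  match m with
  | 0 => [set o]
  | m'.+1 => ball adj o m' `|` [set y | exists x, ball adj o m' x /\ adj x y]
  end.

(* limsup_{m -> oo} |B(o,m)| / m = +oo, for some vertex o, written out:
   for every C and every M there is m >= M (m > 0) with |B(o,m)| > C m. *)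
Definition superlinear_growth (V : Type) (adj : V -> V -> Prop) : Prop :=
  exists o : V, forall (C : RR) (M : nat), exists m : nat,
    (M <= m)%N /\ (0 < m)%N /\
    exists s : list V, NoDup s /\ (forall v, In v s -> ball adj o m v) /\
      C * m%:R < (length s)%:R.

(* a finite list of oriented representatives of pairwise distinct edges *)
Definition distinct_edges (V : Type) (adj : V -> V -> Prop) (L : list (V * V)) : Prop :=
  (forall e, In e L -> adj e.1 e.2) /\ NoDup L /\
  (forall e e', In e L -> In e' L -> e'.1 = e.2 -> e'.2 = e.1 -> False).

(* X is a Bernoulli-p bond percolation on the graph, defined on the
   probability space (T, P): X x y t = X y x t is the state of edge {x,y},
   the edge states are measurable and i.i.d. Bernoulli(p) (law given on all
   finite cylinder events). *)
Definition bernoulli_bond (V : Type) (adj : V -> V -> Prop) (p : RR)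
  (d : measure_display) (T : measurableType d) (P : probability T RR)
  (X : V -> V -> T -> bool) : Prop :=
  (forall x y t, X x y t = X y x t) /\
  (forall x y, adj x y -> measurable [set t | X x y t]) /\
  (forall L M : list (V * V), distinct_edges adj (L ++ M) ->
     P ([set t | forall e, In e L -> X e.1 e.2 t] `&`
        [set t | forall e, In e M -> ~~ X e.1 e.2 t])
     = ((p ^+ length L) * ((1 - p) ^+ length M))%:E).

Definition cluster (V : Type) (adj : V -> V -> Prop) (T : Type)
  (X : V -> V -> T -> bool) (t : T) (x : V) : set V :=
  [set y | clos_refl_trans V (fun a b => adj a b /\ X a b t) x y].

Definition all_clusters_finite (V : Type) (adj : V -> V -> Prop) (p : RR) : Prop :=
  forall (d : measure_display) (T : measurableType d) (P : probability T RR)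
    (X : V -> V -> T -> bool),
    bernoulli_bond adj p P X ->
    {ae P, forall t, forall x, finite_set (cluster adj X t x)}.

Definition p_c (V : Type) (adj : V -> V -> Prop) : RR :=
  sup [set p : RR | 0 <= p <= 1 /\ all_clusters_finite adj p].

(* Main.v *)
(* Peierls' argument reduces the theorem to an exponential bound, uniform over
   the class of graphs, on the number of contours: finite connected sets [A]
   containing a vertex [o], with complement free of finite pieces and with edge
   boundary [n].

   If the automorphism group is not unimodular, counting the pairs of an
   unbalanced orbit shows that [#A] is at most a multiple of [n], and connected
   sets of bounded size are easily counted.  Otherwise the mass transport
   principle gives a Poincare-type inequality and isoperimetry relative to the
   volume growth, which is at least quadratic: a finite set with large inradius
   and small boundary, translated along the graph, would force linear growth.

   Contours are counted with spanning forests.  Cutting the [n] boundary edges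
   of [A] in a large finite set [W] can only create forests if every cut edge is
   replaced by an exit to the outside; removing the exits one by one until a
   single one is left on [A] costs a factor [1 / (1 - g y)] per exit [y], where
   [g] is the Green function of [y].  With a single exit, [A] is the set of
   descendants of a vertex of a spanning forest, so the sum over [A] of these
   numbers of forests is at most [max #A] times the number of all forests.

   The crucial estimate is [1 - g y >= c / m ^ 8] when [{g > 1/2}] meets at most
   [m] of the cut edges.  If [1 - g y] were smaller, almost no current would flow
   between the level sets of [g], so by isoperimetry the high and the low level
   sets around [y] would both fill a positive proportion of the ball at some
   scale where the volume growth is regular, which contradicts the transport
   inequality.  As the sets [{g > 1/2}] of different exits are disjoint, one can
   always pick an exit with [m <= n / N], [N] being the number of remaining
   exits, and the product of the [(n / N) ^ 8] is exponential in [n].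

   Without superlinear growth there are infinitely many edge spheres of bounded
   size, and almost surely one of them is closed. *)

From HB Require Import structures.
From mathcomp Require Import all_boot all_order all_algebra all_fingroup finmap.
From mathcomp Require Import boolp zify ring lra.
Set Implicit Arguments.
Unset Strict Implicit.
Unset Printing Implicit Defensive.
Import Order.TTheory GRing.Theory Num.Theory.

(** * Balls, boundaries and automorphisms *)

(** The obstacle is uniformity: superlinear growth is a qualitative hypothesis, yet every constant
    may depend on $k$ and $n$ only. Superlinearity is used just once, to exclude the linear growth
    that gluing translates of a thin set would produce; what remains is quadratic growth with an
    explicit constant. All later constants are absorbed into one number [Gam]. The two sides of the
    cut are treated differently. Outside $A$ the complement of $W$ still serves as a root, so all
    exits can be removed; inside $A$ a forest would have no root left, so one exit must stay. The
    scale where growth is regular is found as follows. The volume at radius $2^a$ is written $4^a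
    256^e$ up to constants. The level sets jump over about $e + \log_2 m$ scales at a time; as long
    as $e$ increases, the voltages spent form a geometric series, and a jump over which $e$
    increases by at most 1 is regular. The base $256 = 2^8$ is the one for which the powers of $2^e$
    balance in the final contradiction with the transport inequality. *)

Lemma card_im (T T' : choiceType) (f : T -> T') (A : {fset T}) :
  injective f -> #|` (f @` A)%fset| = #|` A|.
Proof. by move=> fI; rewrite card_imfset. Qed.

Section Balls.
Local Open Scope fset_scope.
Variables (V : choiceType) (nb : V -> {fset V}).
Hypothesis nbC : forall x y, (y \in nb x) = (x \in nb y).

Definition cnb x := x |` nb x.

Fixpoint B x r : {fset V} :=
  if r is r'.+1 then \bigcup_(y <- B x r') cnb y else [fset x].

Lemma in_cnb x y : (y \in cnb x) = (y == x) || (y \in nb x).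
Proof. by rewrite !inE. Qed.

Lemma cnbC x y : (y \in cnb x) = (x \in cnb y).
Proof. by rewrite !in_cnb eq_sym nbC. Qed.

Lemma in_BS x r z :
  reflect (exists2 y, y \in B x r & z \in cnb y) (z \in B x r.+1).
Proof.
apply: (iffP (bigfcupP _ _ _ _)) => [[y /andP[yB _] zy]|[y yB zy]]; first by exists y.
by exists y; rewrite ?yB.
Qed.

Lemma Bid x r : x \in B x r.
Proof. by elim: r => [|r IH] /=; [rewrite inE|apply/in_BS; exists x; rewrite ?inE ?eqxx]. Qed.

Lemma B_trans x y z r s : y \in B x r -> z \in B y s -> z \in B x (r + s).
Proof.
elim: s z => [|s IH] z yB; first by rewrite addn0 /= inE => /eqP ->.
move=> /in_BS[w wB zw]; rewrite addnS; apply/in_BS; exists w => //; exact: IH.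
Qed.

Lemma B_mono x r s : (r <= s)%N -> {subset B x r <= B x s}.
Proof. by move=> rs z zB; rewrite -(subnKC rs); apply: B_trans zB (Bid _ _). Qed.

Lemma B1 x y : (y \in B x 1) = (y \in cnb x).
Proof.
apply/in_BS/idP => [[w]|yx]; first by rewrite inE => /eqP ->.
by exists x => //; rewrite inE.
Qed.

Lemma nbB x y r z : y \in B x r -> z \in nb y -> z \in B x r.+1.
Proof. by move=> yB zy; apply/in_BS; exists y => //; rewrite in_cnb zy orbT. Qed.

Lemma B_sym x y r : (y \in B x r) = (x \in B y r).
Proof.
suff H u w s : w \in B u s -> u \in B w s by apply/idP/idP; exact: H.
elim: s w => [|s IH] w; first by rewrite /= !inE eq_sym.
move=> /in_BS[v vB wv]; rewrite -add1n; apply: (@B_trans _ v); last exact: IH.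
by rewrite B1 cnbC.
Qed.

Lemma B_split x z r s : z \in B x (r + s) -> exists2 y, y \in B x r & z \in B y s.
Proof.
elim: s z => [|s IH] z; first by rewrite addn0 => zB; exists z => //; rewrite Bid.
rewrite addnS => /in_BS[w /IH[y yB wB] zw]; exists y => //.
by apply/in_BS; exists w.
Qed.

Lemma B_step x z r : z \in B x r.+1 -> exists2 y, y \in cnb x & z \in B y r.
Proof. by rewrite -add1n => /B_split[y yB zB]; exists y; rewrite // -B1. Qed.

Variable k : nat.
Hypothesis nbk : forall x, (#|` nb x| <= k)%N.

Lemma card_bigfcup_le (T : choiceType) (A : {fset T}) (F : T -> {fset V}) c :
  (forall x, x \in A -> (#|` F x| <= c)%N) ->
  (#|` \bigcup_(x <- A) F x| <= #|` A| * c)%N.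
Proof.
move=> H; have: (#|` \bigcup_(x <- A) F x| <= \sum_(x <- A) #|` F x|)%N.
  elim/big_ind2: _ => [|n1 A1 n2 A2 H1 H2|//]; first by rewrite cardfs0.
  by rewrite cardfsU (leq_trans (leq_subr _ _)) // leq_add.
move=> /leq_trans; apply.
rewrite [X in (_ <= X * _)%N](_ : _ = \sum_(x <- A) 1)%N; last by rewrite sum1_size.
rewrite big_distrl /= big_seq [X in (_ <= X)%N]big_seq leq_sum // => i iA.
by rewrite mul1n H.
Qed.

Lemma cnbk x : (#|` cnb x| <= k.+1)%N.
Proof. by rewrite cardfsU1 -add1n leq_add // leq_b1. Qed.

Lemma card_B x r : (#|` B x r| <= k.+1 ^ r)%N.
Proof.
elim: r => [|r IH]; first by rewrite cardfs1.
rewrite expnSr (leq_trans (card_bigfcup_le (c := k.+1) _)) //.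
  by move=> y _; exact: cnbk.
by rewrite leq_mul2r IH orbT.
Qed.

Lemma card_BD x r s : (#|` B x (r + s)| <= #|` B x r| * k.+1 ^ s)%N.
Proof.
have sub : B x (r + s) `<=` \bigcup_(y <- B x r) B y s.
  apply/fsubsetP => z /B_split[y yB zB].
  by apply/bigfcupP; exists y; rewrite ?yB.
rewrite (leq_trans (fsubset_leq_card sub)) // card_bigfcup_le // => y _.
exact: card_B.
Qed.

Lemma in_sep (A : {fset V}) (P : pred V) y : (y \in [fset z in A | P z]) = (y \in A) && P y.
Proof. by rewrite !inE. Qed.

Lemma sumb_card (A : {fset V}) (P : pred V) :
  (\sum_(y <- A) P y = #|` [fset y in A | P y]|)%N.
Proof.
rewrite card_fset_sum1 big_fset /= [RHS]big_mkcond /=.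
by apply: eq_bigr => y _; case: (P y).
Qed.

Definition bd (A : {fset V}) : nat := \sum_(x <- A) \sum_(y <- nb x) (y \notin A).

Lemma bdE (A U : {fset V}) : A `<=` U ->
  bd A = (\sum_(x <- U) \sum_(y <- nb x) ((x \in A) && (y \notin A)))%N.
Proof.
move=> AU; rewrite /bd -(big_fset_incl _ AU) /= => [|x _ /negPf ->].
  by rewrite big_seq [RHS]big_seq; apply: eq_bigr => x ->.
by rewrite big1.
Qed.

(** Checked edge by edge. Submodularity is what allows translates of a set to be glued without
    increasing the boundary. *)
Lemma bd_submod (A C : {fset V}) :
  (bd (A `|` C) + bd (A `&` C) <= bd A + bd C)%N.
Proof.
rewrite (bdE (fsubset_refl (A `|` C))) (@bdE (A `&` C) (A `|` C)); last first.
  by rewrite (fsubset_trans (fsubsetIl _ _)) // fsubsetUl.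
rewrite (bdE (fsubsetUl A C)) (bdE (fsubsetUr A C)) -!big_split leq_sum //= => x _.
rewrite -!big_split leq_sum //= => y _; rewrite !in_fsetE.
by case: (x \in A); case: (x \in C); case: (y \in A); case: (y \in C).
Qed.

Lemma bd_gt0 (A : {fset V}) x y : x \in A -> y \in nb x -> y \notin A -> (0 < bd A)%N.
Proof.
move=> xA yx yA; rewrite /bd (big_fsetD1 x) //= (big_fsetD1 y) //= yA.
by rewrite !addSn.
Qed.

End Balls.

(** * Automorphisms and vertex orbits *)

Section Automorphisms.
Local Open Scope fset_scope.
Variables (V : choiceType) (nb : V -> {fset V}).
Hypothesis nbC : forall x y, (y \in nb x) = (x \in nb y).

Definition aut (f : V -> V) := bijective f /\ forall x y, (f y \in nb (f x)) = (y \in nb x).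

Lemma aut_id : aut id.
Proof. by split=> //; exists id. Qed.

Lemma aut_comp f g : aut f -> aut g -> aut (f \o g).
Proof. by move=> [bf Hf] [bg Hg]; split=> [|x y] /=; [exact: bij_comp|rewrite Hf Hg]. Qed.

Lemma aut_inv f : aut f -> exists g, [/\ aut g, cancel f g & cancel g f].
Proof.
move=> [[g fK gK] Hf]; exists g; split=> //; split; first by exists f.
by move=> x y; rewrite -Hf !gK.
Qed.

Lemma aut_inj f : aut f -> injective f.
Proof. by move=> [/bij_inj]. Qed.

Lemma aut_nb f x : aut f -> nb (f x) = f @` nb x.
Proof.
move=> Hf; have [g [_ fK gK]] := aut_inv Hf; have [_ H] := Hf.
apply/fsetP => y; apply/idP/imfsetP => /= [yf|[z zx ->]]; last by rewrite H.
by exists (g y); rewrite ?gK // -H gK.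
Qed.

Lemma aut_B f x z r : aut f -> (f z \in B nb (f x) r) = (z \in B nb x r).
Proof.
move=> Hf; suff H g x' z' : aut g -> z' \in B nb x' r -> g z' \in B nb (g x') r.
  apply/idP/idP => [|]; last exact: H.
  by have [g [Hg fK gK]] := aut_inv Hf => /(H _ _ _ Hg); rewrite !fK.
move=> [_ Hg]; elim: r z' => [|r IH] z' /=; first by rewrite !inE => /eqP ->.
move=> /in_BS[y /IH yB zy]; apply/in_BS; exists (g y) => //.
by move: zy; rewrite !in_cnb Hg => /orP[/eqP ->|->]; rewrite ?eqxx ?orbT.
Qed.

Lemma aut_BE f x r : aut f -> B nb (f x) r = f @` B nb x r.
Proof.
move=> Hf; have [g [_ fK gK]] := aut_inv Hf.
apply/fsetP => z; apply/idP/imfsetP => /= [zf|[w wx ->]]; last by rewrite aut_B.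
by exists (g z); rewrite ?gK // -(aut_B _ _ _ Hf) gK.
Qed.

Lemma card_autB f x r : aut f -> #|` B nb (f x) r| = #|` B nb x r|.
Proof. by move=> Hf; rewrite aut_BE // card_imfset //; exact: aut_inj. Qed.

Lemma big_imfset_inj (f : V -> V) (A : {fset V}) (F : V -> nat) : injective f ->
  (\sum_(x <- f @` A) F x = \sum_(x <- A) F (f x))%N.
Proof. by move=> fI; rewrite big_imfset //= => ? ? _ _; exact: fI. Qed.

Lemma bd_aut f A : aut f -> bd nb (f @` A) = bd nb A.
Proof.
move=> Hf; have fI := aut_inj Hf; rewrite /bd big_imfset_inj //.
apply: eq_bigr => x _; rewrite (aut_nb _ Hf) big_imfset_inj //.
by apply: eq_bigr => y _; rewrite (mem_imfset _ _ fI).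
Qed.

Variables (reps : seq V).
Hypothesis repsP : forall v, exists r f, [/\ r \in reps, aut f & f r = v].
Hypothesis conn : forall x y, exists r, y \in B nb x r.

Definition orb x y := exists2 f, aut f & f x = y.

Lemma orb_refl x : orb x x. Proof. by exists id; [exact: aut_id|]. Qed.
Lemma orb_sym x y : orb x y -> orb y x.
Proof. by move=> [f Hf <-]; have [g [Hg fK _]] := aut_inv Hf; exists g; rewrite ?fK. Qed.
Lemma orb_trans x y z : orb x y -> orb y z -> orb x z.
Proof. by move=> [f Hf <-] [g Hg <-]; exists (g \o f); [exact: aut_comp|]. Qed.

Lemma orb_nb x y z : orb x y -> z \in nb x -> exists2 w, w \in nb y & orb z w.
Proof. by move=> [f Hf <-] zx; exists (f z); [rewrite (proj2 Hf)|exists f]. Qed.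

(* Classes of representatives met by the ball [B v j]; the count grows with [j]
   until the set of classes is closed under adjacency, i.e. is everything. *)
Lemma orb_near x v : exists2 w, orb x w & w \in B nb v (size reps).
Proof.
pose O j := [seq r <- undup reps | `[< exists2 w, orb r w & w \in B nb v j >]].
have Osub j : {subset O j <= O j.+1}.
  move=> r; rewrite !mem_filter => /andP[/asboolP[w rw wB] ->]; rewrite andbT.
  by apply/asboolP; exists w => //; apply: B_mono wB.
have Ou j : uniq (O j) by rewrite filter_uniq ?undup_uniq.
have full j : {subset O j.+1 <= O j} -> forall s y, y \in B nb v s ->
    exists2 w, orb y w & w \in B nb v j.
  move=> sub; elim=> [|s IH] y; first by rewrite /= inE => /eqP ->; exists v; [exact: orb_refl|exact: Bid].
  move=> /in_BS[z /IH[w zw wB]]; rewrite in_cnb => /orP[/eqP ->|yz]; first by exists w.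
  have [y' y'w yy'] := orb_nb zw yz.
  have [r [f [rr Hf fr]]] := repsP y'.
  have : r \in O j.+1.
    rewrite mem_filter mem_undup rr andbT; apply/asboolP; exists y'; first by exists f.
    exact: nbB wB y'w.
  move=> /sub; rewrite mem_filter => /andP[/asboolP[w' rw' w'B] _].
  exists w' => //; apply: orb_trans yy' _; apply: orb_trans rw'; apply: orb_sym; by exists f.
have [s xB] := conn v x.
have [/existsP[j /asboolP Hj]|/existsPn Hn] := boolP [exists j : 'I_(size reps), `[< {subset O j.+1 <= O j} >]].
  have [w xw wB] := full _ Hj _ _ xB; exists w => //.
  by apply: B_mono wB; exact: ltnW.
have: forall j, (j <= size reps)%N -> (j < size (O j))%N.
  elim=> [|j IH] jn.
    have [r [f [rr Hf fr]]] := repsP v.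
    suff : r \in O 0%N by case: (O 0%N).
    rewrite mem_filter mem_undup rr andbT; apply/asboolP; exists v; [by exists f|exact: Bid].
  apply: leq_ltn_trans (IH (ltnW jn)) _; rewrite ltnNge; apply/negP => le.
  have := Hn (Ordinal jn); rewrite /= => /asboolP; apply.
  have [+ _] := uniq_min_size (Ou j) (@Osub j) le => _.
  by have [_ E] := uniq_min_size (Ou j) (@Osub j) le; move=> r; rewrite E.
move=> /(_ _ (leqnn _)); rewrite ltnNge; case/negP.
by rewrite size_filter (leq_trans (count_size _ _)) // size_undup.
Qed.

End Automorphisms.

(** * Outer vertex boundary *)

Section OuterBoundary.
Local Open Scope fset_scope.
Variables (V : choiceType) (nb : V -> {fset V}).
Hypothesis nbC : forall x y, (y \in nb x) = (x \in nb y).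
Variable k : nat.
Hypothesis nbk : forall x, (#|` nb x| <= k)%N.

Definition obd (A : {fset V}) := (\bigcup_(x <- A) nb x) `\` A.

Lemma obdP A y : reflect (y \notin A /\ exists2 x, x \in A & y \in nb x) (y \in obd A).
Proof.
rewrite in_fsetD; apply: (iffP andP) => -[yA H]; split=> //.
  by move/bigfcupP: H => [x /andP[xA _] yx]; exists x.
by apply/bigfcupP; case: H => x xA yx; exists x; rewrite ?xA.
Qed.

(** The first vertex outside [A] on a path from [y] to [z] serves as [w]. *)
Lemma exit (A : {fset V}) y z s : y \in A -> z \in B nb y s -> z \notin A ->
  exists2 w, w \in obd A & z \in B nb w s.
Proof.
elim: s y => [|s IH] y yA; first by rewrite /= inE => /eqP ->; rewrite yA.
move=> /B_step[w wy zw] zA; have [wA|wA] := boolP (w \in A).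
  by have [u uA zu] := IH _ wA zw zA; exists u => //; apply: B_mono zu.
exists w; last exact: B_mono zw.
apply/obdP; split=> //; exists y => //; move: wy; rewrite in_cnb => /orP[/eqP E|//].
by rewrite E yA in wA.
Qed.

Lemma bd_obd A : (bd nb A <= k * #|` obd A|)%N.
Proof.
rewrite /bd card_fset_sum1 big_distrr /=.
have -> : (\sum_(x <- A) \sum_(y <- nb x) (y \notin A) =
   \sum_(x <- A) \sum_(y <- obd A) (y \in nb x))%N.
  rewrite big_seq [RHS]big_seq; apply: eq_bigr => x xA.
  rewrite !sumb_card; congr #|` _|; apply/fsetP => y; rewrite !in_sep.
  apply/andP/andP => -[H1 H2]; split=> //; last by case/obdP: H1.
  by apply/obdP; split=> //; exists x.
rewrite exchange_big leq_sum //= => y _; rewrite muln1.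
rewrite sumb_card (leq_trans _ (nbk y)) // fsubset_leq_card //.
by apply/fsubsetP => x; rewrite in_sep => /andP[_]; rewrite nbC.
Qed.

Lemma obd_bd A : (#|` obd A| <= bd nb A)%N.
Proof.
rewrite /obd /bd; apply: (@leq_trans (\sum_(x <- A) #|` [fset y in nb x | y \notin A]|)); last first.
  by rewrite leq_sum // => x _; rewrite sumb_card.
rewrite (_ : _ `\` _ = \bigcup_(x <- A) [fset y in nb x | y \notin A]); last first.
  apply/fsetP => y; apply/obdP/bigfcupP => [[yA [x xA yx]]|[x /andP[xA _]]].
    by exists x; rewrite ?xA // !inE /= yx.
  by rewrite !inE /= => /andP[yx yA]; split=> //; exists x.
elim/big_ind2: _ => [|n1 A1 n2 A2 H1 H2|//]; first by rewrite cardfs0.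
by rewrite cardfsU (leq_trans (leq_subr _ _)) // leq_add.
Qed.

Lemma obd_B x r : obd (B nb x r) = B nb x r.+1 `\` B nb x r.
Proof.
apply/fsetP => y; apply/obdP/fsetDP => [[yB [z zB yz]]|[/in_BS[z zB] + yB]].
  by split=> //; exact: nbB zB yz.
rewrite in_cnb => /orP[/eqP E|yz]; first by rewrite E zB in yB.
by split=> //; exists z.
Qed.

End OuterBoundary.

(** * From superlinear to quadratic volume growth *)

Section Growth.
Local Open Scope fset_scope.
Variables (V : choiceType) (nb : V -> {fset V}).
Hypothesis nbC : forall x y, (y \in nb x) = (x \in nb y).
Variable k : nat.
Hypothesis nbk : forall x, (#|` nb x| <= k)%N.
Variables (reps : seq V).
Hypothesis repsP : forall v, exists r f, [/\ r \in reps, aut nb f & f r = v].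
Hypothesis conn : forall x y, exists r, y \in B nb x r.
Let n := size reps.
Let d := (2 * n).+1.
Variable o : V.
Hypothesis SL : forall C, exists r, (C * r.+1 < #|` B nb o r|)%N.

Lemma fset_in_ball x (A : {fset V}) : exists a, A `<=` B nb x a.
Proof.
elim/finSet_rect: A => A IH.
have [->|[y yA]] := fset_0Vmem A; first by exists 0%N; exact: fsub0set.
have [a Ha] := IH _ (fproperD1 yA); have [b Hb] := conn x y.
exists (a + b)%N; apply/fsubsetP => z zA; have [->|zy] := eqVneq z y.
  by apply: B_mono Hb; rewrite leq_addl.
apply: (B_mono (leq_addr b a)); apply: (fsubsetP Ha); by rewrite in_fsetD1 zy.
Qed.

(** Outside [F r], the ball of radius [r + a + 1] contains only points within [a + 1] of the outer
    boundary of [F r], which has at most [j] vertices. Ball volumes thus grow by a bounded amount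
    per step, against [SL]. *)
Lemma thin_exhaustion_false x a j (F : nat -> {fset V}) :
  (forall r, B nb x r `<=` F r) -> (forall r, F r `<=` B nb x (r + a)) ->
  (forall r, (bd nb (F r) <= j)%N) -> False.
Proof.
move=> F1 F2 Fj; pose K := (j * k.+1 ^ a.+1)%N.
have step r : (#|` B nb x (r + a.+1)| <= #|` B nb x (r + a)| + K)%N.
  have sub : B nb x (r + a.+1) `<=` F r `|` \bigcup_(w <- obd nb (F r)) B nb w a.+1.
    apply/fsubsetP => z /B_split[y yB zy]; rewrite in_fsetU.
    have [//|zF /=] := boolP (z \in F r).
    have [w wF zw] := exit (fsubsetP (F1 r) _ yB) zy zF.
    by apply/bigfcupP; exists w; rewrite ?wF.
  rewrite (leq_trans (fsubset_leq_card sub)) // cardfsU (leq_trans (leq_subr _ _)) //.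
  rewrite leq_add ?fsubset_leq_card //.
  rewrite (leq_trans (card_bigfcup_le (c := (k.+1 ^ a.+1)%N) _)) //.
    by move=> w _; exact: card_B.
  by rewrite leq_mul2r (leq_trans (obd_bd _ _)) ?orbT.
have lin r : (#|` B nb x (r + a)| <= #|` B nb x a| + r * K)%N.
  elim: r => [|r IH]; first by rewrite mul0n addn0.
  by rewrite addSnnS (leq_trans (step r)) // mulSn addnCA addnC leq_add.
have [s xo] := conn x o.
have [r] := SL (#|` B nb x a| + s * K + K)%N; apply/negP; rewrite -leqNgt.
have sub : B nb o r `<=` B nb x (r + s + a).
  apply/fsubsetP => z zB; apply: (B_mono (leq_addr _ _)); rewrite addnC; exact: B_trans xo zB.
rewrite (leq_trans (fsubset_leq_card sub)) // (leq_trans (lin _)) //; nia.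
Qed.

(** Induction on [j]. Suppose that [A] contains a ball of radius [(j + 1) d] and has at most [j]
    boundary edges. Translates of [A] centred at orbit points at distance at most [d] meet in a set
    containing a ball of radius [j d], hence with at least [j] boundary edges, and submodularity
    leaves at most [j] for their union. Gluing translates along the whole orbit of [x] gives a thin
    exhaustion. *)
Lemma bd_inradius j x (A : {fset V}) : B nb x (j * d) `<=` A -> (j <= bd nb A)%N.
Proof.
elim: j x A => // j IH x A BA; rewrite ltnNge; apply/negP => Aj.
(* The translate of [A] centred at [q]; the default [fset0] only concerns points [q] outside the
   orbit of [x]. *)
pose T q := if pselect (exists2 f, aut nb f & f x = q) is left H
  then s2val (cid2 H) @` A else fset0.
have TP q : orb nb x q -> [/\ B nb q (j.+1 * d) `<=` T q, (bd nb (T q) <= j)%N &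
     forall a, A `<=` B nb x a -> T q `<=` B nb q a].
  move=> H; have [f Hf [<- ->]] : exists2 f, aut nb f & f x = q /\ T q = f @` A.
    by rewrite /T; case: pselect => // H'; case: cid2 => f Hf fx; exists f.
  split.
  - by rewrite (aut_BE _ _ Hf); apply/fsubsetP => z /imfsetP[w /= wB ->]; rewrite mem_imfset ?(fsubsetP BA) //; exact: aut_inj Hf.
  - by rewrite bd_aut.
  - by move=> a Ha; rewrite (aut_BE _ _ Hf); apply/fsubsetP => z /imfsetP[w /= wB ->]; rewrite mem_imfset ?(fsubsetP Ha) //; exact: aut_inj Hf.
have add (F : {fset V}) c q : orb nb x c -> orb nb x q -> q \in B nb c d -> T c `<=` F ->
    (bd nb F <= j)%N -> (bd nb (F `|` T q) <= j)%N.
  move=> oc oq qc cF Fj; have [Bc _ _] := TP _ oc; have [Bq Tq _] := TP _ oq.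
  have : (j <= bd nb (F `&` T q))%N.
    apply: (IH q); rewrite fsubsetI; apply/andP; split; apply/fsubsetP => z zq.
      by apply: (fsubsetP cF); apply: (fsubsetP Bc); rewrite mulSn; exact: B_trans qc zq.
    by apply: (fsubsetP Bq); apply: B_mono zq; rewrite mulSn leq_addl.
  have := bd_submod nb F (T q); lia.
have adds (s : seq V) (F : {fset V}) : (forall q, q \in s -> orb nb x q /\ exists c,
     [/\ orb nb x c, q \in B nb c d & T c `<=` F]) -> (bd nb F <= j)%N ->
    (bd nb (F `|` \bigcup_(q <- s) T q) <= j)%N.
  elim: s F => [|q s IHs] F Hs Fj; first by rewrite big_nil fsetU0.
  rewrite big_cons fsetUA; apply: IHs.
    move=> q' q's; have q'in : q' \in q :: s by rewrite inE q's orbT.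
    have [oq' [c [oc q'c cF]]] := Hs q' q'in.
    split=> //; exists c; split=> //; exact: fsubset_trans cF (fsubsetUl _ _).
  have [oq [c [oc qc cF]]] := Hs q (mem_head _ _); exact: add qc cF Fj.
(* Centres of translates: orbit points within [n] of the ball of radius [r]. A new centre is within
   [n + 1 + n = d] of an older one, whence the value of [d]. *)
pose C r := [fset q in \bigcup_(v <- B nb x r) B nb v n | `[< orb nb x q >]].
have CP r q : reflect (orb nb x q /\ exists2 v, v \in B nb x r & q \in B nb v n) (q \in C r).
  rewrite in_sep; apply: (iffP andP) => [[/bigfcupP[v /andP[vB _] qv] /asboolP oq]|[oq [v vB qv]]].
    by split=> //; exists v.
  by split; [apply/bigfcupP; exists v; rewrite ?vB|apply/asboolP].
pose F r := \bigcup_(q <- C r) T q.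
have FT r q : q \in C r -> T q `<=` F r by move=> qC; exact: bigfcup_sup.
have [a Aa] := fset_in_ball x A.
have Cmono r : C r `<=` C r.+1.
  by apply/fsubsetP => q /CP[oq [v vB qv]]; apply/CP; split=> //; exists v => //; apply: B_mono vB.
apply: (@thin_exhaustion_false x (n + a) j F).
- move=> r; apply/fsubsetP => v vB.
  have [q xq qv] := orb_near repsP conn x v.
  have qC : q \in C r by apply/CP; split=> //; exists v.
  apply: (fsubsetP (FT _ _ qC)); have [Bq _ _] := TP _ xq; apply: (fsubsetP Bq).
  by rewrite B_sym //; apply: B_mono qv; rewrite /d /n mulSn; lia.
- move=> r; apply/bigfcupsP => q /CP[oq [v vB qv]] _; have [_ _ /(_ _ Aa)] := TP _ oq.
  move=> /fsubset_trans; apply; apply/fsubsetP => z zq.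
  by apply: (B_trans vB); exact: B_trans qv zq.
- have xC : x \in C 0%N by apply/CP; split; [exact: orb_refl|exists x; exact: Bid].
  have base : (bd nb (F 0%N) <= j)%N.
    have -> : F 0%N = T x `|` F 0%N by apply/esym/fsetUidPr/FT.
    apply: adds; last by have [] := TP _ (orb_refl nb x).
    move=> q /CP[oq [v vB qv]]; split=> //; exists x; split=> //; first exact: orb_refl.
    by move: vB; rewrite /= inE => /eqP E; rewrite E in qv; apply: (@B_mono _ nb x n d _ q qv); rewrite /d; lia.
  elim=> [//|r IHr]; have -> : F r.+1 = F r `|` F r.+1.
    apply/esym/fsetUidPr/bigfcupsP => q qC _; apply: FT; exact: (fsubsetP (Cmono r)).
  apply: adds => // q /CP[oq [v /in_BS[w wB vw] qv]]; split=> //.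
  have [c xc cw] := orb_near repsP conn x w.
  exists c; split=> //; last by apply: FT; apply/CP; split=> //; exists w.
  have -> : d = (n + (1 + n))%N by rewrite /d; lia.
  apply: (@B_trans _ nb _ w); first by rewrite B_sym.
  by apply: B_trans qv; rewrite B1.
Qed.

(** A ball of radius at least [j d] has at least [j] boundary edges, so each further step adds [j]
    to [k] times its volume; summing over radii gives quadratic growth. The term [4 d^2] covers $r
    \le 2d$, and the factor 9 comes from $2(j+1)^2 \le 9j(j-1)$ for $j \ge 2$. *)
Lemma quadratic_growth x r : (r * r <= (9 * d * k + 4 * (d * d)) * #|` B nb x r|)%N.
Proof.
have step s j : (j * d <= s)%N -> (k * #|` B nb x s| + j <= k * #|` B nb x s.+1|)%N.
  move=> js; have: (j <= bd nb (B nb x s))%N.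
    by apply: (@bd_inradius _ x); apply/fsubsetP => z; exact: B_mono.
  have sub : B nb x s `<=` B nb x s.+1 by apply/fsubsetP => z; exact: B_mono.
  move=> /leq_trans/(_ (bd_obd nbC nbk _)); rewrite obd_B cardfsDS //.
  have := fsubset_leq_card sub; move: (#|` _|) (#|` _|) => p q; nia.
have stepd j i : (k * #|` B nb x (j * d)| + i * j <= k * #|` B nb x (j * d + i)|)%N.
  elim: i => [|i IH]; first by rewrite mul0n !addn0.
  by rewrite addnS; have := step (j * d + i)%N j (leq_addr _ _); lia.
have vol j : (d * (j * j.-1) <= 2 * k * #|` B nb x (j * d)|)%N.
  elim: j => [|j IH]; first by rewrite mul0n muln0.
  have H := stepd j d; have E : (j * d + d = j.+1 * d)%N by rewrite mulSnr.
  rewrite E in H; clear E; move: H IH; move: (#|` B nb x (j * d)|) (#|` B nb x (j.+1 * d)|) => p q H IH.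
  case: j IH H => [|j] IH H; first by lia.
  move: IH H; rewrite /=; nia.
have dpos : (0 < d)%N by [].
pose j := (r %/ d)%N; have rj : (r < j.+1 * d)%N by rewrite ltn_ceil.
have jr : (j * d <= r)%N by rewrite leq_trunc_div.
have V1 : (0 < #|` B nb x r|)%N by rewrite cardfs_gt0; apply/fset0Pn; exists x; exact: Bid.
have Vj : (#|` B nb x (j * d)| <= #|` B nb x r|)%N.
  by apply: fsubset_leq_card; apply/fsubsetP => z; exact: B_mono.
move: V1 Vj rj (vol j); move: (#|` B nb x r|) (#|` B nb x (j * d)|) => v w.
move: j {jr vol stepd step} => j V1 wv rj H.
have [j1|j2] := leqP j 1.
  have r2d : (r <= 2 * d)%N by apply: ltnW; apply: (leq_trans rj); rewrite leq_mul2r ltnS j1 orbT.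
  apply: (@leq_trans (4 * (d * d))).
    by apply: (leq_trans (leq_mul r2d r2d)); rewrite mulnACA.
  by apply: (leq_trans (leq_addl (9 * d * k) _)); exact: leq_pmulr.
have H1 : (d * (j * j.-1) <= 2 * k * v)%N by apply: (leq_trans H); rewrite leq_mul2l wv orbT.
have H2 : (r * r <= (j.+1 * j.+1) * (d * d))%N.
  by rewrite mulnACA; apply: leq_mul; exact: ltnW.
have H3 : (2 * (j.+1 * j.+1) <= 9 * (j * j.-1))%N.
  by case: j j2 {rj wv H H1 H2} => [|[|j]] //= _; nia.
rewrite -(leq_pmul2l (isT : (0 < 2)%N)).
apply: (@leq_trans (2 * (j.+1 * j.+1) * (d * d))); first by rewrite -mulnA leq_mul2l H2 orbT.
apply: (@leq_trans (9 * (j * j.-1) * (d * d))); first by rewrite leq_mul2r H3 orbT.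
apply: (@leq_trans (9 * d * (d * (j * j.-1)))).
  by move: (j * j.-1)%N => c; lia.
apply: (leq_trans (leq_mul (leqnn _) H1)); rewrite mulnDl; move: (d * d)%N => dd.
rewrite mulnDr; apply: leq_trans (leq_addr _ _); lia.
Qed.

End Growth.

(** * The modular function and the mass transport principle *)

Section StabilizerOrbits.
Local Open Scope fset_scope.
Variables (V : choiceType) (nb : V -> {fset V}).
Hypothesis nbC : forall x y, (y \in nb x) = (x \in nb y).
Hypothesis conn : forall x y, exists r, y \in B nb x r.
Implicit Types x y z : V.

(** Some radius about [x] that reaches [z]; it confines the orbits of the stabilizer of [x] to a
    finite set. *)
Definition rad x z := projT1 (cid (conn x z)).
Lemma radP x z : z \in B nb x (rad x z).
Proof. by rewrite /rad; case: cid. Qed.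

Definition so x z := [fset z' in B nb x (rad x z) |
  `[< exists f, [/\ aut nb f, f x = x & f z = z'] >]].

Lemma soP x z z' : reflect (exists f, [/\ aut nb f, f x = x & f z = z']) (z' \in so x z).
Proof.
rewrite in_sep; apply: (iffP andP) => [[_ /asboolP//]|H]; split; last exact/asboolP.
by have [f [Hf fx <-]] := H; rewrite -[X in B nb X]fx aut_B // radP.
Qed.

Definition so2 x z y := [fset y' in B nb x (rad x y) |
  `[< exists f, [/\ aut nb f, f x = x, f z = z & f y = y'] >]].

Lemma so2P x z y y' :
  reflect (exists f, [/\ aut nb f, f x = x, f z = z & f y = y']) (y' \in so2 x z y).
Proof.
rewrite in_sep; apply: (iffP andP) => [[_ /asboolP//]|H]; split; last exact/asboolP.
by have [f [Hf fx _ <-]] := H; rewrite -[X in B nb X]fx aut_B // radP.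
Qed.

(** The index, in the stabilizer of [x], of the common stabilizer of [x] and [z]. *)
Definition a x z := #|` so x z|.

Lemma a_gt0 x z : (0 < a x z)%N.
Proof.
rewrite cardfs_gt0; apply/fset0Pn; exists z; apply/soP; exists id.
by split=> //; exact: aut_id.
Qed.

Lemma so2_gt0 x z y : (0 < #|` so2 x z y|)%N.
Proof.
rewrite cardfs_gt0; apply/fset0Pn; exists y; apply/so2P; exists id.
by split=> //; exact: aut_id.
Qed.

Lemma a_aut f x z : aut nb f -> a (f x) (f z) = a x z.
Proof.
move=> Hf; have [g [Hg fK gK]] := aut_inv Hf; have fI := aut_inj Hf.
rewrite /a -[RHS](card_im _ fI); congr #|` _|.
apply/fsetP => y; apply/soP/imfsetP => /= [[h [Hh hx hz]]|[w /soP[h [Hh hx hz]] ->]].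
  exists (g y); rewrite ?gK //; apply/soP; exists (g \o (h \o f)); split=> /=.
  - by apply: aut_comp => //; exact: aut_comp.
  - by rewrite hx fK.
  - by rewrite hz.
exists (f \o (h \o g)); split=> /=; rewrite ?fK ?hx ?hz //.
by apply: aut_comp => //; exact: aut_comp.
Qed.

Lemma a_le_card x z r : z \in B nb x r -> (a x z <= #|` B nb x r|)%N.
Proof.
move=> zB; apply: fsubset_leq_card; apply/fsubsetP => w /soP[f [Hf fx <-]].
by rewrite -[X in B nb X]fx aut_B.
Qed.

Lemma card_fibers (T : {fset V * V}) (S : {fset V}) c : (forall p, p \in T -> p.1 \in S) ->
  (forall z, z \in S -> #|` [fset p in T | p.1 == z]| = c) -> #|` T| = (#|` S| * c)%N.
Proof.
move=> TS HS; rewrite (card_fset_sum1 S) big_distrl /=.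
rewrite (eq_big_seq (fun z => \sum_(p <- T) (p.1 == z))%N); last first.
  by move=> z zS; rewrite mul1n -(HS z zS) sumb_card.
rewrite exchange_big card_fset_sum1 /= big_seq [RHS]big_seq; apply: eq_bigr => p /TS pS.
rewrite (big_fsetD1 p.1) //= eqxx big1_fset ?addn0 // => z.
by rewrite in_fsetD1 eq_sym => /andP[/negPf ->].
Qed.

Lemma pair_orbit_card x z y :
  exists T : {fset V * V}, (forall u w,
     (u, w) \in T <-> exists f, [/\ aut nb f, f x = x, f z = u & f y = w]) /\
  #|` T| = (a x z * #|` so2 x z y|)%N.
Proof.
pose T := [fset p in so x z `*` so x y |
  `[< exists f, [/\ aut nb f, f x = x, f z = p.1 & f y = p.2] >]].
have TP u w : (u, w) \in T <-> exists f, [/\ aut nb f, f x = x, f z = u & f y = w].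
  rewrite in_sep; split=> [/andP[_ /asboolP//]|H]; apply/andP; split; last exact/asboolP.
  have [f [Hf fx fz fy]] := H; rewrite in_fsetM /=.
  by apply/andP; split; apply/soP; exists f.
exists T; split=> //; apply: card_fibers => [p|u /soP[h [Hh hx hz]]].
  by rewrite in_sep in_fsetM => /andP[/andP[]].
have [g [Hg hK gK]] := aut_inv Hh; have hI := aut_inj Hh.
have gx : g x = x by rewrite -[in LHS]hx hK.
have pI : injective (fun w => (u, h w)) by move=> w w' [/hI].
rewrite -[RHS](card_im _ pI); congr #|` _|.
apply/fsetP => -[u' w]; rewrite in_sep /=; apply/andP/imfsetP => /=.
  move=> [/TP[f [Hf fx fz fy]] /eqP uu]; rewrite uu.
  exists (g w); last by rewrite gK.
  apply/so2P; exists (g \o f); split=> /=.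
  - exact: aut_comp.
  - by rewrite fx.
  - by rewrite fz uu -hz hK.
  - by rewrite fy.
move=> [w' /so2P[f [Hf fx fz fy]] [-> ->]]; split=> //; apply/TP; exists (h \o f).
by split=> /=; rewrite ?fx ?fz ?fy //; exact: aut_comp.
Qed.

(** Both sides count the orbit of the pair formed by [z] and [y] under the stabilizer of [x], fibred
    over either coordinate. *)
Lemma a_so2 x z y : (a x z * #|` so2 x z y| = a x y * #|` so2 x y z|)%N.
Proof.
have [T [TP <-]] := pair_orbit_card x z y; have [T' [T'P <-]] := pair_orbit_card x y z.
have sI : injective (fun p : V * V => (p.2, p.1)) by move=> [? ?] [? ?] [-> ->].
rewrite -[LHS](card_im _ sI); congr #|` _|.
apply/fsetP => -[w u]; apply/imfsetP/idP => /= [[[u' w'] /TP[f [? ? ? ?]] [-> ->]]|/T'P[f [? ? ? ?]]].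
  by apply/T'P; exists f.
by exists (u, w) => //; apply/TP; exists f.
Qed.

Lemma so2C x z y : so2 x z y = so2 z x y.
Proof.
by apply/fsetP => w; apply/so2P/so2P => -[f [? ? ? ?]]; exists f.
Qed.

(* [a x z / a z x] is the modular cocycle of the automorphism group. *)
Lemma a_cocycle x z y : (a x z * a z y * a y x = a z x * a y z * a x y)%N.
Proof.
have := a_so2 x z y; have := a_so2 z y x; have := a_so2 y x z.
rewrite (so2C y x) (so2C y z) (so2C z x).
have := so2_gt0 x z y; have := so2_gt0 x y z; have := so2_gt0 z y x.
move: #|` so2 x z y| #|` so2 x y z| #|` so2 z y x| => b1 b2 b3 p1 p2 p3 E3 E2 E1.
apply/eqP; rewrite -(eqn_pmul2r p1) -(eqn_pmul2r p2) -(eqn_pmul2r p3); apply/eqP.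
transitivity ((a x z * b1) * (a z y * b3) * (a y x * b2))%N; first by lia.
by rewrite E1 E2 E3; lia.
Qed.

Variable k : nat.
Hypothesis nbk : forall x, (#|` nb x| <= k)%N.
Variables (reps : seq V).
Hypothesis repsP : forall v, exists r f, [/\ r \in reps, aut nb f & f r = v].
Let n := size reps.
Let d := (2 * n).+1.

Hypothesis short_bal : forall x z, orb nb x z -> z \in B nb x d -> a x z = a z x.

(** The cocycle is multiplicative, and two points of an orbit are joined by a chain of orbit points
    with steps of length at most [d], so balance of the short pairs propagates. *)
Lemma balanced x z : orb nb x z -> a x z = a z x.
Proof.
suff H r v : v \in B nb x r -> forall z, orb nb x z -> z \in B nb v n -> a x z = a z x.
  by move=> xz; have [r zB] := conn x z; apply: (H r z) => //; exact: Bid.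
elim: r v => [|r IH] v.
  rewrite /= inE => /eqP -> w xw wB; apply: short_bal => //.
  by apply: (@B_mono _ nb x n d _ w wB); rewrite /d; lia.
move=> /in_BS[w wB vw] u xu uv.
have [q xq qw] := orb_near repsP conn x w.
have E1 := IH _ wB _ xq qw.
have E2 : a q u = a u q.
  apply: short_bal; first exact: orb_trans (orb_sym xq) xu.
  have -> : d = (n + (1 + n))%N by rewrite /d; lia.
  by apply: (@B_trans _ nb _ w); [rewrite B_sym|apply: B_trans uv; rewrite B1].
have := a_cocycle x q u; rewrite E1 E2 => /eqP.
by rewrite eqn_pmul2l ?muln_gt0 ?a_gt0 // => /eqP.
Qed.

(** Points of different orbits need not be balanced. By the cocycle identity, replacing [x] by a
    point [q] of its orbit within [n] of [z] keeps the ratio, and [a z q] is at most the volume of a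
    ball of radius [n]. *)
Lemma a_ratio x z : (a z x <= k.+1 ^ n * a x z)%N.
Proof.
have [q xq qz] := orb_near repsP conn x z.
have := a_cocycle x q z; rewrite (balanced xq) -!mulnA => /eqP.
rewrite eqn_pmul2l ?a_gt0 // => /eqP E.
apply: (@leq_trans (a q z * a z x)); first by rewrite leq_pmull // a_gt0.
rewrite E leq_mul2r; apply/orP; right.
by rewrite (leq_trans (a_le_card qz)) // card_B.
Qed.

Local Open Scope ring_scope.
Variable R : realFieldType.

(** The mass [c x z] is shared equally among the [a x z] images [z'] of [z] under automorphisms
    taking [x] to its representative [o]. For fixed [o] and [z'], the contributing points [x] lie in
    one orbit of the stabilizer of [z], whose size [a z x] exceeds [a x z] at most by the factor of
    [a_ratio]. *)
Lemma mass_transport (c : V -> V -> R) z r : (forall x y, 0 <= c x y) ->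
  (forall f x y, aut nb f -> c (f x) (f y) = c x y) ->
  \sum_(x <- B nb z r) c x z <=
  (k.+1 ^ n)%:R * \sum_(o <- reps) \sum_(z' <- B nb o r) c o z'.
Proof.
move=> c0 cI; pose sim x z o z' := `[< exists f, [/\ aut nb f, f x = o & f z = z'] >].
have simc x o z' : sim x z o z' -> c x z = c o z'.
  by move=> /asboolP[f [Hf <- <-]]; rewrite cI.
have step x : x \in B nb z r -> c x z <= \sum_(o <- reps) \sum_(z' <- B nb o r)
     (sim x z o z')%:R * (c o z' / (a x z)%:R).
  move=> xB; have [o [f [oR Hf fo]]] := repsP x; have [g [Hg fK gK]] := aut_inv Hf.
  have gI := aut_inj Hg.
  apply: (@le_trans _ _ (\sum_(z' <- B nb o r) (sim x z o z')%:R * (c o z' / (a x z)%:R))); last first.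
    rewrite [X in _ <= X](big_rem o) //= lerDl sumr_ge0 // => o' _; rewrite sumr_ge0 // => z' _.
    by rewrite mulr_ge0 // divr_ge0.
  have gx : g x = o by rewrite -fo fK.
  have -> : c x z = \sum_(z' <- g @` so x z) (c o z' / (a x z)%:R).
    rewrite big_imfset /=; last by move=> ? ? _ _ /gI.
    rewrite (eq_big_seq (fun=> c x z / (a x z)%:R)); last first.
      move=> w /soP[h [Hh hx <-]]; by congr (_ / _); rewrite -gx cI // -{1}hx cI.
    rewrite big_const_seq count_predT iter_addr_0 -[X in _ = X]mulr_natr.
    by rewrite -[size _]/(a x z) divfK // pnatr_eq0 -lt0n a_gt0.
  have sub : g @` so x z `<=` B nb o r.
    apply/fsubsetP => _ /imfsetP[w /= /soP[h [Hh hx <-]] ->].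
    by rewrite -gx aut_B // -[X in B nb X]hx aut_B // B_sym.
  have E z' : sim x z o z' -> z' \in g @` so x z.
    move=> /asboolP[h [Hh hx hz]]; apply/imfsetP; exists (f z'); rewrite ?fK //=.
    apply/soP; exists (f \o h); split=> /=; rewrite ?hx ?hz //; exact: aut_comp.
  rewrite -[X in _ <= X](big_fset_incl _ sub) /=; last first.
    move=> z' _; apply: contraNeq; rewrite mulf_eq0 negb_or pnatr_eq0 eqb0 negbK.
    by move=> /andP[/E].
  rewrite big_seq [X in _ <= X]big_seq; apply: ler_sum => z' /imfsetP[w /= /soP[h [Hh hx hz]] ->].
  have -> : sim x z o (g w) by apply/asboolP; exists (g \o h); split=> /=; rewrite ?hx ?hz //; exact: aut_comp.
  by rewrite mul1r.
rewrite (@le_trans _ _ (\sum_(x <- B nb z r) \sum_(o <- reps) \sum_(z' <- B nb o r)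
     (sim x z o z')%:R * (c o z' / (a x z)%:R))) //.
  by rewrite big_seq [X in _ <= X]big_seq; apply: ler_sum => x; exact: step.
rewrite exchange_big mulr_sumr /=; apply: ler_sum => o _.
rewrite exchange_big mulr_sumr /=; apply: ler_sum => z' _.
rewrite (eq_bigr (fun x => c o z' * ((sim x z o z')%:R / (a x z)%:R))); last first.
  by move=> x _; rewrite mulrCA.
rewrite -mulr_sumr mulrC; apply: ler_wpM2r => //.
have [/hasP[x0 x0B x0s]|/hasPn none] := boolP (has (fun x => sim x z o z') (B nb z r)); last first.
  rewrite big1_seq ?ler0n // => x /andP[_ /none/negPf ->]; by rewrite mul0r.
have link x : sim x z o z' -> exists f, [/\ aut nb f, f x0 = x & f z = z].
  move: x0s => /asboolP[f [Hf fx fz]] /asboolP[h [Hh hx hz]].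
  have [g [Hg hK gK]] := aut_inv Hh; exists (g \o f); split=> /=; first exact: aut_comp.
    by rewrite fx -hx hK.
  by rewrite fz -hz hK.
rewrite (eq_bigr (fun x => (sim x z o z')%:R / (a x0 z)%:R)); last first.
  move=> x _; have [/link[f [Hf <- fz]]|] := boolP (sim x z o z'); last by rewrite !mul0r.
  by rewrite -[X in a _ X]fz a_aut.
rewrite -mulr_suml -natr_sum sumb_card ler_pdivrMr ?ltr0n ?a_gt0 // -natrM ler_nat.
apply: leq_trans (a_ratio x0 z); apply: fsubset_leq_card; apply/fsubsetP => x.
by rewrite in_sep => /andP[_ /link[f [Hf fx fz]]]; apply/soP; exists f.
Qed.

End StabilizerOrbits.

(** * Transport inequality and isoperimetry *)

Section Transport.
Local Open Scope fset_scope.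
Local Open Scope ring_scope.
Variables (V : choiceType) (nb : V -> {fset V}).
Hypothesis nbC : forall x y, (y \in nb x) = (x \in nb y).
Variable R : realFieldType.

(* Expected number of visits to [z] (endpoint excluded) of a lazy walk of [r]
   steps from [x] to [y], each step being uniform among those from which [y]
   can still be reached in time. *)
Fixpoint tw r x y z : R :=
  if r is r'.+1 then
    let N := [fset w in cnb nb x | y \in B nb w r'] in
    (z == x)%:R + (\sum_(w <- N) tw r' w y z) / #|` N|%:R
  else 0.

Lemma tw_ge0 r x y z : 0 <= tw r x y z.
Proof.
elim: r x => //= r IH x; rewrite addr_ge0 // divr_ge0 // sumr_ge0 // => w _; exact: IH.
Qed.

Lemma tw_support r x y z : z \notin B nb x r -> tw r x y z = 0.
Proof.
elim: r x => //= r IH x zB; have /negPf -> : z != x.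
  by apply: contraNneq zB => ->; exact: (Bid nb x r.+1).
rewrite add0r big1_seq ?mul0r // => w /andP[_]; rewrite in_sep => /andP[wx _].
apply: IH; apply: contra zB => zw; rewrite -[\bigcup_(_ <- _) _]/(B nb x r.+1) -add1n.
by apply: B_trans zw; rewrite B1.
Qed.

Lemma avg_le (N : {fset V}) (F : V -> R) c : 0 <= c -> (forall w, w \in N -> F w <= c) ->
  (\sum_(w <- N) F w) / #|` N|%:R <= c.
Proof.
move=> c0 H; have [->|N0] := eqVneq N fset0; first by rewrite big_seq_fset0 mul0r.
rewrite ler_pdivrMr ?ltr0n ?cardfs_gt0 // mulr_natr.
apply: (@le_trans _ _ (\sum_(w <- N) c)); last by rewrite big_const_seq count_predT iter_addr_0.
by rewrite big_seq [X in _ <= X]big_seq; exact: ler_sum.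
Qed.

Lemma avg_ge (N : {fset V}) (F : V -> R) c : N != fset0 -> (forall w, w \in N -> c <= F w) ->
  c <= (\sum_(w <- N) F w) / #|` N|%:R.
Proof.
move=> N0 H; rewrite ler_pdivlMr ?ltr0n ?cardfs_gt0 // mulr_natr.
apply: (@le_trans _ _ (\sum_(w <- N) c)); first by rewrite big_const_seq count_predT iter_addr_0.
by rewrite big_seq [X in _ <= X]big_seq; exact: ler_sum.
Qed.

Lemma sum_delta (U : {fset V}) x (F : V -> R) : x \in U -> \sum_(z <- U) (z == x)%:R * F z = F x.
Proof.
move=> xU; rewrite (big_fsetD1 x) //= eqxx mul1r big1_fset ?addr0 // => z.
by rewrite in_fsetD1 => /andP[/negPf -> _] _; rewrite mul0r.
Qed.

Lemma tw_sum r x y (U : {fset V}) : \sum_(z <- U) tw r x y z <= r%:R.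
Proof.
elim: r x => [|r IH] x /=; first by rewrite big1.
rewrite big_split /= -(natr1 r) addrC lerD //.
  by rewrite -mulr_suml exchange_big /= avg_le.
have [xU|xU] := boolP (x \in U).
  rewrite (eq_bigr (fun z => (z == x)%:R * (fun=> 1) z)) => [|z _]; last by rewrite mulr1.
  by rewrite (sum_delta (fun=> 1)).
rewrite big1_seq ?ler01 // => z /andP[_ zU]; case: eqP => // zx; by rewrite -zx zU in xU.
Qed.

Lemma sum_fset_le (A U : {fset V}) (F : V -> R) : A `<=` U ->
  (forall x, x \in U -> 0 <= F x) -> \sum_(x <- A) F x <= \sum_(x <- U) F x.
Proof.
move=> AU F0; rewrite [X in _ <= X](big_fsetID _ (mem A)) /=.
have -> : [fset x in U | x \in A] = A.
  by apply/fsetP => x; rewrite in_sep andb_idl // => /(fsubsetP AU).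
by rewrite lerDl big_seq sumr_ge0 // => x; rewrite in_sep => /andP[/F0].
Qed.

Definition grad (F : V -> R) z := \sum_(w <- nb z) `|F z - F w|.

Lemma grad_ge0 F z : 0 <= grad F z.
Proof. by rewrite sumr_ge0. Qed.

(** Along each trajectory the increments of [F] telescope, and each of them is at most the gradient
    at the vertex being left. *)
Lemma tw_grad (F : V -> R) r x y (U : {fset V}) : y \in B nb x r -> {subset B nb x r <= U} ->
  `|F x - F y| <= \sum_(z <- U) tw r x y z * grad F z.
Proof.
elim: r x => [|r IH] x.
  rewrite /= inE => /eqP -> _; rewrite subrr normr0 sumr_ge0 // => z _; by rewrite mul0r.
move=> yB BU; have xU : x \in U by apply: BU; exact: Bid.
rewrite (eq_bigr (fun z => (z == x)%:R * grad F z +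
  (\sum_(w <- [fset w in cnb nb x | y \in B nb w r]) tw r w y z * grad F z) /
     #|` [fset w in cnb nb x | y \in B nb w r]|%:R)); last first.
  by move=> z _ /=; rewrite mulrDl -mulr_suml mulrAC.
rewrite big_split /= sum_delta // -mulr_suml exchange_big /= -lerBlDl.
apply: avg_ge.
  have [w wx yw] := B_step yB; apply/fset0Pn; exists w; by rewrite in_sep wx.
move=> w; rewrite in_sep => /andP[wx yw].
have wU : {subset B nb w r <= U}.
  by move=> z zw; apply: BU; rewrite -add1n; apply: B_trans zw; rewrite B1.
rewrite lerBlDl (le_trans _ (lerD (_ : `|F x - F w| <= grad F x) (IH _ yw wU))) //.
  by rewrite -[F x - F y](subrKA (F w)) ler_normD.
move: wx; rewrite in_cnb => /orP[/eqP ->|wx]; first by rewrite subrr normr0 grad_ge0.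
rewrite /grad (big_fsetD1 w) //= lerDl sumr_ge0 //.
Qed.

Lemma tw_aut f r x y z : aut nb f -> tw r (f x) (f y) (f z) = tw r x y z.
Proof.
move=> Hf; have fI := aut_inj Hf; elim: r x => //= r IH x; rewrite (inj_eq fI).
have -> : [fset w in cnb nb (f x) | f y \in B nb w r] = f @` [fset w in cnb nb x | y \in B nb w r].
  have [g [Hg fK gK]] := aut_inv Hf.
  apply/fsetP => w; rewrite in_sep; apply/andP/imfsetP => /= [[wx yw]|[u]].
    exists (g w); rewrite ?gK // in_sep -(aut_B _ _ _ Hf) gK yw andbT.
    by rewrite -B1 -(aut_B _ _ _ Hf) gK B1.
  by rewrite in_sep -B1 => /andP[ux yu] ->; rewrite aut_B // -B1 aut_B.
rewrite card_im // big_imfset //=; last by move=> ? ? _ _ /fI.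
by congr (_ + _ / _); apply: eq_bigr => w _; exact: IH.
Qed.

Variable k : nat.
Hypothesis nbk : forall x, (#|` nb x| <= k)%N.
Variables (reps : seq V).
Hypothesis repsP : forall v, exists r f, [/\ r \in reps, aut nb f & f r = v].
Hypothesis conn : forall x y, exists r, y \in B nb x r.
Let n := size reps.
Hypothesis short_bal : forall x z, orb nb x z -> z \in B nb x (2 * n).+1 ->
  a conn x z = a conn z x.

(** A volume independent of the centre; [card_B_vol] and [vol_card_B] compare it with every ball of
    radius [r]. *)
Definition vol r : nat := \max_(o <- reps) #|` B nb o r|.

Lemma card_B_vol x r : (#|` B nb x r| <= vol r)%N.
Proof.
have [o [f [oR Hf <-]]] := repsP x.
by rewrite (card_autB _ _ Hf) /vol (big_rem o) //= leq_maxl.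
Qed.

Lemma vol_card_B x r : (vol r <= k.+1 ^ n * #|` B nb x r|)%N.
Proof.
rewrite /vol; apply/bigmax_leqP_seq => o oR _.
have [q oq qx] := orb_near repsP conn o x.
have [f Hf fo] := oq; rewrite -(card_autB o r Hf) fo.
rewrite mulnC; apply: leq_trans (card_BD nbk x r n).
apply: fsubset_leq_card; apply/fsubsetP => z zq; rewrite addnC; exact: B_trans qx zq.
Qed.

Lemma vol_gt0 r : V -> (0 < vol r)%N.
Proof.
move=> x; apply: leq_trans (card_B_vol x r).
by rewrite cardfs_gt0; apply/fset0Pn; exists x; exact: Bid.
Qed.

Lemma vol_mono r s : (r <= s)%N -> (vol r <= vol s)%N.
Proof.
move=> rs; rewrite /vol; apply/bigmax_leqP_seq => o oR _.
apply: leq_trans (card_B_vol o s); apply: fsubset_leq_card.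
by apply/fsubsetP => z; exact: B_mono.
Qed.

Definition CT := (k.+1 ^ n * n)%N.

(** Mass transport for [c x z], the expected number of visits to [z] by the walks from [x] to all
    points of its ball. A vertex sends at most [r] per walk, hence at most [r * vol r]; what [z]
    receives is the coefficient of [grad F z]. *)
Lemma transport (F : V -> R) r (X U : {fset V}) : (forall x, x \in X -> {subset B nb x r <= U}) ->
  \sum_(x <- X) \sum_(y <- B nb x r) `|F x - F y| <=
  (CT * (r * vol r))%:R * \sum_(z <- U) grad F z.
Proof.
move=> XU; pose c x z := \sum_(y <- B nb x r) tw r x y z.
have c0 x z : 0 <= c x z by rewrite sumr_ge0 // => y _; exact: tw_ge0.
have cI f x z : aut nb f -> c (f x) (f z) = c x z.
  move=> Hf; have fI := aut_inj Hf; rewrite /c (aut_BE _ _ Hf) big_imfset /=; last by move=> ? ? _ _ /fI.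
  by apply: eq_bigr => y _; rewrite tw_aut.
apply: (@le_trans _ _ (\sum_(x <- X) \sum_(z <- U) c x z * grad F z)).
  rewrite big_seq [X in _ <= X]big_seq; apply: ler_sum => x xX.
  rewrite [X in _ <= X](eq_bigr (fun z => \sum_(y <- B nb x r) tw r x y z * grad F z)); last first.
    by move=> z _; rewrite /c mulr_suml.
  rewrite [X in _ <= X]exchange_big /= big_seq [X in _ <= X]big_seq; apply: ler_sum => y yB.
  exact: tw_grad (XU _ xX).
rewrite exchange_big mulr_sumr /=; apply: ler_sum => z _.
rewrite -mulr_suml ler_wpM2r ?grad_ge0 //.
apply: (@le_trans _ _ (\sum_(x <- B nb z r) c x z)).
  apply: (@le_trans _ _ (\sum_(x <- X `|` B nb z r) c x z)); first by rewrite sum_fset_le ?fsubsetUl.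
  rewrite -(big_fset_incl _ (fsubsetUr X (B nb z r))) //= => x _.
  by rewrite B_sym // => xz; rewrite /c big1 // => y _; exact: tw_support.
apply: le_trans (mass_transport nbC nbk repsP short_bal z r c0 cI) _.
rewrite /CT -mulnA natrM ler_wpM2l //.
apply: (@le_trans _ _ (\sum_(o <- reps) (r * vol r)%:R)); last first.
  by rewrite big_const_seq count_predT iter_addr_0 -mulrnA mulnC.
apply: ler_sum => o _; rewrite exchange_big /= mulnC natrM.
apply: (@le_trans _ _ (\sum_(y <- B nb o r) r%:R)).
  by apply: ler_sum => y _; exact: tw_sum.
rewrite big_const_seq count_predT iter_addr_0 -mulrnA -natrM ler_nat mulnC leq_mul2r.
by rewrite card_B_vol orbT.
Qed.

Definition K1 := (2 * k.+1 ^ n)%N.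
Definition K2 := (2 * (K1 * CT))%N.

(** Transport inequality for the indicator of [P]: by the smallness of [P], at least half of every
    ball of radius [r] lies outside [P], so the left side is at least of order [#|P| * vol r]. *)
Lemma isoperimetry (P : {fset V}) r : (K1 * #|` P| <= vol r)%N ->
  (#|` P| <= K2 * r * bd nb P)%N.
Proof.
move=> Pv; pose F x : R := (x \in P)%:R.
have [U PU] : exists U : {fset V}, forall x, x \in P -> {subset B nb x r <= U}.
  exists (\bigcup_(x <- P) B nb x r) => x xP y yB.
  by apply/bigfcupP; exists x; rewrite ?xP.
have := transport F PU.
have gradF : \sum_(z <- U) grad F z <= (2 * bd nb P)%:R.
  pose W := U `|` (P `|` obd nb P).
  apply: (@le_trans _ _ (\sum_(z <- W) grad F z)).
    by apply: sum_fset_le; rewrite ?fsubsetUl // => x _; exact: grad_ge0.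
  have PW : P `<=` W by rewrite fsubsetU // fsubsetUl orbT.
  have E : \sum_(z <- W) grad F z = (\sum_(z <- W) \sum_(w <- nb z) ((z \in P) && (w \notin P)))%:R
      + (\sum_(z <- W) \sum_(w <- nb z) ((z \notin P) && (w \in P)))%:R :> R.
    rewrite !natr_sum -big_split /=; apply: eq_bigr => z _.
    rewrite !natr_sum -big_split /=; apply: eq_bigr => w _; rewrite /F.
    by case: (z \in P); case: (w \in P); rewrite ?subrr ?normr0 ?subr0 ?sub0r ?normrN ?normr1 ?addr0 ?add0r.
  rewrite E -natrD ler_nat mul2n -addnn leq_add //; first by rewrite (bdE _ PW).
  rewrite /bd; apply: (@leq_trans (\sum_(z <- W) \sum_(w <- P) ((w \in nb z) && (z \notin P)))%N).
    apply: leq_sum => z _; case: (z \in P) => /=; first by rewrite big1.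
    rewrite !sumb_card fsubset_leq_card //; apply/fsubsetP => w.
    by rewrite !in_sep andbT andbC.
  rewrite exchange_big /= leq_sum // => w _; rewrite !sumb_card fsubset_leq_card //.
  by apply/fsubsetP => z; rewrite !in_sep nbC => /andP[_].
move=> H; have {H} := le_trans H (ler_wpM2l (ler0n _ _) gradF).
rewrite -natrM => H.
have {}H : ((\sum_(x <- P) \sum_(y <- B nb x r) (y \notin P))%N <= CT * (r * vol r) * (2 * bd nb P))%N.
  rewrite -(ler_nat R); apply: le_trans H; rewrite natr_sum big_seq [X in _ <= X]big_seq.
  apply: ler_sum => x xP; rewrite natr_sum; apply: ler_sum => y _; rewrite /F xP.
  by case: (y \in P); rewrite ?subrr ?subr0 ?normr1 ?normr0.
have low1 x : (vol r <= K1 * \sum_(y <- B nb x r) (y \notin P))%N.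
  have := vol_card_B x r; have : (#|` B nb x r| <= \sum_(y <- B nb x r) (y \notin P) + #|` P|)%N.
    rewrite sumb_card -(cardfsID P (B nb x r)) addnC leq_add //.
      by rewrite fsubset_leq_card //; apply/fsubsetP => y; rewrite in_sep in_fsetD andbC.
    by rewrite fsubset_leq_card // fsubsetIr.
  move: Pv; rewrite /K1; move: (\sum_(y <- _) _)%N #|` P| #|` B nb x r| (vol r) (k.+1 ^ n)%N => s p b v K.
  by clear; nia.
have v0 : (0 < vol r)%N \/ P = fset0.
  have [->|/fset0Pn[x _]] := eqVneq P fset0; [by right|left; exact: vol_gt0].
case: v0 => [v0|->]; last by rewrite cardfs0.
rewrite -(leq_pmul2r v0).
apply: (@leq_trans (K1 * \sum_(x <- P) \sum_(y <- B nb x r) (y \notin P))%N).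
  apply: (@leq_trans (\sum_(x <- P) vol r)); first by rewrite big_const_seq count_predT iter_addn_0 mulnC.
  by rewrite [X in (_ <= X)%N]big_distrr /= leq_sum.
apply: (leq_trans (leq_mul (leqnn K1) H)); rewrite /K2.
by move: K1 CT (vol r) (bd nb P) => A C v b; lia.
Qed.

End Transport.

(* Matrix-tree theorem, with rooted spanning forests encoded as acyclic parent
   maps [h] ([None] is the root). *)
Section MatrixTree.
Local Open Scope ring_scope.
Variables (R : realFieldType) (N : nat).

Definition acyc (h : 'I_N -> option 'I_N) :=
  exists rk : 'I_N -> nat, forall i j, h i = Some j -> (rk j < rk i)%N.

Definition pmx (h : 'I_N -> option 'I_N) : 'M[R]_N :=
  \matrix_(i, j) ((i == j)%:R - (h i == Some j)%:R).

(** A permutation with nonzero contribution never increases the rank, and the sum of the ranks is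
    invariant, so it preserves each rank; the strict decrease along [h] then leaves only the
    identity. *)
Lemma det_pmx_acyc h : acyc h -> \det (pmx h) = 1.
Proof.
move=> [rk Hrk]; rewrite /determinant (bigD1 1%g) //= [X in _ + X]big1 => [|s s1].
  rewrite odd_perm1 expr0 mul1r addr0 big1 // => i _; rewrite mxE perm1 eqxx.
  by case: eqP => [/Hrk|]; rewrite ?ltnn ?subr0.
apply/eqP; rewrite mulf_eq0 signr_eq0 /=; apply/negPn/negP => /prodf_neq0 H.
have le i : (rk (s i) <= rk i)%N.
  have := H i isT; rewrite mxE; case: (eqVneq i (s i)) => [<- //|_].
  by case: (h i =P Some (s i)) => [/Hrk/ltnW//|_]; rewrite subrr eqxx.
have E : (\sum_i rk (s i) = \sum_i rk i)%N by rewrite [RHS](reindex_inj (@perm_inj _ s)).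
have eqr i : rk (s i) = rk i.
  have [_] := leqif_sum (fun i (_ : true) => leqif_eq (le i)).
  by rewrite E eqxx => /esym/forall_inP/(_ i isT)/eqP.
case/eqP: s1; apply/permP => i; rewrite perm1; have := H i isT; rewrite mxE.
case: (eqVneq i (s i)) => [<- //|_].
by case: (h i =P Some (s i)) => [/Hrk|_]; rewrite ?eqr ?ltnn // subrr eqxx.
Qed.

(** The indicator of the vertices whose chain of parents never reaches the root is a nonzero left
    kernel vector. *)
Lemma det_pmx_cyc h : ~ acyc h -> \det (pmx h) = 0.
Proof.
move=> nac; pose it n i := iter n (obind h) (Some i).
pose S (i : 'I_N) : bool := `[< forall n, it n i <> None >].
have itS n i j : h i = Some j -> it n.+1 i = it n j by move=> hi; rewrite /it iterSr /= hi.
have SS i j : h i = Some j -> S i = S j.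
  move=> hi; apply/asboolP/asboolP => H n; first by rewrite -(itS n i j hi).
  by case: n => // n; rewrite (itS _ _ _ hi).
have [/existsP[i0 Si0]|/existsPn none] := boolP [exists i, S i]; last first.
  case: nac; have P i : exists n, it n i == None.
    have /asboolP := none i; rewrite /= => /existsNP[n]; rewrite not_notE => /eqP E.
    by exists n.
  exists (fun i => ex_minn (P i)) => i j hi.
  case: (ex_minnP (P i)) => n; case: n => // n; rewrite (itS _ _ _ hi) => Hn _.
  by case: ex_minnP => m _ /(_ _ Hn).
apply/eqP; rewrite -det_tr; apply/det0P.
exists (\row_i (S i)%:R).
  by apply/eqP => /rowP/(_ i0); rewrite !mxE Si0 => /eqP; rewrite oner_eq0.
apply/rowP => i; rewrite !mxE.
under eq_bigr do rewrite !mxE mulrBr.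
rewrite sumrB (bigD1 i) //= eqxx mulr1 big1 ?addr0 => [|j /negPf]; last first.
  by rewrite eq_sym => ->; rewrite mulr0.
case hi: (h i) => [j|].
  rewrite (bigD1 j) //= eqxx mulr1 big1 ?addr0 => [|l /negPf lj].
    by rewrite -(SS _ _ hi) subrr.
  rewrite (_ : (Some j == Some l) = (j == l)) // eq_sym lj mulr0 //.
rewrite big1 => [|j _]; last by rewrite mulr0.
case: (boolP (S i)) => [/asboolP/(_ 1%N)|]; last by rewrite subr0.
by rewrite /it /= hi.
Qed.

Variable C : finType.
Implicit Types (al : 'I_N -> pred C) (tg : 'I_N -> C -> option 'I_N).

(** Laplacian of a network given by arcs: [al i c] tells that the arc [c] may be chosen at [i], and
    [tg i c] is its head, [None] being the root. *)
Definition lap al tg : 'M[R]_N :=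
  \matrix_(i, j) \sum_(c | al i c) ((i == j)%:R - (tg i c == Some j)%:R).

Definition forests al tg : {set {ffun 'I_N -> C}} :=
  [set phi : {ffun 'I_N -> C} | [forall i, al i (phi i)] &&
     `[< acyc (fun i => tg i (phi i)) >]].

(** Multilinearity in the rows turns the determinant into a sum over all choices of one arc per
    vertex; each choice is a parent map, contributing 1 or 0 according to acyclicity. *)
Lemma det_lap al tg : \det (lap al tg) = #|forests al tg|%:R.
Proof.
have E s : \prod_i lap al tg i (s i) = \sum_(phi : {ffun 'I_N -> C} | [forall i, al i (phi i)])
    \prod_i ((i == s i)%:R - (tg i (phi i) == Some (s i))%:R).
  under eq_bigr do rewrite mxE.
  rewrite (bigA_distr_big_dep (fun i c => al i c)); apply: eq_bigl => phi.
  by apply/familyP/forallP.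
rewrite /determinant; under eq_bigr do rewrite E mulr_sumr.
rewrite exchange_big /=.
rewrite -sum1_card natr_sum big_mkcond [RHS]big_mkcond /=; apply: eq_bigr => phi _.
rewrite inE; case: [forall i, _] => //=.
have -> : \sum_(s : 'S_N) (-1) ^+ s * \prod_i ((i == s i)%:R - (tg i (phi i) == Some (s i))%:R)
   = \det (pmx (fun i => tg i (phi i))).
  by apply: eq_bigr => s _; congr (_ * _); apply: eq_bigr => i _; rewrite mxE.
by case: asboolP => [/det_pmx_acyc|/det_pmx_cyc].
Qed.

(** Rank one update: the cofactors along row [y] do not see the change, and [invmx M y y] is the
    diagonal cofactor divided by the determinant. *)
Lemma det_sub_delta (M : 'M[R]_N) y : \det M != 0 ->
  \det (M - delta_mx y y) = \det M * (1 - invmx M y y).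
Proof.
move=> dM; rewrite /invmx unitmxE unitfE dM !mxE mulrBr mulr1 mulrA divff // mul1r.
rewrite (expand_det_row _ y) (expand_det_row M y) -[X in _ = _ - X]mul1r.
under eq_bigr => j _.
  rewrite !mxE eqxx /= mulrBl (_ : cofactor _ y j = cofactor M y j); last first.
    congr (_ * \det _); apply/matrixP => i l; rewrite !mxE.
    by rewrite [_ == y]eq_sym (negPf (neq_lift _ _)) subr0.
  over.
rewrite sumrB; congr (_ - _); rewrite (bigD1 y) //= eqxx big1 ?addr0 // => j /negPf jy.
by rewrite jy mul0r.
Qed.

End MatrixTree.

(** * Green functions on a cut network *)

(* The Laplacian on [W] of the graph in which the edges joining the two sides
   of [s] are cut, with killing rate [ka] added. *)
Section Network.
Local Open Scope fset_scope.
Local Open Scope ring_scope.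
Variables (V : choiceType) (nb : V -> {fset V}).
Hypothesis nbC : forall x y, (y \in nb x) = (x \in nb y).
Variables (R : realFieldType) (W : {fset V}).

Definition NW := #|{: W}|.
Definition vt (i : 'I_NW) : V := val (enum_val i).
Definition idx (v : V) : option 'I_NW := omap enum_rank (insub v : option W).

Lemma vtW i : vt i \in W. Proof. exact: valP. Qed.
Lemma idxK i : idx (vt i) = Some i.
Proof. by rewrite /idx /vt valK /= enum_valK. Qed.
Lemma vt_inj : injective vt.
Proof. by move=> i j /(congr1 idx); rewrite !idxK => -[]. Qed.
Lemma idxW v : v \in W -> exists2 i, idx v = Some i & vt i = v.
Proof.
by move=> vW; rewrite /idx insubT /=; eexists; [reflexivity|rewrite /vt enum_rankK].
Qed.
Lemma idxN v : v \notin W -> idx v = None.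
Proof. by move=> vW; rewrite /idx insubN. Qed.
Lemma idxS v i : idx v = Some i -> vt i = v.
Proof.
have [vW|vW] := boolP (v \in W); last by rewrite idxN.
by have [j -> <-] := idxW vW => -[->].
Qed.
Lemma idx_eq v i : (idx v == Some i) = (v == vt i).
Proof. by apply/eqP/eqP => [/idxS|->]; rewrite ?idxK. Qed.

Lemma sum_vt (F : V -> R) : \sum_i F (vt i) = \sum_(v <- W) F v.
Proof.
rewrite big_seq_fsetE /= [RHS](reindex (@enum_val W predT)) //=.
  by exists enum_rank => x _; rewrite ?enum_valK ?enum_rankK.
Qed.

Variable s : V -> bool.
Implicit Types (ka : V -> nat) (h g : V -> R).

(** For [h] vanishing off [W], the edges that leave [W] on the same side of the cut also act as
    killing: the outside of [W] is grounded. *)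
Definition Lk ka h v := \sum_(w <- nb v | s w == s v) (h v - h w) + (ka v)%:R * h v.

Definition Mx ka : 'M[R]_NW := \matrix_(i, j)
  ((i == j)%:R * (\sum_(w <- nb (vt i) | s w == s (vt i)) 1 + (ka (vt i))%:R)
   - ((vt j \in nb (vt i)) && (s (vt j) == s (vt i)))%:R).

Lemma sum_sub0 (A U : {fset V}) (P : pred V) h :
  (forall v, v \in A -> v \notin U -> h v = 0) ->
  \sum_(v <- A | P v) h v = \sum_(v <- U) ((v \in A) && P v)%:R * h v.
Proof.
move=> H; rewrite (big_fset_incl _ (fsubsetUr A U)) /=; last first.
  by move=> v; rewrite in_fsetU => /orP[vA|->//] vU; rewrite H // mulr0.
transitivity (\sum_(v <- A) ((v \in A) && P v)%:R * h v); last first.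
  apply: (big_fset_incl _ (fsubsetUl A U)) => /= v _ /negPf ->; by rewrite mul0r.
rewrite big_mkcond big_seq [RHS]big_seq; apply: eq_bigr => v ->.
by case: (P v); rewrite ?mul1r ?mul0r.
Qed.

Lemma MxE ka h i : (forall v, v \notin W -> h v = 0) ->
  \sum_j Mx ka i j * h (vt j) = Lk ka h (vt i).
Proof.
move=> h0; under eq_bigr do rewrite mxE mulrBl.
rewrite sumrB (bigD1 i) //= eqxx mul1r [X in _ + X - _]big1 ?addr0 => [|j /negPf]; last first.
  by rewrite eq_sym => ->; rewrite !mul0r.
rewrite (sum_vt (fun u => ((u \in nb (vt i)) && (s u == s (vt i)))%:R * h u)).
rewrite -sum_sub0 => [|v _]; last exact: h0.
by rewrite /Lk sumrB mulrDl mulr_suml; under [X in _ + _ - _ = X - _ + _]eq_bigr do rewrite -[h _]mul1r; rewrite addrAC.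
Qed.

Lemma Mx_ker ka h : \det (Mx ka) != 0 -> (forall v, v \notin W -> h v = 0) ->
  (forall v, v \in W -> Lk ka h v = 0) -> forall v, h v = 0.
Proof.
move=> dM h0 hL v; have [vW|] := boolP (v \in W); last exact: h0.
have uM : Mx ka \in unitmx by rewrite unitmxE unitfE.
have E : Mx ka *m \col_j h (vt j) = 0.
  apply/colP => i; rewrite [RHS]mxE -(hL _ (vtW i)) -MxE // mxE.
  by apply: eq_bigr => j _; rewrite [X in _ * X]mxE.
have := congr1 (mulmx (invmx (Mx ka))) E; rewrite mulKmx // mulmx0.
by have [i _ <-] := idxW vW => /colP/(_ i); rewrite !mxE.
Qed.

Definition dec ka y v := if v == y then (ka y).-1 else ka v.

(** [g] is the column of [y] in the inverse matrix. Removing one exit at [y] lowers a diagonal entry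
    by 1, so the price of the removal is a rank one update. *)
Lemma green ka y : \det (Mx ka) != 0 -> y \in W -> (0 < ka y)%N ->
  exists g, [/\ forall v, v \notin W -> g v = 0, forall v, v \in W -> Lk ka g v = (v == y)%:R &
    \det (Mx (dec ka y)) = \det (Mx ka) * (1 - g y)].
Proof.
move=> dM yW ky; have [j jy vy] := idxW yW.
have uM : Mx ka \in unitmx by rewrite unitmxE unitfE.
pose g v := if idx v is Some i then invmx (Mx ka) i j else 0.
have g0 v : v \notin W -> g v = 0 by move=> vW; rewrite /g idxN.
exists g; split=> // [v /idxW[i iv <-]|].
  rewrite -MxE // -vy (inj_eq vt_inj).
  have /matrixP/(_ i j) := mulmxV uM; rewrite [LHS]mxE [RHS]mxE => <-.
  by apply: eq_bigr => l _; rewrite /g idxK.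
rewrite /g jy -det_sub_delta //; congr (\det _); apply/matrixP => i l; rewrite !mxE /dec.
have -> : (vt i == y) = (i == j) by rewrite -vy (inj_eq vt_inj).
have [->|ij] := eqVneq i j; last by rewrite /= subr0.
have [->|jl] := eqVneq l j; last by rewrite /= subr0 !mul0r.
rewrite vy; case: (ka y) ky => // c _; rewrite /= -natr1; ring.
Qed.

(** Minimum principle. Where a negative minimum is attained there is no killing, and all neighbours
    on the same side attain it as well; the indicator of that set would be in the kernel of an
    invertible matrix. *)
Lemma Lk_min ka h : \det (Mx ka) != 0 -> (forall v, v \notin W -> 0 <= h v) ->
  (forall v, v \in W -> 0 <= Lk ka h v) -> forall v, 0 <= h v.
Proof.
move=> dM h0 hL v0; rewrite leNgt; apply/negP => hv0.
have v0W : v0 \in W by apply: contraLR hv0 => /h0; rewrite -leNgt.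
have [m mW mmin] : exists2 m, m \in W & forall v, h m <= h v.
  have [m _ Hm] := @arg_minP _ _ W [` v0W] xpredT (fun x : W => h (val x)) isT.
  exists (val m); first exact: valP.
  move=> v; have [vW|/h0] := boolP (v \in W); first exact: (Hm [` vW]).
  by apply: le_trans; apply: le_trans (Hm [` v0W] isT) (ltW hv0).
have hm : h m < 0 by apply: le_lt_trans (mmin v0) hv0.
pose f v : R := (h v == h m)%:R.
have fW v : h v == h m -> v \in W.
  by move=> /eqP E; apply: contraLR hm => /h0; rewrite -leNgt E.
have closed v : h v == h m -> (ka v = 0%N) /\ forall w, w \in nb v -> s w == s v -> h w == h m.
  move=> hv; have vW := fW _ hv; move/eqP: hv => hv; have := hL _ vW; rewrite /Lk hv.
  have S0 : \sum_(w <- nb v | s w == s v) (h m - h w) <= 0.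
    by rewrite big_seq_cond sumr_le0 // => w _; rewrite subr_le0.
  have K0 : (ka v)%:R * h m <= 0 by rewrite mulr_ge0_le0 // ltW.
  move=> L0; have S1 : \sum_(w <- nb v | s w == s v) (h w - h m) = 0.
    by apply/eqP; rewrite -oppr_eq0 -sumrN (eq_bigr (fun w => h m - h w)) => [|w _]; rewrite ?opprB //; apply/eqP; lra.
  split.
    have /eqP : (ka v)%:R * h m = 0 by lra.
    by rewrite mulf_eq0 pnatr_eq0 (lt_eqF hm) orbF => /eqP.
  move=> w wv sw; move/eqP: S1; rewrite psumr_eq0 => [/allP/(_ _ wv)|u _]; last by rewrite subr_ge0.
  by rewrite sw /= subr_eq0.
suff : f m = 0 by rewrite /f eqxx => /eqP; rewrite oner_eq0.
apply: (Mx_ker dM) => v; rewrite /f.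
  by move=> vW; case: eqP => // /eqP/fW; rewrite (negPf vW).
move=> vW; rewrite /Lk; case: (eqVneq (h v) (h m)) => [/eqP hv|hv].
  have [-> cl] := closed v hv; rewrite mul0r addr0 big_seq_cond big1 // => w /andP[wv sw].
  by rewrite (eqP (cl w wv sw)) eqxx subrr.
rewrite mulr0 addr0 big_seq_cond big1 // => w /andP[wv sw].
case: (eqVneq (h w) (h m)) => [/eqP hw|]; last by rewrite subr0.
have [_ cl] := closed w hw; have := cl v; rewrite nbC => /(_ wv); rewrite eq_sym.
by rewrite (negPf hv) => /(_ sw).
Qed.

Lemma Lk_sub ka h g v : Lk ka (fun x => h x - g x) v = Lk ka h v - Lk ka g v.
Proof.
rewrite /Lk mulrBr opprD addrACA -sumrB; congr (_ + _); apply: eq_bigr => w _; ring.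
Qed.

Lemma Lk_scale ka c h v : Lk ka (fun x => c * h x) v = c * Lk ka h v.
Proof.
rewrite /Lk mulrDr mulr_sumr mulrCA; congr (_ + _); apply: eq_bigr => w _; ring.
Qed.

Lemma Lk_cst1 ka v : Lk ka (fun=> 1) v = (ka v)%:R.
Proof. by rewrite /Lk big1 ?add0r ?mulr1 // => w _; rewrite subrr. Qed.

Lemma green_ge0 ka y g : \det (Mx ka) != 0 -> (forall v, v \notin W -> g v = 0) ->
  (forall v, v \in W -> Lk ka g v = (v == y)%:R) -> forall v, 0 <= g v.
Proof.
by move=> dM g0 gL; apply: (Lk_min dM) => v vW; rewrite ?g0 ?gL.
Qed.

(** The sum is the probability that the killed walk from [x] dies at an exit in [Z]. Formally, the
    minimum principle is applied to 1 minus the sum. *)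
Lemma green_sum ka (Z : {fset V}) (G : V -> V -> R) : \det (Mx ka) != 0 -> Z `<=` W ->
  (forall y v, y \in Z -> v \notin W -> G y v = 0) ->
  (forall y v, y \in Z -> v \in W -> Lk ka (G y) v = (v == y)%:R) ->
  forall x, \sum_(z <- Z) (ka z)%:R * G z x <= 1.
Proof.
move=> dM ZW G0 GL x; rewrite -subr_ge0.
apply: (Lk_min dM (h := fun x => 1 - \sum_(z <- Z) (ka z)%:R * G z x)) => v vW.
  by rewrite big1_seq ?subr0 ?ler01 // => z /andP[_ zZ]; rewrite G0 // mulr0.
rewrite Lk_sub Lk_cst1.
have -> : Lk ka (fun x0 => \sum_(z <- Z) (ka z)%:R * G z x0) v =
    \sum_(z <- Z) (ka z)%:R * Lk ka (G z) v.
  rewrite {1}/Lk mulr_sumr; under eq_bigr do rewrite -sumrB.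
  rewrite exchange_big -big_split /=; apply: eq_bigr => z _.
  rewrite -Lk_scale /Lk; congr (_ + _).
have [vZ|vZ] := boolP (v \in Z).
  rewrite (big_fsetD1 v) //= GL // eqxx mulr1 big1_fset ?addr0 ?subrr // => z.
  by rewrite in_fsetD1 => /andP[zv zZ] _; rewrite GL // eq_sym (negPf zv) mulr0.
rewrite big1_fset ?subr0 // => z zZ _; rewrite GL // (_ : v == z = false) ?mulr0 //.
by apply: contraNF vZ => /eqP ->.
Qed.

End Network.

(** * Spanning forests of the cut and uncut networks *)

Section Forests.
Local Open Scope fset_scope.
Local Open Scope ring_scope.
Variables (V : choiceType) (nb : V -> {fset V}).
Hypothesis nbC : forall x y, (y \in nb x) = (x \in nb y).
Variables (R : realFieldType) (W : {fset V}).
Notation N := (NW W).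
Notation vt := (@vt V W).
Notation idx := (@idx V W).

(** Heads of arcs: besides [W] itself, its neighbours outside [W], all of which stand for the root
    while keeping distinct edges distinct. *)
Definition WC : finType := {: (W `|` obd nb W)}.

Lemma nbWC v w : v \in W -> w \in nb v -> w \in W `|` obd nb W.
Proof.
move=> vW wv; rewrite in_fsetU; have [//|wW /=] := boolP (w \in W).
by apply/obdP; split=> //; exists v.
Qed.

Lemma sum_WC i (P : pred V) (F : V -> R) :
  \sum_(c : WC | (val c \in nb (vt i)) && P (val c)) F (val c) =
  \sum_(w <- nb (vt i) | P w) F w.
Proof.
rewrite -(big_seq_fsetE _ _ (fun c => (c \in nb (vt i)) && P c)) /= big_mkcond.
have sub : nb (vt i) `<=` W `|` obd nb W.
  by apply/fsubsetP => w; apply: nbWC; exact: vtW.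
rewrite -(big_fset_incl _ sub) /=; last by move=> w _ /negPf ->.
by rewrite [RHS]big_mkcond big_seq [RHS]big_seq; apply: eq_bigr => w ->.
Qed.

Definition alW (i : 'I_N) (c : WC) := val c \in nb (vt i).
Definition tgW (i : 'I_N) (c : WC) := idx (val c).

Section Sides.
Variable s : V -> bool.
(** A chosen edge that crosses the cut leads to the root: this is an exit. *)
Definition tgS (i : 'I_N) (c : WC) := if s (val c) == s (vt i) then idx (val c) else None.

Lemma lap_Mx (al : V -> pred V) (ka : V -> nat) :
  (forall v, v \in W -> \sum_(w <- nb v | al v w && (s w != s v)) 1 = (ka v)%:R :> R) ->
  (forall v w, s w == s v -> al v w) ->
  lap R (fun i (c : WC) => alW i c && al (vt i) (val c)) tgS = Mx nb R W s ka.
Proof.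
move=> Hk Hal; apply/matrixP => i j; rewrite !mxE sumrB; congr (_ - _).
  rewrite (sum_WC i (al (vt i)) (fun=> (i == j)%:R)) mulrDr -Hk ?vtW // !mulr_sumr.
  rewrite (bigID (fun w => s w == s (vt i))) /=; congr (_ + _).
    by apply: eq_big => [w|w _]; rewrite ?mulr1 // andb_idl // => /Hal.
  by apply: eq_bigr => w _; rewrite mulr1.
rewrite /alW /tgS.
rewrite (eq_bigr (fun c : WC => (fun w => ((s w == s (vt i)) && (w == vt j))%:R : R) (val c))); last first.
  by move=> c _; case: ifP => // _; rewrite idx_eq.
rewrite (sum_WC i (al (vt i)) (fun w => ((s w == s (vt i)) && (w == vt j))%:R)).
have [vv|vv] := boolP ((vt j \in nb (vt i)) && (s (vt j) == s (vt i))); last first.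
  rewrite big_seq_cond big1 // => w /andP[wn _]; case: eqP => // sw /=; case: eqP => // E.
  by rewrite -E wn sw eqxx in vv.
have /andP[vn sv] := vv; rewrite big_mkcond (big_fsetD1 (vt j)) //= Hal // sv eqxx.
rewrite big1_fset ?addr0 // => w; rewrite in_fsetD1 => /andP[/negPf -> _] _.
by rewrite andbF if_same.
Qed.

Lemma acyc_sub (h h' : 'I_N -> option 'I_N) :
  (forall i j, h' i = Some j -> h i = Some j) -> acyc h -> acyc h'.
Proof. by move=> H [rk Hrk]; exists rk => i j /H/Hrk. Qed.

Definition cross v := (\sum_(w <- nb v) (s w != s v))%N.

(** A forest of the uncut network becomes one of the cut network when its crossing edges are read as
    exits, since forgetting parents preserves acyclicity. *)
Lemma det_cut : \det (lap R alW tgW) <= \det (Mx nb R W s cross).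
Proof.
have <- : lap R (fun i (c : WC) => alW i c && (fun _ _ => true) (vt i) (val c)) tgS
    = Mx nb R W s cross.
  apply: (@lap_Mx (fun _ _ => true) cross) => // v _ /=; rewrite /cross natr_sum big_mkcond.
  by apply: eq_bigr => w _; case: (s w != s v).
rewrite !det_lap ler_nat subset_leq_card //; apply/subsetP => phi; rewrite !inE.
move=> /andP[/forallP al /asboolP ac]; apply/andP; split.
  by apply/forallP => i; rewrite andbT.
by apply/asboolP; apply: acyc_sub ac => i j; rewrite /tgS /tgW; case: ifP.
Qed.

End Sides.

Definition al1 (A : {fset V}) z eta v w :=
  ((w \in A) == (v \in A)) || ((v == z) && (w == eta)).

Definition forests1 A z eta : {set {ffun 'I_N -> WC}} :=
  forests (fun i (c : WC) => alW i c && al1 A z eta (vt i) (val c)) (tgS (mem A)).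

Definition root1 (z v : V) : nat := (v == z).

Lemma det_root1 (A : {fset V}) z eta : z \in A -> eta \in nb z -> eta \notin A ->
  \det (Mx nb R W (mem A) (root1 z)) = #|forests1 A z eta|%:R.
Proof.
move=> zA ez eA; rewrite -det_lap; congr (\det _); apply/esym.
apply: (@lap_Mx (mem A)) => [v vW|v w]; last by move=> H; rewrite /al1; apply/orP; left.
rewrite /root1; case: (eqVneq v z) => [->|vz]; last first.
  rewrite big1 // => w; rewrite /al1 (negPf vz) /= orbF.
  by move=> /andP[/eqP -> /negP]; rewrite eqxx.
rewrite big_mkcond (big_fsetD1 eta) //= /al1 !eqxx orbT zA (negPf eA) /= big1_fset ?addr0 // => w.
by rewrite in_fsetD1 => /andP[/negPf -> _] _; case: (w \in A).
Qed.

Definition par (phi : {ffun 'I_N -> WC}) i := tgW i (phi i).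
Definition walk phi t v := iter t (obind (par phi)) (idx v).

Section OneSet.
Variables (A : {fset V}) (z eta : V) (phi : {ffun 'I_N -> WC}).
Hypotheses (AW : A `<=` W) (zA : z \in A) (eA : eta \notin A).
Hypothesis phiF : phi \in forests1 A z eta.

Lemma phi_al i : alW i (phi i) && al1 A z eta (vt i) (val (phi i)).
Proof. by move: phiF; rewrite inE => /andP[/forallP/(_ i)]. Qed.

Lemma par_out i j : vt i \notin A -> par phi i = Some j -> vt j \notin A.
Proof.
move=> iA /idxS ->; have /andP[_] := phi_al i; rewrite /al1.
case: (eqVneq (vt i) z) => [E|_]; first by rewrite E zA in iA.
by rewrite orbF => /eqP ->.
Qed.

Lemma par_in i : vt i \in A -> vt i != z -> exists2 j, par phi i = Some j & vt j \in A.
Proof.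
move=> iA iz; have /andP[_] := phi_al i; rewrite /al1 (negPf iz) orbF iA => /eqP pA.
have [j jE jv] := idxW (fsubsetP AW _ pA); exists j; by rewrite ?jv.
Qed.

(** Restoring the edge from [z] to [eta] closes no cycle, because parents never lead from outside
    [A] back into [A]: the ranks on [A] are shifted above all the others. *)
Lemma par_acyc : acyc (par phi).
Proof.
move: phiF; rewrite inE => /andP[_ /asboolP[rk Hrk]].
exists (fun i => if vt i \in A then rk i + (\max_j rk j).+1 else rk i)%N => i j pj.
have [iA|iA] := boolP (vt i \in A); last first.
  rewrite (negPf (par_out iA pj)); apply: Hrk; rewrite /tgS.
  by move: (par_out iA pj) (pj); rewrite /par /tgW => + /idxS E; rewrite -E /= => /negPf ->; rewrite (negPf iA) eqxx E.
have [jA|jA] := boolP (vt j \in A); last first.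
  by rewrite addnS ltnS (leq_trans (leq_bigmax j)) // leq_addl.
rewrite ltn_add2r; apply: Hrk; rewrite /tgS.
by move: jA (pj); rewrite /par /tgW => + /idxS E; rewrite -E /= => ->; rewrite iA eqxx E.
Qed.

Lemma phi_forest : phi \in forests alW tgW.
Proof.
rewrite inE; apply/andP; split; last exact/asboolP/par_acyc.
by apply/forallP => i; have /andP[] := phi_al i.
Qed.

Lemma walk_out t v : v \notin A -> forall i, walk phi t v = Some i -> vt i \notin A.
Proof.
move=> vA; elim: t => [|t IH] i /=; first by move=> /idxS ->.
case E: (walk phi t v) => [j|] //=; by apply: par_out; apply: IH.
Qed.

(** Within [A] only [z] has its parent outside, so the chain of parents stays in [A] until it meets
    [z]; strictly decreasing ranks bound its length. *)
Lemma walk_hit v : v \in A -> exists2 t, (t < #|` A|)%N & walk phi t v = idx z.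
Proof.
move=> vA; have [rk Hrk] := par_acyc.
(* The number of vertices of [A] of rank at most that of the current vertex drops at each step and
   bounds the hitting time. *)
pose low m := [fset u in A | (if idx u is Some j then rk j else 0) <= m]%N.
have [i iv vi] := idxW (fsubsetP AW _ vA).
suff [t Ht E] : exists2 t, (t < #|` low (rk i)|)%N & walk phi t v = idx z.
  exists t => //; apply: leq_trans Ht _; apply: fsubset_leq_card.
  by apply/fsubsetP => u; rewrite in_sep => /andP[].
move: {2}(rk i) (leqnn (rk i)) => m; elim: m i v vA iv vi => [|m IH] i v vA iv vi rm.
  have [->|vz] := eqVneq v z.
    exists 0%N => //; rewrite cardfs_gt0; apply/fset0Pn; exists v; by rewrite in_sep vA iv /=.
  have [j pj jA] : exists2 j, par phi i = Some j & vt j \in A by apply: par_in; rewrite vi.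
  by have := Hrk _ _ pj; lia.
have [->|vz] := eqVneq v z.
  exists 0%N => //; rewrite cardfs_gt0; apply/fset0Pn; exists v; by rewrite in_sep vA iv /=.
have [j pj jA] : exists2 j, par phi i = Some j & vt j \in A by apply: par_in; rewrite vi.
have rji := Hrk _ _ pj; have rjm : (rk j <= m)%N by lia.
have [t Ht E] := IH j (vt j) jA (idxK j) erefl rjm.
exists t.+1; last by rewrite /walk iterSr iv /= pj -idxK.
have sub : v |` low (rk j) `<=` low (rk i).
  apply/fsubsetP => u; rewrite in_fset1U => /orP[/eqP ->|]; first by rewrite in_sep vA iv /=.
  rewrite !in_sep => /andP[-> /=]; case: (idx u) => // l; lia.
have := fsubset_leq_card sub; rewrite cardfsU1 (_ : v \notin _) ?add1n; first exact: leq_trans.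
by rewrite in_sep iv vA /= -ltnNge.
Qed.

Lemma walk_mem v : v \in W -> (v \in A) = `[< exists t, walk phi t v = idx z >].
Proof.
move=> vW; apply/idP/asboolP => [/walk_hit[t _]|[t]]; first by exists t.
have [i iz zi] := idxW (fsubsetP AW _ zA); rewrite iz => Ht.
by apply: contraPT Ht => vA Ht; have := walk_out vA Ht; rewrite zi zA.
Qed.

End OneSet.

(* For a fixed forest, [A] is the set of descendants of its root [z], and [z] is
   an ancestor of [o] at generation less than the size of [A]. *)
Lemma forests1_sum (o : V) (F : seq {fset V}) (zF etaF : {fset V} -> V) (m : nat) : uniq F ->
  (forall A, A \in F -> [/\ o \in A, A `<=` W, zF A \in A, etaF A \notin A & (#|` A| <= m)%N]) ->
  (\sum_(A <- F) #|forests1 A (zF A) (etaF A)| <= m * #|forests alW tgW|)%N.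
Proof.
move=> uF HF.
have E A : A \in F -> #|forests1 A (zF A) (etaF A)| =
    (\sum_(phi in forests alW tgW) (phi \in forests1 A (zF A) (etaF A)))%N.
  move=> /HF[_ AW zA eA _]; rewrite -sum1_card big_mkcond [RHS]big_mkcond /=.
  apply: eq_bigr => phi _; case: (boolP (phi \in forests1 _ _ _)) => [H|_]; last by case: ifP.
  by rewrite (phi_forest zA H).
rewrite (eq_big_seq _ E) exchange_big /= mulnC -sum_nat_const leq_sum // => phi _.
pose FF := [seq A <- F | phi \in forests1 A (zF A) (etaF A)].
have -> : (\sum_(A <- F) (phi \in forests1 A (zF A) (etaF A)) = size FF)%N.
  by rewrite size_filter -sum1_count [RHS]big_mkcond /=; apply: eq_bigr => A _; case: (_ \in _).
have FP A : A \in FF -> A \in F /\ phi \in forests1 A (zF A) (etaF A).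
  by rewrite mem_filter => /andP[].
pose gen A := if pselect (exists2 t, (t < #|` A|)%N & walk phi t o = idx (zF A)) is left H
  then s2val (cid2 H) else 0%N.
have genP A : A \in FF -> (gen A < m)%N /\ walk phi (gen A) o = idx (zF A).
  move=> /FP[/HF[oA AW zA eA Am] H]; rewrite /gen; case: pselect => [H'|[]]; last exact: (walk_hit AW zA eA H oA).
  by case: cid2 => t /= tA E'; split=> //; exact: leq_trans tA Am.
have uFF : uniq (map gen FF).
  have -> : uniq (map gen FF) = uniq FF; last by rewrite filter_uniq.
  apply: (@map_inj_in_uniq {fset V} nat gen FF) => A A' AF AF' EA.
  have [_ w1] := genP _ AF; have [_ w2] := genP _ AF'; rewrite EA w2 in w1.
  have [/HF[oA AW zA eA _] H] := FP _ AF; have [/HF[oA' AW' zA' eA' _] H'] := FP _ AF'.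
  apply/fsetP => v; have [vW|vW] := boolP (v \in W); last first.
    by rewrite (contraNF (fsubsetP AW v) vW) (contraNF (fsubsetP AW' v) vW).
  by rewrite (walk_mem AW zA eA H vW) (walk_mem AW' zA' eA' H' vW) w1.
rewrite -(size_map gen) -(size_iota 0 m); apply: uniq_leq_size => // t /(@mapP {fset V} nat gen FF)[A /genP[tm _] ->].
by rewrite mem_iota.
Qed.

Hypothesis conn : forall x y, exists r, y \in B nb x r.
Hypothesis inf : forall A : {fset V}, exists x, x \notin A.

(** Each vertex chooses a neighbour that is closer to the complement of [W]. *)
Lemma forests_gt0 : (0 < #|forests alW tgW|)%N.
Proof.
have out v : exists r, ~~ (B nb v r `<=` W).
  have [u uW] := inf W; have [r ur] := conn v u; exists r.
  by apply: contra uW => /fsubsetP; apply.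
pose rk v := ex_minn (out v).
have step v : v \in W -> exists2 w, w \in nb v & (rk w < rk v)%N.
  move=> vW; rewrite {2}/rk; case: ex_minnP => -[|r] Hr rmin.
    by case/negP: Hr; rewrite /= fsub1set.
  have /fsubsetPn[u /B_step[w wv ur] uW] := Hr.
  have nw : ~~ (B nb w r `<=` W) by apply/fsubsetPn; exists u.
  have rw : (rk w <= r)%N by rewrite /rk; case: ex_minnP => m _ /(_ _ nw).
  exists w; last by rewrite ltnS.
  move: wv; rewrite in_cnb => /orP[/eqP E|//]; by have := rmin _ (eq_ind w (fun q => ~~ (B nb q r `<=` W)) nw v E); rewrite ltnn.
have ch i : exists c : WC, (val c \in nb (vt i)) && (rk (val c) < rk (vt i))%N.
  have [w wv rw] := step _ (vtW i); by exists [` nbWC (vtW i) wv]; rewrite /= wv.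
rewrite card_gt0; apply/set0Pn; exists [ffun i => xchoose (ch i)]; rewrite inE; apply/andP; split.
  by apply/forallP => i; rewrite ffunE /alW; have /andP[] := xchooseP (ch i).
apply/asboolP; exists (fun i => rk (vt i)) => i j; rewrite ffunE /tgW => /idxS ->.
by have /andP[] := xchooseP (ch i).
Qed.

End Forests.

(** * Growth of level sets *)

(* [f s rho] is the size of a set growing with the voltage budget [s] and the
   radius [rho]; [bf s rho] is its edge boundary. *)
Section Climb.
Local Open Scope ring_scope.
Variables (R : realFieldType) (Gam : nat) (v : nat -> nat) (m : nat) (i s1 : R).
Hypothesis Gam1 : (1 <= Gam)%N.
Hypothesis m1 : (1 <= m)%N.
Hypothesis i0 : 0 < i.
Variables (f bf : R -> nat -> nat).
Hypothesis f_grow : forall s rho l, 0 <= s -> 0 < l -> s + l <= s1 ->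
  (f s rho <= f (s + l) rho.+1)%N /\
  (bf s rho)%:R <= m%:R + Gam%:R * ((f (s + l) rho.+1)%:R - (f s rho)%:R) + i / l.
Hypothesis f_iso : forall s rho r, 0 <= s <= s1 -> (0 < r)%N -> (Gam * f s rho <= v r)%N ->
  (f s rho <= Gam * r * bf s rho)%N.

(** [K r^2 / f] is the voltage reserved for climbing from size [f] to the volume at radius [r]. *)
Let K : R := 16 * Gam%:R ^+ 3 * i.

Lemma climb_cost_ge0 r n : 0 <= K * r%:R ^+ 2 / n%:R.
Proof. by rewrite !mulr_ge0 ?exprn_ge0 ?invr_ge0 // ltW. Qed.

(** With boundary [b], the increment $l = 4i/b$ makes $i/l$ equal to $b/4$, and isoperimetry with
    [4 m Gam r <= f] gives $m \le b/4$; the growth is therefore at least $b/(2\,Gam)$. The resulting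
    decrease of [K r^2 / f] pays for $l$. *)
Lemma climb_step s rho r : 0 <= s -> (0 < r)%N -> (0 < f s rho)%N ->
  (Gam * f s rho <= v r)%N -> (4 * m * Gam * r <= f s rho)%N ->
  s + K * r%:R ^+ 2 / (f s rho)%:R <= s1 ->
  exists s', [/\ s <= s', s' + K * r%:R ^+ 2 / (f s' rho.+1)%:R <= s + K * r%:R ^+ 2 / (f s rho)%:R &
     (2 * Gam * Gam * r * f s rho + f s rho <= 2 * Gam * Gam * r * f s' rho.+1)%N].
Proof.
move=> s0 r0 f0 fv fm ss1.
have G1 : 1 <= Gam%:R :> R by rewrite ler1n.
have r1 : 1 <= r%:R :> R by rewrite ler1n.
have F0 : 0 < (f s rho)%:R :> R by rewrite ltr0n.
have sle : s <= s1.
  by apply: le_trans ss1; rewrite lerDl !mulr_ge0 ?exprn_ge0 ?invr_ge0 ?ltW //; lra.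
have fb : (f s rho)%:R <= Gam%:R * r%:R * (bf s rho)%:R :> R.
  by rewrite -!natrM ler_nat f_iso // s0.
have FM : 4 * m%:R * Gam%:R * r%:R <= (f s rho)%:R :> R by rewrite -!natrM ler_nat.
have M1 : 1 <= m%:R :> R by rewrite ler1n.
set F := (f s rho)%:R in F0 fb FM *; set b := (bf s rho)%:R in fb.
set g := Gam%:R in G1 fb FM; set x := r%:R in r1 fb FM *.
have gx : 1 <= g * x by rewrite -[1]mulr1 ler_pM.
have b0 : 0 < b.
  rewrite ltNge; apply/negP => b0; have : g * x * b <= 0 by rewrite mulr_ge0_le0 // (le_trans _ gx).
  lra.
have mb : 4 * m%:R <= b.
  have : (4 * m%:R) * (g * x) <= b * (g * x) by rewrite [b * _]mulrC; apply: le_trans fb; lra.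
  by rewrite ler_pM2r // (lt_le_trans _ gx).
pose l := 4 * i / b; have l0 : 0 < l by rewrite divr_gt0 // mulr_gt0.
have x2 : x <= x ^+ 2 by rewrite expr2 ler_peMl // (le_trans _ r1).
have g3 : g <= g ^+ 3.
  by rewrite !exprS expr0 mulr1 ler_peMr ?(le_trans _ G1) // -[1]mulr1 ler_pM.
have lK : l <= K * x ^+ 2 / F.
  rewrite /l ler_pdivlMr // mulrAC ler_pdivrMr //.
  apply: (@le_trans _ _ (4 * i * (g * x * b))); first by rewrite ler_pM2l // mulr_gt0.
  rewrite (_ : K * x ^+ 2 * b = 4 * i * (4 * (g ^+ 3 * x ^+ 2) * b)); last by rewrite /K -/g; ring.
  rewrite ler_pM2l ?mulr_gt0 // ler_pM2r //.
  apply: (@le_trans _ _ (g ^+ 3 * x ^+ 2)); first by rewrite ler_pM //; lra.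
  by rewrite ler_peMl // ?ler1n // mulr_ge0 // exprn_ge0 //; lra.
have sl : s + l <= s1 by apply: le_trans ss1; rewrite lerD2l.
have [fmono] := f_grow rho s0 l0 sl; rewrite -/b -/g -/F.
have -> : i / l = b / 4.
  rewrite /l; field; by rewrite ?gt_eqF.
set F' := (f (s + l) rho.+1)%:R => H.
have D0 : b <= 2 * g * (F' - F) by lra.
have FF : F <= 2 * g * g * x * (F' - F).
  apply: (le_trans fb); rewrite (_ : 2 * g * g * x * (F' - F) = g * x * (2 * g * (F' - F))); last by ring.
  by rewrite ler_wpM2l // (le_trans _ gx).
have Dp : 0 < F' - F.
  by have : 0 < 2 * g * (F' - F) by [lra]; rewrite pmulr_rgt0 // mulr_gt0 //; lra.
exists (s + l); split; first by rewrite lerDl ltW.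
  rewrite -/F'; have F'0 : 0 < F' by lra.
  rewrite -addrA lerD2l.
  rewrite -lerBrDr -mulrBr.
  have -> : F^-1 - F'^-1 = (F' - F) / (F * F') by field; rewrite ?gt_eqF.
  rewrite /l mulrA ler_pdivlMr ?mulr_gt0 // mulrAC ler_pdivrMr //.
  rewrite (_ : K * x ^+ 2 * (F' - F) * b = 4 * i * (4 * (g ^+ 3 * x ^+ 2 * (F' - F) * b))); last by rewrite /K -/g; ring.
  rewrite ler_pM2l ?mulr_gt0 //.
  have P1 : F * F <= 2 * (g ^+ 3 * x ^+ 2 * (F' - F) * b).
    apply: (@le_trans _ _ ((2 * g * g * x * (F' - F)) * (g * x * b))); last by rewrite le_eqVlt; apply/orP; left; apply/eqP; ring.
    by rewrite ler_pM // ltW.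
  have P2 : F * (F' - F) <= g ^+ 3 * x ^+ 2 * (F' - F) * b.
    apply: (@le_trans _ _ (g * x * b * (F' - F))); first by rewrite ler_pM2r.
    rewrite [X in _ <= X](_ : _ = g ^+ 3 * x ^+ 2 * b * (F' - F)); last by ring.
    by rewrite ler_pM2r // ler_pM2r // ler_pM //; lra.
  have Y0 : 0 <= g ^+ 3 * x ^+ 2 * (F' - F) * b by rewrite !mulr_ge0 ?exprn_ge0 // ?ltW //; lra.
  have -> : F * F' = F * F + F * (F' - F) by ring.
  lra.
by rewrite -(ler_nat R) natrD !natrM -/F -/F' -/g -/x; lra.
Qed.

(** Each of [T] steps adds at least the proportion $1/(2\,Gam^2 r)$ of the initial size, unless the
    volume at radius [r] is reached earlier. *)
Lemma climb_double s rho r T : 0 <= s -> (0 < r)%N -> (0 < f s rho)%N ->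
  (4 * m * Gam * r <= f s rho)%N ->
  s + K * r%:R ^+ 2 / (f s rho)%:R <= s1 ->
  exists s' rho', [/\ s <= s', (rho' <= rho + T)%N, (f s rho <= f s' rho')%N,
     s' + K * r%:R ^+ 2 / (f s' rho')%:R <= s + K * r%:R ^+ 2 / (f s rho)%:R &
     (v r < Gam * f s' rho')%N \/ (2 * Gam * Gam * r * f s rho + T * f s rho <= 2 * Gam * Gam * r * f s' rho')%N].
Proof.
move=> s0 r0 f0 fm ss1; elim: T => [|T [s' [rho' [ss' rr ff pot alt]]]].
  by exists s, rho; split=> //; [rewrite addn0|right; rewrite mul0n addn0].
have [big|small] := ltnP (v r) (Gam * f s' rho').
  by exists s', rho'; split=> //; [rewrite (leq_trans rr) // leq_add2l|left].
case: alt => [|alt]; first by rewrite ltnNge small.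
have f'0 : (0 < f s' rho')%N by apply: leq_trans ff.
have [s'' [s2 pot2 g2]] := @climb_step s' rho' r (le_trans s0 ss') r0 f'0 small (leq_trans fm ff) (le_trans pot ss1).
have ff2 : (f s' rho' <= f s'' rho'.+1)%N.
  rewrite -(@leq_pmul2l (2 * Gam * Gam * r)) ?muln_gt0 ?Gam1 //.
  by apply: leq_trans g2; rewrite leq_addr.
exists s'', rho'.+1; split.
- exact: le_trans s2.
- by rewrite addnS ltnS.
- exact: leq_trans ff2.
- exact: le_trans pot.
- right; apply: leq_trans g2; rewrite mulSn addnCA addnC leq_add //.
Qed.

(** [D] doublings. The number [D] only enters the radius used; the voltage is bounded by the initial
    reserve. *)
Lemma climb D s rho r : 0 <= s -> (0 < r)%N -> (0 < f s rho)%N ->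
  (4 * m * Gam * r <= f s rho)%N ->
  s + K * r%:R ^+ 2 / (f s rho)%:R <= s1 -> (v r < 2 ^ D * f s rho)%N ->
  exists s' rho', [/\ s <= s', (rho' <= rho + D * (2 * Gam * Gam * r))%N,
     s' <= s + K * r%:R ^+ 2 / (f s rho)%:R & (v r < Gam * f s' rho')%N].
Proof.
elim: D s rho => [|D IH] s rho s0 r0 f0 fm ss1 vD.
  exists s, rho; split=> //; first by rewrite addn0.
    by rewrite lerDl climb_cost_ge0.
  by apply: (leq_trans vD); rewrite expn0 mul1n leq_pmull.
have [s' [rho' [ss' rr ff pot alt]]] := @climb_double s rho r (2 * Gam * Gam * r) s0 r0 f0 fm ss1.
have f'0 : (0 < f s' rho')%N by apply: leq_trans ff.
have pot' : s' <= s + K * r%:R ^+ 2 / (f s rho)%:R.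
  by apply: le_trans pot; rewrite lerDl climb_cost_ge0.
case: alt => [big|dbl].
  by exists s', rho'; split=> //; rewrite (leq_trans rr) // leq_add2l mulSn leq_addr.
have f2 : (2 * f s rho <= f s' rho')%N.
  rewrite -(@leq_pmul2l (2 * Gam * Gam * r)) ?muln_gt0 ?Gam1 //.
  by apply: leq_trans dbl; move: (2 * Gam * Gam * r)%N (f s rho) => q ?; lia.
have vD' : (v r < 2 ^ D * f s' rho')%N.
  by apply: (leq_trans vD); rewrite expnSr -mulnA leq_mul2l f2 orbT.
have [s'' [rho'' [h1 h2 h3 h4]]] := IH s' rho' (le_trans s0 ss') r0 f'0 (leq_trans fm ff) (le_trans pot ss1) vD'.
exists s'', rho''; split=> //; first exact: le_trans h1.
  by move: h2 rr; rewrite mulSn; move: (2 * Gam * Gam * r)%N => q; lia.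
exact: le_trans pot.
Qed.

End Climb.

(** * Passing from one dyadic scale to a later one *)

Lemma radius_base (G m mu c0 c1 e : nat) : (1 <= G)%N -> (1 <= m)%N -> (mu <= m)%N ->
  (4 * m * G + (2 * (4 * mu + c1) + 8 * e) * (2 * G * G) <=
   2 * G * G * (20 + 4 * G + 4 * c0 + 4 * c1) * (m + e))%N.
Proof.
move=> G1 m1 mum.
have G2 : (G * m <= G * G * m)%N by rewrite leq_mul2r leq_pmulr ?orbT.
have E : (2 * G * G = 2 * (G * G))%N by rewrite mulnA.
rewrite E -[X in (_ <= X)%N]mulnA; move: (G * G)%N G2 => g G2 {E}.
apply: (@leq_trans (g * (4 * m + 16 * mu + 4 * c1 + 16 * e))); first by lia.
rewrite [(2 * g)%N]mulnC -mulnA leq_mul2l; apply/orP; right.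
have me : (0 < m + e)%N by lia.
have h1 := leq_pmulr c1 me; clear -h1 mum m1 me; nia.
Qed.

Lemma radius_jump (G m mu c0 c1 e e' : nat) : (1 <= m)%N -> (mu <= m)%N -> (e <= e')%N ->
  (2 * (2 * (e + mu + c0) + 8 * e' + 2 * G) <= (20 + 4 * G + 4 * c0 + 4 * c1) * (m + e'))%N.
Proof.
move=> m1 mum ee; have me : (0 < m + e')%N by lia.
have h1 := leq_pmulr c0 me; have h2 := leq_pmulr G me.
clear -h1 h2 mum m1 me ee; nia.
Qed.

Lemma mul_swap4 (g z x y : nat) : (g * z * (x * y) = z * y * (g * x))%N.
Proof. ring. Qed.

Lemma ler_divs (R : realFieldType) (a b c d : R) : (0 < b -> 0 < d -> a * d <= c * b -> a / b <= c / d)%R.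
Proof. by move=> b0 d0; rewrite ler_pdivrMr // [(c / d * b)%R]mulrAC ler_pdivlMr. Qed.

Section Chain.
Local Open Scope ring_scope.
Variables (R : realFieldType) (Gam : nat) (v : nat -> nat) (mu c0 c1 : nat) (i s1 : R).
Hypothesis Gam1 : (1 <= Gam)%N.
Hypothesis i0 : 0 < i.
Hypothesis v_quad : forall r, (r * r <= Gam * v r)%N.
Let m := (2 ^ mu)%N.

Lemma ea_ex a : exists e, (Gam * v (2 ^ a) <= 4 ^ a * 256 ^ e)%N.
Proof.
exists (Gam * v (2 ^ a))%N; apply: (leq_trans _ (leq_pmull _ _)); last by rewrite expn_gt0.
by apply: ltnW; apply: ltn_expl.
Qed.

(** The excess over quadratic growth: up to constants, the volume at radius [2^a] is
    [4^a * 256^(ea a)]. *)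
Definition ea a := ex_minn (ea_ex a).

Lemma ea1 a : (Gam * v (2 ^ a) <= 4 ^ a * 256 ^ ea a)%N.
Proof. by rewrite /ea; case: ex_minnP. Qed.

Lemma quad4 a : (4 ^ a <= Gam * v (2 ^ a))%N.
Proof. by apply: leq_trans (v_quad _); rewrite -expnMn. Qed.

Lemma ea2 a : (4 ^ a * 256 ^ ea a <= 256 * (Gam * v (2 ^ a)))%N.
Proof.
rewrite /ea; case: ex_minnP => -[|e] _ emin.
  by rewrite muln1 (leq_trans (quad4 a)) // leq_pmull.
have : ~~ (Gam * v (2 ^ a) <= 4 ^ a * 256 ^ e)%N by apply/negP => /emin; rewrite ltnn.
by rewrite -ltnNge => /ltnW; rewrite expnS mulnCA leq_mul2l orbC => ->.
Qed.

Lemma v_le a : (v (2 ^ a) <= 4 ^ a * 256 ^ ea a)%N.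
Proof. by apply: leq_trans (ea1 a); rewrite leq_pmull. Qed.

(** Length of a jump. Level sets filling scale [a] live within a radius of order [2^a (m + ea a)],
    and [2^(a + La a)] is large enough to contain this region. *)
Definition La a := (ea a + mu + c0)%N.
Definition a0 := (4 * mu + c1)%N.
Definition Crho := (2 * Gam * Gam * (20 + 4 * Gam + 4 * c0 + 4 * c1))%N.
Definition Cj := (4096 * Gam ^ 5 * 4 ^ c0)%N.
Definition Cs := (12 * Gam ^ 2 * 2 ^ c1)%N.
(** Voltage budget at scale [a]: the initial climb, then jumps whose costs at least halve with each
    increase of [ea], whence the partial sum of a geometric series. *)
Definition Sa a : R := (Cs * m ^ 5)%:R * i + (Cj * m ^ 2)%:R * i * (2 - 2 / (2 ^ ea a)%:R).

Hypothesis c1_big : (2 ^ (10 + c0 + Gam) * Gam ^ 3 <= 2 ^ c1)%N.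
Hypothesis i_small : (Cs * m ^ 5)%:R * i + (Cj * m ^ 2)%:R * i * (2 + (4 ^ Gam)%:R) <= s1.

Variables (f bf : R -> nat -> nat) (rho1 : nat).
Hypothesis f_grow : forall s rho l, 0 <= s -> 0 < l -> s + l <= s1 ->
  (f s rho <= f (s + l) rho.+1)%N /\
  (bf s rho)%:R <= m%:R + Gam%:R * ((f (s + l) rho.+1)%:R - (f s rho)%:R) + i / l.
Hypothesis f_iso : forall s rho r, 0 <= s <= s1 -> (0 < r)%N -> (Gam * f s rho <= v r)%N ->
  (f s rho <= Gam * r * bf s rho)%N.
Hypothesis f_unit : forall s rho, 0 <= s -> s + 2 * i <= s1 -> (rho < rho1)%N ->
  (f s rho < f (s + 2 * i) rho.+1)%N.
Hypothesis f00 : (0 < f 0 0)%N.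

Let m1 : (1 <= m)%N. Proof. by rewrite expn_gt0. Qed.
Let mum : (mu <= m)%N. Proof. by apply: ltnW; exact: ltn_expl. Qed.
Let K : R := 16 * Gam%:R ^+ 3 * i.

Lemma CjE : (Cj * m ^ 2)%:R = 4096 * Gam%:R ^+ 5 * 4 ^+ c0 * m%:R ^+ 2 :> R.
Proof. by rewrite -!natrX -!natrM. Qed.

Definition reach a := exists s rho,
  [/\ 0 <= s, s <= Sa a, (rho <= Crho * (2 ^ a * (m + ea a)))%N & (v (2 ^ a) < Gam * f s rho)%N].

Lemma Sa_le a : Sa a <= (Cs * m ^ 5)%:R * i + (Cj * m ^ 2)%:R * i * 2.
Proof.
rewrite /Sa lerD2l; apply: ler_wpM2l; first by rewrite mulr_ge0 // ltW.
by rewrite gerBl divr_ge0.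
Qed.

Lemma units T : (T <= rho1)%N -> 2 * i * T%:R <= s1 -> (T < f (2 * i * T%:R) T)%N.
Proof.
elim: T => [|T IH] Tr Ts; first by rewrite mulr0.
have E : 2 * i * T.+1%:R = 2 * i * T%:R + 2 * i by rewrite -(natr1 T) mulrDr mulr1.
have p : 0 <= 2 * i * T%:R by rewrite !mulr_ge0 // ltW.
have i20 : 0 < 2 * i by rewrite mulr_gt0.
have Ts' : 2 * i * T%:R <= s1 by apply: le_trans Ts; rewrite E lerDl ltW.
by rewrite E in Ts *; apply: leq_ltn_trans (IH (ltnW Tr) Ts') _; apply: f_unit.
Qed.

(** Isoperimetric climbing to radius [r] needs a size of at least [4 m Gam r]. That many vertices
    are first gained one by one, each for a voltage [2 i]; as [2^a0] is of order [m^4], this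
    explains the [m^5] of the budget. *)
Lemma reach_base : (4 * m * Gam * 2 ^ a0 <= rho1)%N -> reach a0.
Proof.
move=> Mr; pose M := (4 * m * Gam * 2 ^ a0)%N.
have M0 : (0 < M)%N by rewrite !muln_gt0 m1 Gam1 expn_gt0.
have E2 : (2 ^ a0 = m ^ 4 * 2 ^ c1)%N by rewrite /a0 expnD [(4 * mu)%N]mulnC expnM.
have s5 : 8 * m%:R * Gam%:R * (2 ^ a0)%:R * i + 4 * Gam%:R ^+ 2 * (2 ^ a0)%:R * i <= (Cs * m ^ 5)%:R * i.
  rewrite -mulrDl ler_pM2r // -!natrX -!natrM -natrD ler_nat /Cs E2.
  rewrite expnS; move: (2 ^ c1)%N (m ^ 4)%N => X Y.
  have E : (8 * m * Gam + 4 * Gam ^ 2 <= 12 * Gam ^ 2 * m)%N.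
    have h1 := leq_pmulr (Gam ^ 2) m1; have h2 := leq_mul (leq_pmulr Gam Gam1) (leqnn m).
    rewrite mulnn in h2; move: h1 h2; move: (Gam ^ 2)%N => g2; nia.
  by have := leq_mul E (leqnn (Y * X)); nia.
have Scs : (Cs * m ^ 5)%:R * i <= s1.
  apply: le_trans i_small; rewrite lerDl; apply: mulr_ge0; last by rewrite addr_ge0.
  by apply: mulr_ge0 => //; exact: ltW.
have Ms : 2 * i * M%:R <= 8 * m%:R * Gam%:R * (2 ^ a0)%:R * i.
  by rewrite /M !natrM; lra.
have g2 : 0 <= 4 * Gam%:R ^+ 2 * (2 ^ a0)%:R * i :> R by rewrite !mulr_ge0 ?exprn_ge0 // ltW.
have Ms1 : 2 * i * M%:R <= s1 by lra.
have Mf := units Mr Ms1.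
have p : 0 <= 2 * i * M%:R by rewrite !mulr_ge0 // ltW.
have cost : K * (2 ^ a0)%:R ^+ 2 / (f (2 * i * M%:R) M)%:R <= 4 * Gam%:R ^+ 2 * (2 ^ a0)%:R * i.
  rewrite ler_pdivrMr ?ltr0n ?(leq_ltn_trans _ Mf) //.
  apply: (@le_trans _ _ (4 * Gam%:R ^+ 2 * (2 ^ a0)%:R * i * M%:R)); last first.
    by rewrite ler_wpM2l // ler_nat ltnW.
  rewrite /K /M !natrM.
  rewrite (_ : 4 * _ ^+ 2 * _ * i * _ = 16 * Gam%:R ^+ 3 * i * (2 ^ a0)%:R ^+ 2 * m%:R :> R); last by ring.
  by rewrite ler_peMr ?ler1n // !mulr_ge0 ?exprn_ge0 // ltW.
have tot : 2 * i * M%:R + K * (2 ^ a0)%:R ^+ 2 / (f (2 * i * M%:R) M)%:R <= (Cs * m ^ 5)%:R * i by lra.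
have vD : (v (2 ^ a0) < 2 ^ (2 * a0 + 8 * ea a0) * f (2 * i * M%:R) M)%N.
  apply: (leq_ltn_trans (v_le _)); rewrite expnD !expnM.
  by rewrite -[X in (X < _)%N]muln1 ltn_pmul2l ?muln_gt0 ?expn_gt0 // (leq_ltn_trans M0).
have [s' [rho' [h1 h2 h3 h4]]] := climb Gam1 m1 i0 f_grow f_iso p (expn_gt0 _ _ : (0 < 2 ^ a0)%N)
  (leq_ltn_trans (leq0n _) Mf) (ltnW Mf) (le_trans tot Scs) vD.
exists s', rho'; split=> //; first exact: le_trans h1.
  apply: (le_trans h3); apply: (le_trans tot); rewrite /Sa lerDl; apply: mulr_ge0; first by rewrite mulr_ge0 // ltW.
  rewrite subr_ge0 ler_pdivrMr ?ltr0n ?expn_gt0 // ler_peMr // ler1n expn_gt0 //.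
apply: (leq_trans h2); rewrite /M.
have H : (4 * m * Gam + (2 * a0 + 8 * ea a0) * (2 * Gam * Gam) <= Crho * (m + ea a0))%N.
  exact: radius_base.
move: (2 ^ a0)%N => X; apply: (@leq_trans ((4 * m * Gam + (2 * a0 + 8 * ea a0) * (2 * Gam * Gam)) * X)).
  by rewrite [X in (_ <= X)%N]mulnDl -!mulnA.
by rewrite [(X * _)%N]mulnC [(Crho * _)%N]mulnA leq_mul2r H orbT.
Qed.

(** A level set filling scale [a] has size at least [4^a * 256^(ea a)] up to constants. This is
    enough to start a climb towards any scale up to [a + La a + Gam], and gives its cost. *)
Lemma reach_start a s rho l : (a0 <= a)%N -> (v (2 ^ a) < Gam * f s rho)%N ->
  (l <= La a + Gam)%N ->
  [/\ (0 < f s rho)%N, (4 * m * Gam * 2 ^ (a + l) <= f s rho)%N &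
   K * (2 ^ (a + l))%:R ^+ 2 / (f s rho)%:R <= 16 * 256 * Gam%:R ^+ 5 * i * (4 ^ l)%:R / (256 ^ ea a)%:R].
Proof.
move=> a0a vf lL.
have f0 : (0 < f s rho)%N by case: (f s rho) vf => //; rewrite muln0.
have H : (4 ^ a * 256 ^ ea a <= 256 * Gam ^ 2 * f s rho)%N.
  apply: (leq_trans (ea2 a)); rewrite -mulnA leq_mul2l -mulnn -mulnA leq_mul2l.
  by rewrite (ltnW vf) !orbT.
split=> //.
  have X : (2 ^ (10 + c0 + Gam) * Gam ^ 3 * m ^ 4 <= 2 ^ a)%N.
    apply: (@leq_trans (2 ^ a0)); last by rewrite leq_exp2l.
    have -> : (2 ^ a0 = m ^ 4 * 2 ^ c1)%N by rewrite /a0 expnD [(4 * mu)%N]mulnC expnM.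
    by rewrite [X in (_ <= X)%N]mulnC leq_mul2r c1_big orbT.
  have Y : (2 ^ l <= 2 ^ ea a * m * 2 ^ (c0 + Gam))%N.
    by rewrite /m -!expnD leq_exp2l //; move: lL; rewrite /La; lia.
  rewrite -(@leq_pmul2l (256 * Gam ^ 2)) ?muln_gt0 ?expn_gt0 ?Gam1 //.
  apply: leq_trans H; rewrite expnD.
  apply: (@leq_trans (256 * Gam ^ 2 * (4 * m * Gam * (2 ^ a * (2 ^ ea a * m * 2 ^ (c0 + Gam)))))).
    by rewrite !leq_mul2l Y !orbT.
  have -> : (4 ^ a = 2 ^ a * 2 ^ a)%N by rewrite -expnMn.
  have e8 : (2 ^ ea a <= 256 ^ ea a)%N by case: (ea a) => // e; rewrite leq_exp2r.
  have m4 : (m * m <= m ^ 4)%N by rewrite mulnn leq_pexp2l.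
  apply: (@leq_trans (2 ^ (10 + c0 + Gam) * Gam ^ 3 * m ^ 4 * 2 ^ a * 2 ^ ea a)); last first.
    by apply: leq_mul => //; apply: leq_mul.
  rewrite -addnA [(2 ^ (10 + _))%N]expnD -[(2 ^ 10)%N]/(1024)%N.
  apply: (@leq_trans (1024 * 2 ^ (c0 + Gam) * Gam ^ 3 * (m * m) * 2 ^ a * 2 ^ ea a)); last first.
    by do 3 apply: leq_mul => //.
  rewrite [(Gam ^ 3)%N]expnSr; move: (2 ^ (c0 + Gam))%N (Gam ^ 2)%N (2 ^ a)%N (2 ^ ea a)%N => A C D E.
  by clear; lia.
have fR : 0 < (f s rho)%:R :> R by rewrite ltr0n.
apply: ler_divs; rewrite ?ltr0n ?expn_gt0 //.
have E : (2 ^ (a + l))%:R ^+ 2 = (4 ^ a)%:R * (4 ^ l)%:R :> R.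
  by rewrite -natrX -natrM -expnD -[4%N]/(2 ^ 2)%N -!expnM mulnC.
have HR : (4 ^ a)%:R * (256 ^ ea a)%:R <= 256 * Gam%:R ^+ 2 * (f s rho)%:R :> R.
  by rewrite -natrX -!natrM ler_nat.
rewrite E /K; set X := (4 ^ a)%:R in HR *; set Y := (256 ^ _)%:R in HR *; set Z := (4 ^ l)%:R.
set g := Gam%:R in HR *; set F := (f _ _)%:R in HR *.
rewrite (_ : 16 * g ^+ 3 * i * (X * Z) * Y = 16 * g ^+ 3 * i * Z * (X * Y)); last by ring.
rewrite (_ : 16 * 256 * g ^+ 5 * i * Z * F = 16 * g ^+ 3 * i * Z * (256 * g ^+ 2 * F)); last by ring.
by apply: ler_wpM2l => //; rewrite !mulr_ge0 ?exprn_ge0 // ltW.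
Qed.

(** Up to constants and the factor [i], the jump costs [m^2 4^(ea a) / 256^(ea a)], hence at most
    [m^2 / 2^(ea a)], which fits in the increase of [Sa] because [ea] increases strictly. *)
Lemma reach_jump a : (a0 <= a)%N -> reach a -> (ea a < ea (a + La a))%N -> (0 < c0)%N -> reach (a + La a).
Proof.
move=> a0a [s [rho [s0 sS rr vf]]] ee c00.
have [f0 f4 cost] := reach_start a0a vf (leq_addr Gam (La a)).
set a' := (a + La a)%N in ee f4 cost *.
have cost' : 16 * 256 * Gam%:R ^+ 5 * i * (4 ^ La a)%:R / (256 ^ ea a)%:R <=
    (Cj * m ^ 2)%:R * i / (2 ^ ea a)%:R :> R.
  apply: ler_divs; rewrite ?ltr0n ?expn_gt0 //.
  rewrite CjE /La !expnD !natrM !natrX.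
  have -> : (256 : R) = 2 ^+ 8 by rewrite -natrX.
  have -> : (4 : R) = 2 ^+ 2 by rewrite -natrX.
  rewrite -!exprM.
  have : (2 : R) ^+ (2 * ea a) * 2 ^+ ea a <= 2 ^+ (8 * ea a).
    by rewrite -exprD ler_eXn2l ?ltr1n //; lia.
  rewrite [(mu * 2)%N]mulnC; move: (2 ^+ (2 * ea a)) (2 ^+ ea a) (2 ^+ (8 * ea a)) (2 ^+ (2 * mu)) (exprn_ge0 (2 * mu) (ler0n R 2)) => X Y Z T T0 XYZ.
  set g := Gam%:R; set c := 2 ^+ (2 * c0).
  rewrite (_ : _ * Y = 16 * 2 ^+ 8 * g ^+ 5 * i * T * c * (X * Y)); last by ring.
  rewrite (_ : _ * Z = 16 * 2 ^+ 8 * g ^+ 5 * i * T * c * Z); last by ring.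
  by apply: ler_wpM2l => //; rewrite !mulr_ge0 ?exprn_ge0 // ltW.
have Ss : Sa a + (Cj * m ^ 2)%:R * i / (2 ^ ea a)%:R <= Sa a'.
  rewrite /Sa -addrA lerD2l -mulrDr; apply: ler_wpM2l; first by rewrite mulr_ge0 // ltW.
  have : 2 / (2 ^ ea a')%:R <= 1 / (2 ^ ea a)%:R :> R.
    apply: ler_divs; rewrite ?ltr0n ?expn_gt0 // mul1r.
    by rewrite -natrM ler_nat -expnS leq_exp2l.
  have -> : 1 / (2 ^ ea a)%:R = (2 ^ ea a)%:R^-1 :> R by rewrite mul1r.
  have -> : 2 / (2 ^ ea a)%:R = (2 ^ ea a)%:R^-1 + (2 ^ ea a)%:R^-1 :> R by rewrite mulrDl mul1r.
  by move: ((2 ^ ea a)%:R^-1) (2 / _) => p q; lra.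
have tot : s + K * (2 ^ a')%:R ^+ 2 / (f s rho)%:R <= Sa a'.
  by apply: le_trans Ss; apply: lerD => //; apply: le_trans cost'.
have S1 : Sa a' <= s1.
  apply: le_trans (Sa_le _) (le_trans _ i_small); rewrite lerD2l; apply: ler_wpM2l.
    by rewrite mulr_ge0 // ltW.
  by rewrite lerDl.
have vD : (v (2 ^ a') < 2 ^ (2 * La a + 8 * ea a' + 2 * Gam) * f s rho)%N.
  apply: (leq_ltn_trans (v_le _)).
  have h1 : (4 ^ a < Gam ^ 2 * f s rho)%N.
    by apply: (leq_ltn_trans (quad4 a)); rewrite -mulnn -mulnA ltn_pmul2l.
  have h2 : (Gam ^ 2 <= 2 ^ (2 * Gam))%N.
    by rewrite mulnC expnM -!mulnn leq_mul // ltnW // ltn_expl.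
  have -> : (2 ^ (2 * La a + 8 * ea a' + 2 * Gam) = 4 ^ La a * 256 ^ ea a' * 2 ^ (2 * Gam))%N.
    by rewrite -[4%N]/(2 ^ 2)%N -[256%N]/(2 ^ 8)%N -!expnM -!expnD.
  have -> : (4 ^ a' = 4 ^ a * 4 ^ La a)%N by rewrite expnD.
  rewrite -[(4 ^ a * _ * _)%N]mulnA [(4 ^ a * _)%N]mulnC -[X in (_ < X)%N]mulnA.
  rewrite ltn_pmul2l ?muln_gt0 ?expn_gt0 //.
  by apply: (leq_trans h1); rewrite leq_mul2r h2 orbT.
have [s' [rho' [h1 h2 h3 h4]]] := climb Gam1 m1 i0 f_grow f_iso s0 (expn_gt0 2 a' : (0 < 2 ^ a')%N)
  f0 f4 (le_trans tot S1) vD.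
exists s', rho'; split=> //; [exact: le_trans h1|exact: le_trans tot|].
apply: (leq_trans h2).
have ha : (2 * 2 ^ a <= 2 ^ a')%N by rewrite -expnS leq_exp2l // -addn1 leq_add2l (leq_trans c00) // leq_addl.
have step1 : (2 * (Crho * (2 ^ a * (m + ea a))) <= Crho * (2 ^ a' * (m + ea a')))%N.
  rewrite mulnCA leq_mul2l mulnA; apply/orP; right; apply: leq_mul => //.
  by rewrite leq_add2l ltnW.
have step2 : (2 * ((2 * La a + 8 * ea a' + 2 * Gam) * (2 * Gam * Gam * 2 ^ a')) <= Crho * (2 ^ a' * (m + ea a')))%N.
  have rj := @radius_jump Gam m mu c0 c1 (ea a) (ea a') m1 mum (ltnW ee).
  rewrite [X in (X <= _)%N]mulnA /Crho [X in (_ <= X)%N]mul_swap4.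
  exact: leq_mul rj (leqnn _).
rewrite -(@leq_pmul2l 2) // mulnDr [X in (_ <= X)%N]mul2n -addnn.
by apply: leq_add => //; apply: leq_trans step1; rewrite leq_mul2l rr orbT.
Qed.

(** One last jump, without condition on [ea], paid by the reserve [4 ^ Gam] in [i_small]. *)
Lemma reach_end a l : (a0 <= a)%N -> reach a -> (l <= La a + Gam)%N ->
  exists s rho, 0 <= s <= s1 /\ (v (2 ^ (a + l)) < Gam * f s rho)%N.
Proof.
move=> a0a [s [rho [s0 sS rr vf]]] lL.
have [f0 f4 cost] := reach_start a0a vf lL.
have cost' : 16 * 256 * Gam%:R ^+ 5 * i * (4 ^ l)%:R / (256 ^ ea a)%:R <=
    (Cj * m ^ 2)%:R * i * (4 ^ Gam)%:R :> R.
  rewrite ler_pdivrMr ?ltr0n ?expn_gt0 //.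
  have h : (4 ^ l <= 4 ^ c0 * m ^ 2 * 4 ^ Gam * 256 ^ ea a)%N.
    apply: (@leq_trans (4 ^ (La a + Gam))); first by rewrite leq_exp2l.
    have -> : (m ^ 2 = 4 ^ mu)%N by rewrite /m -expnM mulnC expnM.
    have e8 : (4 ^ ea a <= 256 ^ ea a)%N by case: (ea a) => // e; rewrite leq_exp2r.
    rewrite /La !expnD; apply: leq_trans (leq_mul (leqnn _) e8).
    by rewrite leq_eqVlt; apply/orP; left; apply/eqP; rewrite mulnC -!mulnA; ring.
  have hR : (4 ^ l)%:R <= (4 ^ c0)%:R * (m ^ 2)%:R * (4 ^ Gam)%:R * (256 ^ ea a)%:R :> R.
    by rewrite -!natrM ler_nat.
  rewrite CjE; rewrite (natrX _ m) in hR; set X := (4 ^ l)%:R in hR *; set Y := (256 ^ _)%:R in hR *.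
  rewrite -(natrX _ 4 c0); set Z := (4 ^ c0)%:R in hR *; set T := m%:R ^+ 2 in hR *; set U := (4 ^ Gam)%:R in hR *.
  set g := Gam%:R.
  rewrite [X in _ <= X](_ : _ = 4096 * g ^+ 5 * i * (Z * T * U * Y)); last by ring.
  rewrite (_ : (16 : R) * 256 = 4096); last by rewrite -natrM.
  by apply: ler_wpM2l => //; rewrite !mulr_ge0 ?exprn_ge0 // ltW.
have tot : s + K * (2 ^ (a + l))%:R ^+ 2 / (f s rho)%:R <= s1.
  apply: le_trans i_small; rewrite mulrDr addrA.
  by apply: lerD; [exact: le_trans sS (Sa_le a)|exact: le_trans cost'].
have vD : (v (2 ^ (a + l)) < 2 ^ v (2 ^ (a + l)) * f s rho)%N.
  by apply: (leq_trans (ltn_expl _ (isT : 1 < 2)%N)); rewrite leq_pmulr.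
have [s' [rho' [h1 h2 h3 h4]]] := climb Gam1 m1 i0 f_grow f_iso s0 (expn_gt0 2 (a + l) : (0 < 2 ^ (a + l))%N)
  f0 f4 tot vD.
by exists s', rho'; split=> //; rewrite (le_trans s0 h1) (le_trans h3 tot).
Qed.

End Chain.

(** * Current through the level sets of a Green function *)

Section Levels.
Local Open Scope fset_scope.
Local Open Scope ring_scope.
Variables (V : choiceType) (nb : V -> {fset V}).
Hypothesis nbC : forall x y, (y \in nb x) = (x \in nb y).
Variable R : realFieldType.
Variables (D : pred V) (W : {fset V}) (ka : V -> nat) (g : V -> R) (y : V).
Hypotheses (yW : y \in W) (Dy : D y) (kay : (0 < ka y)%N).
Hypothesis g0 : forall v, v \notin W -> g v = 0.
Hypothesis g_ge0 : forall v, 0 <= g v.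
Hypothesis gL : forall v, v \in W -> D v ->
  \sum_(w <- nb v | D w) (g v - g w) + (ka v)%:R * g v = (v == y)%:R.

(* Summation by parts: [F] tests the equation for [g], and the killing at [y]
   absorbs all but [1 - g y] of the unit charge. *)
Lemma energy_le (F : V -> R) (U : {fset V}) :
  (forall v, 0 <= F v) -> (forall v, ~~ D v -> F v = 0) -> (forall v, v \notin W -> F v = 0) ->
  (forall v w, D v -> D w -> 0 <= (F v - F w) * (g v - g w)) ->
  \sum_(v <- U) \sum_(w <- nb v) (D v && D w)%:R * ((F v - F w) * (g v - g w)) <=
  2 * (F y * (1 - g y)).
Proof.
move=> F0 FD FW Fg; pose U' := U `|` (W `|` obd nb W).
pose e v w : R := ((w \in nb v) && (D v && D w))%:R.
have eC v w : e v w = e w v by rewrite /e nbC [D v && _]andbC.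
apply: (@le_trans _ _ (\sum_(v <- U') \sum_(w <- nb v) (D v && D w)%:R * ((F v - F w) * (g v - g w)))).
  apply: sum_fset_le; first exact: fsubsetUl.
  move=> v _; apply: sumr_ge0 => w _.
  by have [/andP[Dv Dw]|] := boolP (D v && D w); rewrite ?mul0r // mul1r Fg.
have nbU v w : v \in W -> w \in nb v -> w \in U'.
  move=> vW wv; rewrite !in_fsetU; have [|wW] := boolP (w \in W); rewrite ?orbT //=.
  by apply/orP; right; apply/obdP; split=> //; exists v.
have E1 : \sum_(v <- U') \sum_(w <- nb v) (D v && D w)%:R * ((F v - F w) * (g v - g w)) =
    \sum_(v <- U') \sum_(w <- U') e v w * ((F v - F w) * (g v - g w)).
  apply: eq_bigr => v _; rewrite (@sum_sub0 _ R (nb v) U' xpredT).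
    by apply: eq_bigr => w _; rewrite /e andbT mulrA -natrM mulnb.
  move=> w wv wU; have vW : v \notin W by apply: contra wU => vW; exact: nbU wv.
  have wW : w \notin W by apply: contra wU => wW; rewrite !in_fsetU wW orbT.
  by rewrite !FW // subr0 mul0r mulr0.
have E2 : \sum_(v <- U') \sum_(w <- U') e v w * ((F v - F w) * (g v - g w)) =
    2 * \sum_(v <- U') F v * \sum_(w <- U') e v w * (g v - g w).
  transitivity (\sum_(v <- U') F v * (\sum_(w <- U') e v w * (g v - g w)) +
                \sum_(w <- U') F w * (\sum_(v <- U') e w v * (g w - g v))); last by rewrite mulrDl mul1r.
  rewrite [X in _ + X](_ : _ = \sum_(v <- U') \sum_(w <- U') F w * (e w v * (g w - g v))); last first.
    by rewrite exchange_big /=; apply: eq_bigr => w _; rewrite mulr_sumr.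
  rewrite -big_split; apply: eq_bigr => v _; rewrite mulr_sumr -big_split; apply: eq_bigr => w _ /=.
  by rewrite (eC w v); ring.
rewrite E1 E2 ler_pM2l ?ltr0n //.
have yU : y \in U' by rewrite !in_fsetU yW orbT.
rewrite -(sum_delta (fun v => F v * (1 - g y)) yU) big_seq [X in _ <= X]big_seq.
apply: ler_sum => v vU.
have [Dv|/FD ->] := boolP (D v); last by rewrite !mul0r mulr0.
have [vW|/FW ->] := boolP (v \in W); last by rewrite !mul0r mulr0.
have -> : \sum_(w <- U') e v w * (g v - g w) = (v == y)%:R - (ka v)%:R * g v.
  rewrite -(gL vW Dv) addrK (@sum_sub0 _ R (nb v) U' D).
    by apply: eq_bigr => w _; rewrite /e Dv.
  by move=> w wv; rewrite (nbU _ _ vW wv).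
rewrite [X in _ <= X]mulrCA; apply: ler_wpM2l => //.
have [->|_] := eqVneq v y; last by rewrite mul0r sub0r oppr_le0 mulr_ge0.
rewrite mul1r lerD2l lerN2 -[X in X <= _]mul1r; apply: ler_wpM2r => //.
by rewrite ler1n.
Qed.

(** Energy bound for the indicator of [t < g]: the current across level [t] is at most $1 - g(y)$,
    and each edge is counted in both directions. *)
Lemma level_flow t (U : {fset V}) : 0 <= t < g y ->
  \sum_(v <- U) \sum_(w <- nb v) [&& D v, D w & (t < g v) != (t < g w)]%:R * `|g v - g w| <=
  2 * (1 - g y).
Proof.
move=> /andP[t0 ty]; pose F v : R := (D v && (t < g v))%:R.
have FyE : F y = 1 by rewrite /F Dy ty.
have H := @energy_le F U; rewrite FyE mul1r in H; apply: le_trans (H _ _ _ _).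
- apply: ler_sum => v _; apply: ler_sum => w _; rewrite /F.
  case: (D v) (D w) => -[] //=; rewrite ?mul0r // !mul1r.
  have [tv|tv] := ltP t (g v); have [tw|tw] := ltP t (g w); rewrite /= ?mul0r ?mul1r.
  + by rewrite subrr mul0r.
  + by rewrite subr0 mul1r ger0_norm // subr_ge0 (le_trans tw) // ltW.
  + by rewrite sub0r mulN1r opprB distrC ger0_norm // subr_ge0 (le_trans tv) // ltW.
  + by rewrite subrr mul0r.
- by move=> v; rewrite /F ler0n.
- by move=> v /negPf; rewrite /F => ->.
- by move=> v vW; rewrite /F g0 // ltNge t0 andbF.
- move=> v w Dv Dw; rewrite /F Dv Dw /=.
  have [tv|tv] := ltP t (g v); have [tw|tw] := ltP t (g w); rewrite /= ?subrr ?mul0r //.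
  + by rewrite subr0 mul1r subr_ge0 (le_trans tw) // ltW.
  + by rewrite sub0r mulN1r opprB subr_ge0 (le_trans tv) // ltW.
Qed.

Lemma sum_swap_le (T : V -> V -> R) (S Z : {fset V}) : (forall v w, 0 <= T v w) ->
  (forall v w, w \notin Z -> T v w = 0) ->
  \sum_(v <- S) \sum_(w <- nb v) T v w <= \sum_(w <- Z) \sum_(v <- nb w) T v w.
Proof.
move=> T0 TZ; have -> : \sum_(v <- S) \sum_(w <- nb v) T v w =
    \sum_(v <- S) \sum_(w <- Z) ((w \in nb v) && true)%:R * T v w.
  by apply: eq_bigr => v _; rewrite (@sum_sub0 _ R (nb v) Z xpredT) // => w _; exact: TZ.
rewrite exchange_big /=; apply: ler_sum => w _.
apply: (@le_trans _ _ (\sum_(v <- [fset v in S | v \in nb w]) T v w)).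
  rewrite big_fset /= [X in _ <= X]big_mkcond; apply: ler_sum => v _.
  by rewrite andbT nbC; case: (v \in nb w); rewrite ?mul1r ?mul0r.
apply: sum_fset_le => //; by apply/fsubsetP => v; rewrite in_sep => /andP[].
Qed.

Variable k : nat.
Hypothesis nbk : forall x, (#|` nb x| <= k)%N.

(** A boundary edge of [S] either ends in [S'], at most [k] times per new vertex, or is of one of
    two exceptional kinds that are counted separately. *)
Lemma bd_split (S S' : {fset V}) (T1 T2 : V -> V -> bool) : S `<=` S' ->
  (forall v w, v \in S -> w \in nb v -> w \notin S -> [|| w \in S', T1 v w | T2 v w]) ->
  (bd nb S)%:R <= k%:R * (#|` S'|%:R - #|` S|%:R) +
    \sum_(v <- S) \sum_(w <- nb v) (T1 v w)%:R + \sum_(v <- S) \sum_(w <- nb v) (T2 v w)%:R :> R.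
Proof.
move=> SS' H.
apply: (@le_trans _ _ (\sum_(v <- S) \sum_(w <- nb v) (w \in S' `\` S)%:R +
   \sum_(v <- S) \sum_(w <- nb v) (T1 v w)%:R + \sum_(v <- S) \sum_(w <- nb v) (T2 v w)%:R)).
  rewrite /bd natr_sum -!big_split /= big_seq [X in _ <= X]big_seq; apply: ler_sum => v vS.
  rewrite natr_sum -!big_split /= big_seq [X in _ <= X]big_seq; apply: ler_sum => w wv.
  rewrite in_fsetD; have [//|wS /=] := boolP (w \in S); first by rewrite -!natrD ler0n.
  by have := H v w vS wv wS; rewrite -!natrD ler_nat; case: (_ \in _) (T1 v w) (T2 v w) => -[] [].
rewrite !lerD2r.
apply: (le_trans (@sum_swap_le (fun _ w => (w \in S' `\` S)%:R) S (S' `\` S) _ _)).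
- by move=> *; rewrite ler0n.
- by move=> v w /negPf ->.
apply: (@le_trans _ _ (\sum_(w <- S' `\` S) k%:R)).
  rewrite big_seq [X in _ <= X]big_seq; apply: ler_sum => w wS.
  rewrite wS -natr_sum ler_nat; apply: leq_trans (nbk w).
  by rewrite card_fset_sum1.
rewrite big_const_seq count_predT iter_addr_0.
have := cardfsID S S'; rewrite (fsetIidPr SS') => <-.
by rewrite natrD [X in X - _]addrC addrK mulr_natr.
Qed.

(** Markov's inequality for the current across level [t]. *)
Lemma level_count t l (S : {fset V}) : 0 <= t < g y -> 0 < l ->
  \sum_(v <- S) \sum_(w <- nb v) [&& D v, D w, (t < g v) != (t < g w) & l <= `|g v - g w|]%:R
  <= 2 * (1 - g y) / l.
Proof.
move=> ty l0; rewrite ler_pdivlMr // mulr_suml; apply: le_trans (level_flow S ty).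
apply: ler_sum => v _; rewrite mulr_suml; apply: ler_sum => w _.
case: (D v) (D w) (_ != _) => -[] [] //=; rewrite ?mul0r // mul1r.
by case: (leP l) => [?|_]; rewrite ?mul1r ?mul0r.
Qed.

End Levels.

(** * The numerical contradiction at a regular scale *)

Section ScaleNumerics.
Local Open Scope ring_scope.
Variable R : realFieldType.

(** Here [A] stands for [2^a], [E] for [2^(ea a)], [P] and [Q] for the sizes of the high and low
    sets. The choice $la = T/i$ with $T = AE^5/b$ makes all three terms of the last factor of order
    $T$ at most. Both sides then have order $A^4E^{16}$, which dictates the exponent 8 of [E]. The
    constant $b$, of order $m^3$, offsets the powers of [m] in [rho * vv], and $b^2m^2$ yields the
    $m^8$ in the condition on [i]. *)
Lemma scale_contra (A E m G c i P Q rho vv : R) :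
  1 <= A -> 1 <= E -> 1 <= m -> 1 <= G -> 1 <= c -> 0 < i ->
  A ^+ 2 * E ^+ 8 < 256 * G ^+ 2 * P -> A ^+ 2 * E ^+ 8 < 256 * G ^+ 2 * Q ->
  0 <= rho <= A * E * m * c -> 0 <= vv <= 256 * (A ^+ 2 * E ^+ 8) * E ^+ 2 * m ^+ 2 * c ^+ 2 ->
  2 ^+ 28 * G ^+ 5 * c ^+ 3 * m ^+ 4 <= A -> 2 ^+ 63 * G ^+ 11 * c ^+ 8 * m ^+ 8 * i <= 1 ->
  (forall la, 0 < la ->
    P * Q / 8 <= G * (2 * rho * vv) * (m / 4 + la * i / 16 + G * vv / (2 * la))) -> False.
Proof.
move=> A1 E1 m1 G1 c1 i0 XP XQ /andP[r0 rA] /andP[v0 vA] cA ci H.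
have [A0 E0 m0] : [/\ 0 < A, 0 < E & 0 < m] by split; exact: lt_le_trans ltr01 _.
have [G0 c0] : 0 < G /\ 0 < c by split; exact: lt_le_trans ltr01 _.
pose b := 2 ^+ 26 * G ^+ 5 * c ^+ 3 * m ^+ 3.
have b0 : 0 < b by rewrite /b !mulr_gt0 // exprn_gt0.
pose T := A * E ^+ 5 / b.
have T0 : 0 < T by rewrite /T divr_gt0 // mulr_gt0 // exprn_gt0.
have la0 : 0 < T / i by rewrite divr_gt0.
have mT : m <= T / 4.
  rewrite /T -mulrA -invfM ler_pdivlMr ?mulr_gt0 //.
  apply: (@le_trans _ _ A); first by apply: le_trans cA; rewrite /b le_eqVlt; apply/orP; left; apply/eqP; ring.
  by rewrite ler_peMr ?(ltW A0) // exprn_ege1.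
have key : G * vv * i * 8 <= T ^+ 2.
  have -> : T ^+ 2 = A ^+ 2 * E ^+ 10 / b ^+ 2 by rewrite /T expr_div_n exprMn -exprM.
  have b2 : 0 < b ^+ 2 by rewrite exprn_gt0.
  rewrite (ler_pdivlMr _ _ b2).
  apply: (@le_trans _ _ (G * (256 * (A ^+ 2 * E ^+ 8) * E ^+ 2 * m ^+ 2 * c ^+ 2) * i * 8 * b ^+ 2)).
    by rewrite (ler_pM2r b2) ler_pM2r // (ler_pM2r i0) (ler_pM2l G0).
  rewrite [X in X <= _](_ : _ = (2 ^+ 63 * G ^+ 11 * c ^+ 8 * m ^+ 8 * i) * (A ^+ 2 * E ^+ 10)); last by rewrite /b; ring.
  by rewrite ger_pMl // mulr_gt0 // exprn_gt0.
have vT : G * vv / (2 * (T / i)) <= T / 16.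
  rewrite [X in X <= _](_ : _ = G * vv * i * 8 / (16 * T)); last by field; rewrite !lt0r_neq0.
  have T16 : 0 < 16 * T by apply: mulr_gt0.
  rewrite (ler_pdivrMr _ _ T16) [X in _ <= X](_ : _ = T ^+ 2); first exact: key.
  by field.
have := H _ la0; rewrite divfK ?gt_eqF // => {H} H.
have H2 : P * Q / 8 <= G * (2 * rho * vv) * (3 * T / 16).
  apply: (le_trans H); apply: ler_wpM2l; last by move: mT vT T0; clear; move: (G * vv / _) => z *; lra.
  by rewrite !mulr_ge0 // ltW.
have H3 : P * Q / 8 <= G * (2 * (A * E * m * c) * (256 * (A ^+ 2 * E ^+ 8) * E ^+ 2 * m ^+ 2 * c ^+ 2)) * (3 * T / 16).
  have T3 : 0 <= 3 * T / 16 by clear -T0; lra.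
  apply: (le_trans H2); apply: (ler_wpM2r T3).
  apply: ler_wpM2l; first exact: ltW.
  by apply: ler_pM => //; [rewrite mulr_ge0|rewrite ler_pM2l].
have E3 : G * (2 * (A * E * m * c) * (256 * (A ^+ 2 * E ^+ 8) * E ^+ 2 * m ^+ 2 * c ^+ 2)) * (3 * T / 16)
   = 96 * (A ^+ 2 * E ^+ 8) ^+ 2 / (2 ^+ 26 * G ^+ 4).
  by rewrite /T /b; field; rewrite !lt0r_neq0.
rewrite E3 ler_pdivlMr in H3; last by rewrite mulr_gt0 // exprn_gt0.
have X0 : 0 < A ^+ 2 * E ^+ 8 by rewrite mulr_gt0 // exprn_gt0.
have L : (A ^+ 2 * E ^+ 8) ^+ 2 < (256 * G ^+ 2 * P) * (256 * G ^+ 2 * Q).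
  by rewrite expr2 ltr_pM // ltW.
set X2 := (_ * _) ^+ 2 in H3 L.
have E4 : (256 * G ^+ 2 * P) * (256 * G ^+ 2 * Q) = 2 ^+ 16 * (G ^+ 4 * (P * Q)) by ring.
have E5 : P * Q / 8 * (2 ^+ 26 * G ^+ 4) = 2 ^+ 23 * (G ^+ 4 * (P * Q)) by field.
rewrite E4 in L; rewrite E5 in H3; have X20 : 0 < X2 by rewrite exprn_gt0.
move: (G ^+ 4 * (P * Q)) L H3 => z L H3.
have : 2 ^+ 23 * z = 2 ^+ 7 * (2 ^+ 16 * z) by ring.
have -> : (2 : R) ^+ 7 = 128 by rewrite -natrX.
by move: (2 ^+ 23 * z) (2 ^+ 16 * z) L H3 => p q; lra.
Qed.

(** Cut-off separating the low set, where the voltage is at most 5/8, from the high set, where it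
    exceeds 3/4. *)
Definition clip (x : R) := if x <= 5 / 8 then 0 else if x <= 3 / 4 then x - 5 / 8 else 1 / 8.

Lemma clip_bounds x : 0 <= clip x <= 1 / 8.
Proof. by rewrite /clip; case: (leP x (5 / 8)) => ?; [|case: (leP x (3 / 4)) => ?]; apply/andP; split; lra. Qed.

Lemma clip_lip x y : x <= y -> 0 <= clip y - clip x <= y - x.
Proof.
rewrite /clip => xy; case: (leP x (5 / 8)) => ?; case: (leP y (5 / 8)) => ?;
  try case: (leP x (3 / 4)) => ?; try case: (leP y (3 / 4)) => ?; apply/andP; split; lra.
Qed.

(** As [clip] is monotone and 1-Lipschitz, its Dirichlet energy is dominated by the mixed energy
    bounded in [energy_le]. *)
Lemma clip_sqr x y : (clip x - clip y) ^+ 2 <= (clip x - clip y) * (x - y).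
Proof.
wlog xy : x y / y <= x.
  move=> H; have [/H//|/ltW/H] := leP y x.
  by rewrite -sqrrN opprB -[(_ - _) * _]mulrNN !opprB.
have /andP[a b] := clip_lip xy; by rewrite expr2; apply: ler_wpM2l.
Qed.

End ScaleNumerics.

Lemma constant_bound (s j q m C : nat) : (0 < m)%N -> (16 * (s + j * q) <= C)%N ->
  (16 * (s * m ^ 5 + j * m ^ 2 * q) <= C * m ^ 8)%N.
Proof.
move=> m0 H; apply: (leq_trans _ (leq_mul H (leqnn (m ^ 8)))).
have m5 : (m ^ 5 <= m ^ 8)%N by apply: leq_pexp2l.
have m2 : (m ^ 2 <= m ^ 8)%N by apply: leq_pexp2l.
rewrite -[X in (_ <= X)%N]mulnA; apply: leq_mul => //; rewrite mulnDl; apply: leq_add.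
  exact: leq_mul.
by rewrite mulnAC; apply: leq_mul.
Qed.

Lemma grow_num (R : realFieldType) (a b m x y z w : R) :
  (a <= m -> b <= y -> y <= z -> x <= w -> x + a + b <= m + w + z)%R.
Proof. lra. Qed.

Lemma add_shuffle_le (j G x y : nat) : (2 * j + 3 <= G -> 2 * j + (x + y + 3) <= x + (y + G))%N.
Proof. lia. Qed.

Lemma three_six_le (p q : nat) : (0 < q -> p <= q -> 3 * p.+1 <= 6 * q)%N.
Proof. lia. Qed.

(** * The lower bound on $1 - g(y)$ *)

Section Heart.
Local Open Scope fset_scope.
Local Open Scope ring_scope.
Variables (V : choiceType) (nb : V -> {fset V}).
Hypothesis nbC : forall x y, (y \in nb x) = (x \in nb y).
Variable k : nat.
Hypothesis nbk : forall x, (#|` nb x| <= k)%N.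
Variables (R : realFieldType) (Gam : nat) (vv : nat -> nat).
Hypotheses (Gam1 : (1 <= Gam)%N) (Gamk : (k <= Gam)%N).
Hypothesis Gam_big : exists2 j, (2 * j + 3 <= Gam)%N & (Gam * Gam <= 2 ^ j)%N.
Hypothesis v_card : forall x r, (#|` B nb x r| <= vv r)%N.
Hypothesis v_mono : forall r s, (r <= s)%N -> (vv r <= vv s)%N.
Hypothesis v_quad : forall r, (r * r <= Gam * vv r)%N.
Hypothesis v_lin : forall j r, (0 < r)%N -> (2 ^ j * vv r <= Gam * vv (4 ^ j * r))%N.
Hypothesis v_iso : forall (P : {fset V}) r, (0 < r)%N -> (Gam * #|` P| <= vv r)%N ->
  (#|` P| <= Gam * r * bd nb P)%N.
Hypothesis v_transport : forall (F : V -> R) r (X U : {fset V}),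
  (forall x, x \in X -> {subset B nb x r <= U}) ->
  \sum_(x <- X) \sum_(y <- B nb x r) `|F x - F y| <=
  (Gam * (r * vv r))%:R * \sum_(z <- U) grad nb F z.

Variables hc0 hc1 Ch : nat.
(* The numerical side conditions are kept folded, out of the reach of the
   arithmetic decision procedures. *)
Definition c1A_cond := (2 ^ (10 + hc0 + Gam) * Gam ^ 3 <= 2 ^ hc1)%N.
Definition c1B_cond := 2 ^+ 28 * Gam%:R ^+ 5 * (2 ^ hc0)%:R ^+ 3 <= (2 ^ hc1)%:R :> R.
Definition crho_cond := (6 * Crho Gam hc0 hc1 <= 2 ^ hc0)%N.
Definition ChA_cond := (16 * (Cs Gam hc1 + Cj Gam hc0 * (2 + 4 ^ Gam)) <= Ch)%N.
Definition ChB_cond := 2 ^+ 63 * Gam%:R ^+ 11 * (2 ^ hc0)%:R ^+ 8 <= Ch%:R :> R.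
Hypothesis c0big : (Gam + 2 <= hc0)%N.
Hypotheses (c1A : c1A_cond) (c1B : c1B_cond) (crho_small : crho_cond).
Hypotheses (ChA : ChA_cond) (ChB : ChB_cond).

Variable mu : nat.
Let m := (2 ^ mu)%N.
(** Twice the lower bound to be proved for [1 - g y]; the contrary is the hypothesis [gy]. *)
Definition hi : R := ((Ch * m ^ 8)%:R)^-1.

Lemma Ch_gt0 : (0 < Ch)%N.
Proof.
apply: leq_trans ChA; rewrite muln_gt0 addn_gt0 /Cs !muln_gt0.
by rewrite !expn_gt0 Gam1.
Qed.

Lemma hi_gt0 : 0 < hi.
Proof. by rewrite invr_gt0 ltr0n muln_gt0 Ch_gt0 !expn_gt0. Qed.

Lemma hi_le (X : nat) : (X <= Ch * m ^ 8)%N -> X%:R * hi <= 1.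
Proof. by move=> X1; rewrite ler_pdivrMr ?ltr0n ?muln_gt0 ?Ch_gt0 ?expn_gt0 // mul1r ler_nat. Qed.

Lemma hi_small : (Cs Gam hc1 * m ^ 5)%:R * hi +
  (Cj Gam hc0 * m ^ 2)%:R * hi * (2 + (4 ^ Gam)%:R) <= 1 / 8.
Proof.
have h : (16 * (Cs Gam hc1 * m ^ 5 + Cj Gam hc0 * m ^ 2 * (2 + 4 ^ Gam)) <= Ch * m ^ 8)%N.
  by apply: constant_bound; [rewrite expn_gt0|exact: ChA].
have E (a b c : nat) : (16 * (a + b * (2 + c)))%:R = 16 * (a%:R + b%:R * (2 + c%:R)) :> R.
  by rewrite natrM natrD natrM natrD.
have := hi_le h; rewrite E.
set a := (Cs _ _ * _)%:R; set b := (Cj _ _ * _)%:R; set c := (4 ^ _)%:R; move=> H.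
have -> : a * hi + b * hi * (2 + c) = (a + b * (2 + c)) * hi by ring.
lra.
Qed.

Lemma hi_le16 : hi <= 1 / 16.
Proof.
have h : (16 <= Ch * m ^ 8)%N.
  apply: (@leq_trans Ch); last by rewrite leq_pmulr // !expn_gt0.
  apply: leq_trans ChA; apply: leq_pmulr; rewrite addn_gt0; apply/orP; left.
  by rewrite /Cs !muln_gt0 !expn_gt0 Gam1.
have := hi_le h; lra.
Qed.

Lemma hi_tiny : 2 ^+ 63 * Gam%:R ^+ 11 * (2 ^ hc0)%:R ^+ 8 * m%:R ^+ 8 * hi <= 1.
Proof.
have m0 : 0 < m%:R ^+ 8 :> R by rewrite exprn_gt0 // ltr0n expn_gt0.
have C0 : 0 < Ch%:R :> R by rewrite ltr0n Ch_gt0.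
have CM : 0 < Ch%:R * m%:R ^+ 8 :> R by apply: mulr_gt0.
by rewrite /hi natrM (natrX _ m) (ler_pdivrMr _ _ CM) mul1r (ler_pM2r m0).
Qed.

Variables (D : pred V) (W : {fset V}) (ka : V -> nat) (g : V -> R) (y x0 : V) (rs : nat).
Hypotheses (yW : y \in W) (Dy : D y) (kay : (0 < ka y)%N).
Hypothesis g0 : forall v, v \notin W -> g v = 0.
Hypothesis g_ge0 : forall v, 0 <= g v.
Hypothesis gL : forall v, v \in W -> D v ->
  \sum_(w <- nb v | D w) (g v - g w) + (ka v)%:R * g v = (v == y)%:R.
Hypotheses (x0y : x0 \in nb y) (Dx0 : ~~ D x0).
Hypothesis gy : 1 - g y < hi / 2.
Definition Hi := [fset v in W | D v && (1 / 2 < g v)].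
Hypothesis Hi_exits : (\sum_(v <- Hi) \sum_(w <- nb v) ~~ D w <= m)%N.
Hypothesis P_out : forall P : {fset V}, y \in P -> {subset P <= Hi} ->
  exists v w, [/\ v \in P, w \in nb v, D w & w \notin P].
Hypothesis Q_out : forall (Q : {fset V}) rho, (rho < rs)%N -> x0 \in Q -> Q `<=` B nb y rho.+1 ->
  exists v w, [/\ v \in Q, w \in nb v, ~~ D w & w \notin Q].
Hypothesis W_small : (#|` W| <= vv (8 * rs.+1))%N.

Lemma in_Hi v : D v -> 1 / 2 < g v -> v \in Hi.
Proof.
move=> Dv gv; rewrite in_sep Dv gv !andbT.
by apply: contraLR gv => /g0 ->; rewrite -leNgt; lra.
Qed.

Lemma exits_le (S : {fset V}) : {subset S <= Hi} ->
  \sum_(v <- S) \sum_(w <- nb v) (~~ D w)%:R <= m%:R :> R.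
Proof.
move=> SH; apply: (@le_trans _ _ (\sum_(v <- Hi) \sum_(w <- nb v) (~~ D w)%:R)).
  by apply: sum_fset_le; [exact/fsubsetP|move=> v _; rewrite sumr_ge0].
move: Hi_exits; rewrite -(ler_nat R) natr_sum; apply: le_trans.
by apply: ler_sum => v _; rewrite natr_sum.
Qed.

Lemma entries_le (S : {fset V}) :
  \sum_(v <- S) \sum_(w <- nb v) [&& ~~ D v, D w & 1 / 2 < g w]%:R <= m%:R :> R.
Proof.
apply: (@le_trans _ _ (\sum_(w <- Hi) \sum_(v <- nb w) [&& ~~ D v, D w & 1 / 2 < g w]%:R)).
  apply: (sum_swap_le nbC (T := fun v w => [&& ~~ D v, D w & 1 / 2 < g w]%:R)).
    by move=> *; rewrite ler0n.
  move=> v w; have [/and3P[_ Dw gw]|//] := boolP [&& _, _ & _].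
  by rewrite in_Hi.
apply: le_trans (@exits_le Hi _) => //.
by apply: ler_sum => w _; apply: ler_sum => v _; rewrite ler_nat; case: (D v) => //=; exact: leq_b1.
Qed.

(** High and low level sets around [y], enlarged by the voltage [s]. The low set includes the other
    side of the cut; it has one more unit of radius because it starts from the neighbour [x0] of
    [y]. *)
Definition Ps (s : R) rho := [fset v in B nb y rho | D v && (1 - hi - s < g v)].
Definition Qs (s : R) rho := [fset v in B nb y rho.+1 | ~~ D v || (g v <= 1 / 2 + s)].

Lemma Ps_Hi (s : R) rho : s <= 1 / 8 -> {subset Ps s rho <= Hi}.
Proof.
move=> s1 v; rewrite in_sep => /and3P[_ Dv gv]; apply: in_Hi => //.
have := hi_le16; lra.
Qed.

Let f1 (s : R) rho := #|` Ps s rho|.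
Let f2 (s : R) rho := #|` Qs s rho|.

(** A boundary edge of the high set crosses the cut, which happens at most [m] times by [Hi_exits],
    or drops by at least [l] across the level, or leads into the set enlarged by [l]. *)
Lemma Ps_grow (s : R) rho (l : R) : 0 <= s -> 0 < l -> s + l <= 1 / 8 ->
  (f1 s rho <= f1 (s + l) rho.+1)%N /\
  (bd nb (Ps s rho))%:R <= m%:R + Gam%:R * ((f1 (s + l) rho.+1)%:R - (f1 s rho)%:R) + hi / l.
Proof.
move=> s0 l0 sl; have i16 := hi_le16; have i0 := hi_gt0.
have sub : Ps s rho `<=` Ps (s + l) rho.+1.
  apply/fsubsetP => v; rewrite !in_sep => /and3P[vB -> gv] /=.
  rewrite (@B_mono _ nb y rho rho.+1 _ v vB) //=; lra.
have cle := fsubset_leq_card sub; split=> //.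
pose t := 1 - hi - s; pose T2 v w := [&& D v, D w, (t < g v) != (t < g w) & l <= `|g v - g w|].
have H := bd_split nbC R nbk (T1 := fun _ w => ~~ D w) (T2 := T2) sub.
apply: le_trans (H _) _ => {H}.
  move=> v w; rewrite !in_sep => /and3P[vB Dv gv] wv.
  rewrite (nbB vB wv) /T2 Dv; have [Dw|] := boolP (D w); last by rewrite orbT.
  rewrite /= -/t gv; have [/=|_] := boolP (w \in B nb y rho).
    move=> _ wt; rewrite (negbTE wt) /=; move: wt; rewrite -leNgt => wt.
    have [//|/= wl] := ltP (1 - hi - (s + l)) (g w).
    by rewrite ger0_norm; [lra|rewrite /t in gv wt; lra].
  move=> _; have [//|/= wl] := ltP (1 - hi - (s + l)) (g w).
  have -> : (t < g w) = false by apply/negbTE; rewrite -leNgt /t; lra.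
  by rewrite /=; rewrite ger0_norm; [rewrite /t in gv; lra|rewrite /t in gv; lra].
have T1le := @exits_le (Ps s rho) (@Ps_Hi s rho _).
have gy' := gy; have ty : 0 <= t < g y by rewrite /t; apply/andP; split; lra.
have T2le := level_count nbC yW Dy kay g0 g_ge0 gL (Ps s rho) ty l0.
have gy'' := gy; have h1 : 2 * (1 - g y) / l <= hi / l by rewrite ler_pM2r ?invr_gt0 //; lra.
have h2 : k%:R * (#|` Ps (s + l) rho.+1|%:R - #|` Ps s rho|%:R) <=
    Gam%:R * ((f1 (s + l) rho.+1)%:R - (f1 s rho)%:R) :> R.
  by apply: ler_wpM2r; rewrite ?ler_nat // subr_ge0 ler_nat.
have s8 : s <= 1 / 8 by lra.
exact: grow_num (T1le s8) T2le h1 h2.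
Qed.

(** Same trichotomy as for the high set. The cut edges are now those entering vertices with
    [g > 1/2]; a vertex of lower voltage is already in the low set. *)
Lemma Qs_grow (s : R) rho (l : R) : 0 <= s -> 0 < l -> s + l <= 1 / 8 ->
  (f2 s rho <= f2 (s + l) rho.+1)%N /\
  (bd nb (Qs s rho))%:R <= m%:R + Gam%:R * ((f2 (s + l) rho.+1)%:R - (f2 s rho)%:R) + hi / l.
Proof.
move=> s0 l0 sl; have i16 := hi_le16; have i0 := hi_gt0.
have sub : Qs s rho `<=` Qs (s + l) rho.+1.
  apply/fsubsetP => v; rewrite !in_sep => /andP[vB gv].
  rewrite (@B_mono _ nb y rho.+1 rho.+2 _ v vB) //=; case/orP: gv => [->//|gv].
  by apply/orP; right; lra.
have cle := fsubset_leq_card sub; split=> //.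
pose t := 1 / 2 + s; pose T2 v w := [&& D v, D w, (t < g v) != (t < g w) & l <= `|g v - g w|].
have H := bd_split nbC R nbk (T1 := fun v w => [&& ~~ D v, D w & 1 / 2 < g w]) (T2 := T2) sub.
apply: le_trans (H _) _ => {H}.
  move=> v w; rewrite !in_sep => /andP[vB gv] wv wQ.
  have wB := nbB vB wv; rewrite wB /=.
  have [Dw|//] := boolP (D w); rewrite Dw /= in wQ *.
  have [//|/= gw] := leP (g w) (1 / 2 + (s + l)).
  have g2 : 1 / 2 < g w by lra.
  case/orP: gv => [Dv|gv]; first by rewrite Dv g2.
  rewrite g2 /T2 Dw; have [Dv|//] := boolP (D v); rewrite /= /t.
  have -> : (1 / 2 + s < g v) = false by apply/negbTE; rewrite -leNgt.
  have -> : (1 / 2 + s < g w) by lra.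
  by rewrite /= distrC ger0_norm; lra.
have T1le := @entries_le (Qs s rho).
have gy' := gy; have ty : 0 <= t < g y by rewrite /t; apply/andP; split; lra.
have T2le := level_count nbC yW Dy kay g0 g_ge0 gL (Qs s rho) ty l0.
have gy'' := gy; have h1 : 2 * (1 - g y) / l <= hi / l by rewrite ler_pM2r ?invr_gt0 //; lra.
have h2 : k%:R * (#|` Qs (s + l) rho.+1|%:R - #|` Qs s rho|%:R) <=
    Gam%:R * ((f2 (s + l) rho.+1)%:R - (f2 s rho)%:R) :> R.
  by apply: ler_wpM2r; rewrite ?ler_nat // subr_ge0 ler_nat.
exact: grow_num T1le T2le h1 h2.
Qed.

Lemma fset_lt (S S' : {fset V}) w : S `<=` S' -> w \in S' -> w \notin S -> (#|` S| < #|` S'|)%N.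
Proof. by move=> sub wS' wS; apply: fproper_ltn_card; rewrite fproperEneq sub andbT; apply: contraNneq wS => ->. Qed.

(** An edge across the level carries less than [hi], so the edge given by [P_out] leads to a vertex
    that the budget [2 * hi] brings in. *)
Lemma Ps_unit (s : R) rho : 0 <= s -> s + 2 * hi <= 1 / 8 -> (f1 s rho < f1 (s + 2 * hi) rho.+1)%N.
Proof.
move=> s0 sl; have i16 := hi_le16; have i0 := hi_gt0.
have gy' := gy; have yP : y \in Ps s rho by rewrite in_sep Bid Dy /=; lra.
have [v [w [vP wv Dw wP]]] := P_out yP (@Ps_Hi s rho (ltac:(lra))).
move: (vP) (wP); rewrite !in_sep => /and3P[vB Dv gv]; rewrite Dw /= => wP'.
apply: (@fset_lt _ _ w) => //.
  apply/fsubsetP => u; rewrite !in_sep => /and3P[uB -> gu] /=.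
  rewrite (@B_mono _ nb y rho rho.+1 _ u uB) //=; lra.
rewrite in_sep (nbB vB wv) Dw /=; rewrite ltNge; apply/negP => wl.
pose t := 1 - hi - s.
have ty : 0 <= t < g y by rewrite /t; apply/andP; split; lra.
have := level_flow nbC yW Dy kay g0 g_ge0 gL [fset v] ty.
rewrite big_seq_fset1 (big_fsetD1 w) //= Dv Dw /t gv /=.
have -> : (1 - hi - s < g w) = false by apply/negbTE; rewrite -leNgt; lra.
rewrite /= mul1r ger0_norm; last by lra.
have : 0 <= \sum_(i <- nb v `\ w) [&& true, D i & true != (1 - hi - s < g i)]%:R * `|g v - g i|.
  by apply: sumr_ge0 => *; rewrite mulr_ge0.
rewrite /=; move: (\sum_(_ <- _) _) => z; lra.
Qed.

Lemma Qs_unit (s : R) rho : 0 <= s -> s + 2 * hi <= 1 / 8 -> (rho < rs)%N ->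
  (f2 s rho < f2 (s + 2 * hi) rho.+1)%N.
Proof.
move=> s0 sl rr; have i0 := hi_gt0.
have xQ : x0 \in Qs s rho.
  by rewrite in_sep Dx0 andbT (@B_mono _ nb y 1 rho.+1) // B1 in_cnb x0y orbT.
have [|v [w [vQ wv Dw wQ]]] := Q_out rr xQ.
  by apply/fsubsetP => u; rewrite in_sep => /andP[].
have vB : v \in B nb y rho.+1 by move: vQ; rewrite in_sep => /andP[].
apply: (@fset_lt _ _ w) => //.
  apply/fsubsetP => u; rewrite !in_sep => /andP[uB gu].
  rewrite (@B_mono _ nb y rho.+1 rho.+2 _ u uB) //=; case/orP: gu => [->//|gu].
  by apply/orP; right; lra.
by rewrite in_sep (nbB vB wv) Dw.
Qed.

Lemma card_ge1 (S : {fset V}) x : x \in S -> (0 < #|` S|)%N.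
Proof. by move=> xS; rewrite cardfs_gt0; apply/fset0Pn; exists x. Qed.

Lemma Ps00 : (0 < f1 0 0)%N.
Proof.
have i0 := hi_gt0; have gy' := gy.
by apply: (@card_ge1 _ y); rewrite in_sep Bid Dy /=; lra.
Qed.

Lemma Qs00 : (0 < f2 0 0)%N.
Proof. by apply: (@card_ge1 _ x0); rewrite in_sep Dx0 andbT B1 in_cnb x0y orbT. Qed.

Notation reachP := (reach Gam vv mu hc0 hc1 hi f1).
Notation reachQ := (reach Gam vv mu hc0 hc1 hi f2).
Notation st := (a0 mu hc1).
Notation Lg := (La Gam vv mu hc0).
Notation ea := (ea Gam vv).

(** Once the scale passes [rs], the high set can climb [Gam] scales further, to a volume that
    exceeds [#|W|] by [v_lin], although it stays inside [W]. *)
Lemma heart_finish a : (st <= a)%N -> reachP a -> (rs.+1 <= 2 ^ (a + Lg a))%N -> False.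
Proof.
move=> sa rP rsa.
have iso1 : forall (s : R) rho r, 0 <= s <= 1 / 8 -> (0 < r)%N -> (Gam * f1 s rho <= vv r)%N ->
  (f1 s rho <= Gam * r * bd nb (Ps s rho))%N by move=> s rho r _; exact: v_iso.
have [s [rho [/andP[s0 s1] H]]] := reach_end Gam1 hi_gt0 v_quad c1A hi_small Ps_grow iso1 Ps00 sa rP (leqnn _).
have fW : (f1 s rho <= vv (2 ^ (a + Lg a + 3)))%N.
  apply: (@leq_trans #|` W|).
    apply: fsubset_leq_card; apply/fsubsetP => v /(Ps_Hi s1); rewrite in_sep => /andP[//].
  by apply: (leq_trans W_small); apply: v_mono; rewrite expnD mulnC leq_mul2r rsa orbT.
have [j j3 jG] := Gam_big.
have p2 : (0 < 2 ^ (a + Lg a + 3))%N by rewrite expn_gt0.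
have pr := v_lin j p2.
have pq : (vv (4 ^ j * 2 ^ (a + Lg a + 3)) <= vv (2 ^ (a + (Lg a + Gam))))%N.
  by apply: v_mono; rewrite -[4%N]/(2 ^ 2)%N -expnM -expnD leq_exp2l // add_shuffle_le.
have h1 := leq_trans pr (leq_mul (leqnn Gam) pq).
have h2 : (Gam * vv (2 ^ (a + (Lg a + Gam))) < Gam * Gam * vv (2 ^ (a + Lg a + 3)))%N.
  by rewrite -mulnA ltn_pmul2l //; apply: (leq_trans H); exact: leq_mul.
have h3 := leq_mul jG (leqnn (vv (2 ^ (a + Lg a + 3)))).
by have := leq_ltn_trans h1 (leq_trans h2 h3); rewrite ltnn.
Qed.

Definition Fc v : R := if D v then clip (g v) else 0.

Lemma sum_supp_le (U Z : {fset V}) (h : V -> R) : (forall v, 0 <= h v) ->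
  (forall v, v \notin Z -> h v = 0) -> \sum_(v <- U) h v <= \sum_(v <- Z) h v.
Proof.
move=> h0 hZ; apply: (@le_trans _ _ (\sum_(v <- U `|` Z) h v)).
  by apply: sum_fset_le; rewrite ?fsubsetUl.
by rewrite [X in _ <= X](big_fset_incl _ (fsubsetUr U Z)) //= => v _; exact: hZ.
Qed.

(** Across the cut only edges at a vertex with [g > 1/2] matter, at most [m] in each direction, with
    increments at most 1/8. Inside [D], the inequality $|x| \le \frac{la}{2}x^2 + \frac{1}{2\,la}$
    splits increments into an energy term, where the total energy is at most [hi / 8], and a volume
    term. *)
Lemma grad_Fc (U : {fset V}) (la : R) : 0 < la ->
  \sum_(z <- U) grad nb Fc z <= m%:R / 4 + la * hi / 16 + Gam%:R * #|` U|%:R / (2 * la).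
Proof.
move=> la0; have i0 := hi_gt0.
have F8 v : 0 <= Fc v <= 1 / 8.
  by rewrite /Fc; case: (D v); [exact: clip_bounds|apply/andP; split; lra].
have edge v w : `|Fc v - Fc w| <= 1 / 8 * ((v \in Hi)%:R * (~~ D w)%:R) +
   1 / 8 * [&& ~~ D v, D w & 1 / 2 < g w]%:R +
   la / 2 * ((D v && D w)%:R * ((Fc v - Fc w) * (g v - g w))) + (2 * la)^-1.
  have p0 : 0 < (2 * la)^-1 by rewrite invr_gt0 mulr_gt0.
  have h8 : 0 <= 1 / 8 :> R by lra.
  have clipW u : ~ (1 / 2 < g u) -> clip (g u) = 0.
    by move=> /negP; rewrite -leNgt /clip => gu; case: leP => // ?; lra.
  rewrite /Fc; have [Dv|Dv] := boolP (D v); have [Dw|Dw] := boolP (D w) => /=.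
  - have := clip_sqr (g v) (g w); set x := clip _ - clip _; set z := x * _ => xz.
    rewrite !mulr0 !add0r mul1r.
    have : la / 2 * x ^+ 2 <= la / 2 * z by rewrite ler_pM2l // divr_gt0.
    have : 0 <= la / 2 * (`|x| - la^-1) ^+ 2 by rewrite mulr_ge0 ?sqr_ge0 // ltW // divr_gt0.
    have -> : la / 2 * (`|x| - la^-1) ^+ 2 = la / 2 * `|x| ^+ 2 - `|x| + (2 * la)^-1.
      by field; rewrite gt_eqF.
    rewrite real_normK ?num_real //; move: (la / 2 * x ^+ 2) (la / 2 * z) => p q; lra.
  - rewrite subr0 !mul0r !mulr0 !addr0 mulr1.
    have /andP[c0 c8] := clip_bounds (g v); rewrite ger0_norm //.
    have [gv|/negP/clipW ->] := boolP (1 / 2 < g v); first by rewrite in_Hi // mulr1; lra.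
    by apply: addr_ge0; [apply: mulr_ge0|exact: ltW].
  - rewrite sub0r normrN !mul0r !mulr0 addr0 add0r.
    have /andP[c0 c8] := clip_bounds (g w); rewrite ger0_norm //.
    have [gv|/negP/clipW ->] := boolP (1 / 2 < g w); first by rewrite /= mulr1; lra.
    by rewrite /= mulr0 add0r ltW.
  - by rewrite subrr normr0 !mul0r !mulr0 !addr0 mulr1; apply: addr_ge0; [apply: mulr_ge0|exact: ltW].
pose S1 := \sum_(v <- U) \sum_(w <- nb v) (v \in Hi)%:R * (~~ D w)%:R : R.
pose S2 := \sum_(v <- U) \sum_(w <- nb v) [&& ~~ D v, D w & 1 / 2 < g w]%:R : R.
pose S3 := \sum_(v <- U) \sum_(w <- nb v) (D v && D w)%:R * ((Fc v - Fc w) * (g v - g w)).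
pose S4 := \sum_(v <- U) \sum_(w <- nb v) 1 : R.
have tot : \sum_(z <- U) grad nb Fc z <= 1 / 8 * S1 + 1 / 8 * S2 + la / 2 * S3 + (2 * la)^-1 * S4.
  rewrite /S1 /S2 /S3 /S4 !mulr_sumr -!big_split /=; apply: ler_sum => v _.
  rewrite !mulr_sumr -!big_split /=; apply: ler_sum => w _; rewrite [X in _ <= _ + X]mulr1; exact: edge.
have s1 : S1 <= m%:R.
  apply: (le_trans (@sum_supp_le U Hi (fun v => \sum_(w <- nb v) (v \in Hi)%:R * (~~ D w)%:R) _ _)).
  - by move=> v; rewrite sumr_ge0 // => w _; rewrite mulr_ge0.
  - by move=> v /negPf ->; rewrite big1 // => w _; rewrite mul0r.
  apply: le_trans (@exits_le Hi _) => //; apply: ler_sum => v _; apply: ler_sum => w _.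
  by rewrite ler_piMl // lern1 leq_b1.
have s2 : S2 <= m%:R := entries_le U.
have s3 : S3 <= hi / 8.
  apply: (le_trans (energy_le nbC yW kay g_ge0 gL U _ _ _ _)).
  - by move=> v; case/andP: (F8 v).
  - by move=> v /negPf; rewrite /Fc => ->.
  - move=> v vW; rewrite /Fc g0 // /clip; case: (D v) => //; case: leP => // ?; lra.
  - move=> v w Dv Dw; rewrite /Fc Dv Dw; apply: le_trans (clip_sqr _ _); exact: sqr_ge0.
  have gy' := gy; have /andP[y0 y8] := F8 y; have gy0 : 0 <= hi / 2 by lra.
  have [gy1|/ltW gy1] := leP 0 (1 - g y); last first.
    apply: (@le_trans _ _ 0); last by lra.
    by rewrite mulr_ge0_le0 // mulr_ge0_le0.
  have : Fc y * (1 - g y) <= 1 / 8 * (hi / 2) by apply: ler_pM => //; exact: ltW.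
  lra.
have s4 : S4 <= Gam%:R * #|` U|%:R.
  apply: (@le_trans _ _ (\sum_(v <- U) Gam%:R)); last first.
    by rewrite big_const_seq count_predT iter_addr_0 mulr_natr.
  apply: ler_sum => v _; rewrite big_const_seq count_predT iter_addr_0 ler_nat.
  by apply: leq_trans Gamk; exact: nbk.
apply: (le_trans tot).
have h3 : la / 2 * S3 <= la / 2 * (hi / 8) by rewrite ler_pM2l // divr_gt0.
have h4 : (2 * la)^-1 * S4 <= (2 * la)^-1 * (Gam%:R * #|` U|%:R).
  by rewrite ler_pM2l // invr_gt0 mulr_gt0.
rewrite [_ / (2 * la)]mulrC; move: s1 s2 h3 h4; rewrite [la / 2 * (hi / 8)](_ : _ = la * hi / 16); last by field.
by move: (_^-1 * _) ((2 * la)^-1 * _) (la / 2 * S3) (la * hi / 16) => *; lra.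
Qed.

(** At a regular scale [Fc] equals 1/8 on the high set and 0 on the low set, and both lie in the
    ball of radius [rho] about [y]. The transport inequality at radius [2 * rho] is then
    incompatible with the small gradient of [Fc]. *)
Lemma heart_good a : (st <= a)%N -> reachP a -> reachQ a -> (ea (a + Lg a) <= (ea a).+1)%N -> False.
Proof.
move=> sa [s [r1 [s0 sS r1b vP]]] [s' [r2 [s0' sS' r2b vQ]]] good.
have i0 := hi_gt0; have i16 := hi_le16.
have S8 : Sa Gam vv mu hc0 hc1 hi a <= 1 / 8.
  apply: le_trans (Sa_le _ _ _ _ _ _ _) _ => //; apply: le_trans hi_small.
  rewrite lerD2l; apply: ler_wpM2l; first by rewrite mulr_ge0 // ltW.
  by rewrite lerDl.
pose rho := (Crho Gam hc0 hc1 * (2 ^ a * (m + ea a))).+1.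
set P := Ps s r1; set Q := Qs s' r2.
have PB v : v \in P -> v \in B nb y rho.
  by rewrite in_sep => /andP[vB _]; apply: (@B_mono _ nb y r1) vB; rewrite /rho leqW.
have QB v : v \in Q -> v \in B nb y rho.
  by rewrite in_sep => /andP[vB _]; apply: (@B_mono _ nb y r2.+1) vB; rewrite /rho ltnS.
have rho3 : (3 * rho <= 2 ^ a * 2 ^ ea a * m * 2 ^ hc0)%N.
  have me : (m + ea a <= m * 2 ^ ea a)%N.
    apply: (@leq_trans (m * (ea a).+1)); first by rewrite mulnS leq_add2l leq_pmull // /m expn_gt0.
    by apply: leq_mul => //; exact: ltn_expl.
  apply: (@leq_trans (6 * (Crho Gam hc0 hc1 * (2 ^ a * (m * 2 ^ ea a))))); last first.
    have := crho_small; rewrite /crho_cond; move: (Crho _ _ _) (2 ^ hc0)%N (2 ^ a)%N (2 ^ ea a)%N => C c A E cs.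
    have := leq_mul cs (leqnn (A * (m * E))); rewrite -mulnA => h; apply: (leq_trans h).
    by rewrite leq_eqVlt; apply/orP; left; apply/eqP; ring.
  have C0 : (0 < Crho Gam hc0 hc1 * (2 ^ a * (m * 2 ^ ea a)))%N.
    have Cp : (0 < Crho Gam hc0 hc1)%N by rewrite /Crho !muln_gt0 Gam1.
    have m1 : (0 < m)%N by rewrite expn_gt0.
    by rewrite muln_gt0 Cp muln_gt0 expn_gt0 muln_gt0 m1 expn_gt0.
  have Cle : (Crho Gam hc0 hc1 * (2 ^ a * (m + ea a)) <= Crho Gam hc0 hc1 * (2 ^ a * (m * 2 ^ ea a)))%N.
    by rewrite !leq_mul2l me !orbT.
  exact: three_six_le.
have rhoL : (3 * rho <= 2 ^ (a + Lg a))%N.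
  by apply: (leq_trans rho3); rewrite -!expnD leq_exp2l // /La !addnA.
set vL := vv (2 ^ (a + Lg a)).
have vL2 r : (r <= 3 * rho)%N -> (vv r <= vL)%N by move=> h; apply: v_mono; exact: leq_trans rhoL.
have vLle : (vL <= 256 * (4 ^ a * 256 ^ ea a) * 4 ^ ea a * m ^ 2 * 4 ^ hc0)%N.
  apply: (leq_trans (v_le _ Gam1 _)).
  apply: (@leq_trans (4 ^ (a + Lg a) * 256 ^ (ea a).+1)); first by rewrite leq_mul2l leq_exp2l ?good ?orbT.
  have -> : (m ^ 2 = 4 ^ mu)%N by rewrite /m -expnM mulnC expnM.
  rewrite /La !expnD expnS; rewrite leq_eqVlt; apply/orP; left; apply/eqP.
  by move: (4 ^ a)%N (4 ^ ea a)%N (4 ^ mu)%N (4 ^ hc0)%N (256 ^ ea a)%N 256%N => *; ring.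
have big (S : nat) : (vv (2 ^ a) < Gam * S)%N -> (4 ^ a * 256 ^ ea a < 256 * Gam ^ 2 * S)%N.
  move=> H; apply: (leq_ltn_trans (ea2 v_quad a)).
  by rewrite -mulnA ltn_pmul2l // -mulnn -mulnA ltn_pmul2l.
have FP v : v \in P -> Fc v = 1 / 8.
  rewrite in_sep /Fc => /and3P[_ -> gv]; rewrite /clip; case: leP => [?|_]; first by lra.
  by case: leP => [?|//]; lra.
have FQ v : v \in Q -> Fc v = 0.
  rewrite in_sep /Fc => /andP[_]; case: (D v) => //= gv; rewrite /clip; case: leP => [//|?]; lra.
have PQ la : 0 < la -> (#|` P|)%:R * (#|` Q|)%:R / 8 <=
    Gam%:R * (2 * rho%:R * vL%:R) * (m%:R / 4 + la * hi / 16 + Gam%:R * vL%:R / (2 * la)) :> R.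
  move=> la0; have XU x : x \in P -> {subset B nb x (2 * rho) <= B nb y (3 * rho)}.
    move=> /PB xP z zx; have -> : (3 * rho = rho + 2 * rho)%N by rewrite mulSn.
    exact: B_trans xP zx.
  have := v_transport Fc XU => H.
  have L : #|` P|%:R * #|` Q|%:R / 8 <= \sum_(x <- P) \sum_(z <- B nb x (2 * rho)) `|Fc x - Fc z|.
    apply: (@le_trans _ _ (\sum_(x <- P) \sum_(z <- Q) (1 / 8))).
      rewrite !big_const_seq !count_predT !iter_addr_0 le_eqVlt; apply/orP; left; apply/eqP.
      by rewrite -(mulr_natr (1 / 8 *+ _)) -(mulr_natr (1 / 8)); field.
    rewrite big_seq [X in _ <= X]big_seq; apply: ler_sum => x xP.
    apply: (@le_trans _ _ (\sum_(z <- Q) `|Fc x - Fc z|)).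
      rewrite big_seq [X in _ <= X]big_seq; apply: ler_sum => z zQ.
      by rewrite (FP _ xP) (FQ _ zQ) subr0 ger0_norm //; lra.
    apply: sum_fset_le => //; apply/fsubsetP => z /QB zQ.
    have -> : (2 * rho = rho + rho)%N by rewrite mul2n addnn.
    by apply: (@B_trans _ _ _ y) zQ; rewrite (B_sym nbC) PB.
  apply: (le_trans L); apply: (le_trans H).
  have G3 := grad_Fc (B nb y (3 * rho)) la0.
  apply: (@le_trans _ _ ((Gam * (2 * rho * vL))%:R * (m%:R / 4 + la * hi / 16 + Gam%:R * vL%:R / (2 * la)))); last by rewrite !natrM.
  apply: ler_pM.
  - by rewrite ler0n.
  - by apply: sumr_ge0 => z _; exact: grad_ge0.
  - rewrite ler_nat; apply: leq_mul => //; apply: leq_mul => //; apply: vL2; exact: leq_mul.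
  - apply: (le_trans G3); rewrite lerD2l; apply: ler_wpM2r; first by rewrite invr_ge0 ltW // mulr_gt0.
    by apply: ler_wpM2l => //; rewrite ler_nat (leq_trans (v_card _ _)) // vL2.
have castX : (2 ^ a)%:R ^+ 2 * (2 ^ ea a)%:R ^+ 8 = (4 ^ a * 256 ^ ea a)%:R :> R.
  by rewrite natrM -!natrX -!expnM [(a * 2)%N]mulnC [(ea a * 8)%N]mulnC !expnM.
apply: (@scale_contra R (2 ^ a)%:R (2 ^ ea a)%:R m%:R Gam%:R (2 ^ hc0)%:R hi #|` P|%:R #|` Q|%:R rho%:R vL%:R) => //.
- by rewrite ler1n expn_gt0.
- by rewrite ler1n expn_gt0.
- by rewrite ler1n expn_gt0.
- by rewrite ler1n.
- by rewrite ler1n expn_gt0.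
- by rewrite castX -natrX -!natrM ltr_nat big.
- by rewrite castX -natrX -!natrM ltr_nat big.
- rewrite ler0n -!natrM ler_nat; apply: leq_trans rho3; exact: leq_pmull.
- rewrite ler0n castX -!natrX -!natrM ler_nat; apply: (leq_trans vLle).
  by rewrite -![((2 ^ _) ^ 2)%N]expnM ![(_ * 2)%N]mulnC ![(2 ^ (2 * _))%N]expnM.
- apply: (@le_trans _ _ (2 ^ st)%:R); last by rewrite ler_nat leq_exp2l.
  have -> : (2 ^ st = 2 ^ hc1 * m ^ 4)%N by rewrite /a0 expnD mulnC [(4 * mu)%N]mulnC expnM.
  by rewrite natrM (natrX _ m); apply: ler_wpM2r => //; rewrite exprn_ge0.
- exact: hi_tiny.
Qed.

(** Both level sets jump from scale to scale while [ea] increases by at least 2 per jump. This stops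
    at a regular scale or beyond [rs], and either is contradictory. *)
Lemma heart : False.
Proof.
have iso1 : forall (s : R) rho r, 0 <= s <= 1 / 8 -> (0 < r)%N -> (Gam * f1 s rho <= vv r)%N ->
  (f1 s rho <= Gam * r * bd nb (Ps s rho))%N by move=> s rho r _; exact: v_iso.
have iso2 : forall (s : R) rho r, 0 <= s <= 1 / 8 -> (0 < r)%N -> (Gam * f2 s rho <= vv r)%N ->
  (f2 s rho <= Gam * r * bd nb (Qs s rho))%N by move=> s rho r _; exact: v_iso.
have c00 : (0 < hc0)%N by apply: leq_trans c0big; rewrite addn2.
have step n a : (rs < 2 ^ (a + n))%N -> (st <= a)%N -> reachP a -> reachQ a -> False.
  elim: n a => [|n IH] a rsa sa rP rQ.
    apply: (heart_finish sa rP); apply: (leq_trans rsa); rewrite leq_exp2l // leq_add2l //.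
  have [fin|] := ltnP rs (2 ^ (a + Lg a)); first exact: (heart_finish sa rP fin).
  move=> _; have [good|bad] := leqP (ea (a + Lg a)) (ea a).+1; first exact: (heart_good sa rP rQ).
  have bad' : (ea a < ea (a + Lg a))%N by exact: leq_trans bad.
  have La1 : (1 <= Lg a)%N by rewrite (leq_trans c00) // leq_addl.
  apply: (IH (a + Lg a)%N).
  - by apply: (leq_trans rsa); rewrite leq_exp2l // -addnA leq_add2l -add1n leq_add2r.
  - by rewrite (leq_trans sa) // leq_addr.
  - exact: (reach_jump Gam1 hi_gt0 v_quad c1A hi_small Ps_grow iso1 Ps00 sa rP bad' c00).
  - exact: (reach_jump Gam1 hi_gt0 v_quad c1A hi_small Qs_grow iso2 Qs00 sa rQ bad' c00).
pose M := (4 * 2 ^ mu * Gam * 2 ^ st)%N.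
have rP : reachP st.
  apply: (reach_base Gam1 hi_gt0 c1A hi_small Ps_grow iso1 (rho1 := M) _ Ps00) => //.
  by move=> s rho s0 s1 _; exact: Ps_unit.
(* If [rs] is below the initial size [M], the one by one growth of the low set is not guaranteed,
   but then [W] is already small compared with the starting scale. *)
have [Mr|Mr] := leqP M rs.
  have rQ : reachQ st by exact: (reach_base Gam1 hi_gt0 c1A hi_small Qs_grow iso2 Qs_unit Qs00 Mr).
  apply: (step rs st) => //; apply: (leq_trans (ltn_expl rs (isT : 1 < 2)%N)); by rewrite leq_exp2l // leq_addl.
apply: (heart_finish (leqnn _) rP); apply: (leq_trans Mr); rewrite /M.
apply: (@leq_trans (2 ^ 2 * 2 ^ mu * 2 ^ Gam * 2 ^ st)).
  by apply: leq_mul => //; apply: leq_mul => //; exact/ltnW/ltn_expl.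
rewrite -!expnD leq_exp2l // /La; move: (ea st) st c0big; clear => e b c; lia.
Qed.

End Heart.

(** * Choice of the constants *)

Section Constants.
Variable Gam : nat.
Hypothesis Gam1 : (1 <= Gam)%N.

Lemma pow_add_le t a e c : (t + a + e * Gam <= c)%N -> (2 ^ t * 2 ^ a * Gam ^ e <= 2 ^ c)%N.
Proof.
move=> H; have h : (Gam ^ e <= 2 ^ (Gam * e))%N.
  by rewrite expnM; case: e H => // e _; rewrite leq_exp2r // ltnW // ltn_expl.
apply: (leq_trans (leq_mul (leqnn _) h)); rewrite -!expnD leq_exp2l //.
by rewrite [(Gam * e)%N]mulnC.
Qed.

Lemma crho_bound c0 c1 : (c0 = 20 + 4 * Gam)%N -> (c1 = 28 + 3 * c0 + 5 * Gam)%N ->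
  (6 * Crho Gam c0 c1 <= 2 ^ c0)%N.
Proof.
move=> E0 E1.
have -> : (6 * Crho Gam c0 c1 = 12 * (Gam * Gam) * (452 + 88 * Gam))%N.
  by rewrite /Crho E1 E0; ring.
apply: (@leq_trans (12 * (Gam * Gam) * (540 * Gam))); first by apply: leq_mul => //; lia.
rewrite E0 expnD [(4 * Gam)%N]mulnC expnM.
have -> : ((2 ^ Gam) ^ 4 = 2 ^ Gam * 2 ^ Gam * (2 ^ Gam * 2 ^ Gam))%N by rewrite !expnS expn0 muln1 !mulnA.
have h : (Gam <= 2 ^ Gam)%N by exact/ltnW/ltn_expl.
have h1 : (0 < 2 ^ Gam)%N by rewrite expn_gt0.
move: (2 ^ Gam)%N h h1 => X h h1.
have X2 : (Gam * Gam <= X * X)%N by apply: leq_mul.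
have X3 : (Gam * Gam * Gam <= X * X * X)%N by apply: leq_mul.
have X4 : (X * X * X <= X * X * (X * X))%N by rewrite !mulnA leq_pmulr.
have -> : (12 * (Gam * Gam) * (540 * Gam) = 6480 * (Gam * Gam * Gam))%N by ring.
have b : (6480 <= 2 ^ 20)%N by apply: (@leq_trans (2 ^ 13)) => //; rewrite leq_exp2l.
by apply: leq_mul => //; exact: leq_trans X4.
Qed.

(** There is no circularity: [Crho] is polynomial in [Gam], [c0] and [c1], and [c1] is affine in
    [c0] and [Gam], so that $2^{c_0}$ dominates it for the chosen [c0]; [C] comes last. *)
Lemma heart_constants : exists c0 c1 C, [/\ (Gam + 2 <= c0)%N,
  (2 ^ (10 + c0 + Gam) * Gam ^ 3 <= 2 ^ c1)%N,
  (forall R : realFieldType, 2 ^+ 28 * Gam%:R ^+ 5 * (2 ^ c0)%:R ^+ 3 <= (2 ^ c1)%:R :> R)%R,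
  (6 * Crho Gam c0 c1 <= 2 ^ c0)%N &
  (16 * (Cs Gam c1 + Cj Gam c0 * (2 + 4 ^ Gam)) <= C)%N /\
  (forall R : realFieldType, 2 ^+ 63 * Gam%:R ^+ 11 * (2 ^ c0)%:R ^+ 8 <= C%:R :> R)%R].
Proof.
have [c0 E0] : exists c0, (c0 = 20 + 4 * Gam)%N by eexists.
have [c1 E1] : exists c1, (c1 = 28 + 3 * c0 + 5 * Gam)%N by eexists.
(* Hiding the exponents behind variables keeps the powers of 2 symbolic. *)
have [t28 Et] : exists t, t = 28%N by eexists.
have [t63 Eu] : exists t, t = 63%N by eexists.
exists c0, c1, (16 * (Cs Gam c1 + Cj Gam c0 * (2 + 4 ^ Gam)) +
   2 ^ t63 * Gam ^ 11 * (2 ^ c0) ^ 8)%N; split.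
- by rewrite E0; lia.
- rewrite -addnA expnD.
  have := @pow_add_le 10 (c0 + Gam) 3 c1; apply.
  by rewrite E1; lia.
- move=> R; rewrite -Et -!natrX -!natrM ler_nat.
  have := @pow_add_le t28 (c0 * 3) 5 c1; rewrite expnM mulnAC; apply.
  by rewrite Et E1; lia.
- exact: crho_bound.
- split; first exact: leq_addr.
  by move=> R; rewrite -Eu -!natrX -!natrM ler_nat leq_addl.
Qed.

End Constants.

Definition pw8 (x : nat) := (x ^ 8)%N.
Lemma pw8M x y : pw8 (x * y) = (pw8 x * pw8 y)%N.
Proof. by rewrite /pw8 expnMn. Qed.
Lemma pw8_mono x y : (x <= y)%N -> (pw8 x <= pw8 y)%N.
Proof. by move=> xy; rewrite /pw8 leq_exp2r. Qed.
Lemma pw8X x n : pw8 (x ^ n) = (pw8 x ^ n)%N.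
Proof. by rewrite /pw8 -!expnM mulnC. Qed.
Lemma pw8_gt0 x : (0 < x)%N -> (0 < pw8 x)%N.
Proof. by move=> x0; rewrite /pw8 expn_gt0 x0. Qed.

Lemma strip_bound (c t n Q e : nat) : (0 < c)%N -> (t <= n)%N -> (Q <= e ^ n)%N ->
  (c ^ t * pw8 Q <= (c * pw8 e) ^ n)%N.
Proof.
move=> c0 tn Qn; rewrite expnMn -pw8X.
by apply: leq_mul; [exact: leq_pexp2l|exact: pw8_mono].
Qed.

(* Locked: the unary value of [8 ^ 8] must never be computed. *)
Definition K8 : nat := locked (pw8 8).

(** * Amortised removal of exits *)

(** Bernoulli's inequality $(1 - \frac1{n+1})^m \ge 1 - \frac m{n+1}$, cleared of denominators. *)
Lemma bernoulli_nat (n m : nat) : (m <= n.+1)%N -> (n.+1 ^ m * (n.+1 - m) <= n ^ m * n.+1)%N.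
Proof.
elim: m => [|m IH] mn; first by rewrite !expn0 subn0.
have h : (n.+1 * (n.+1 - m.+1) <= n * (n.+1 - m))%N.
  by rewrite subSS; have := subSn mn => /=; rewrite -(subnK (mn : (m <= n)%N)); move: (n - m)%N => d; nia.
rewrite expnSr -mulnA (leq_trans (leq_mul (leqnn _) h)) // mulnCA expnS -mulnA leq_mul2l.
by rewrite IH ?orbT // ltnW.
Qed.

(** Integer substitute for $(1+1/n)^n \le e$: Bernoulli's inequality on half of the exponent gives a
    factor 2, which is squared. *)
Lemma succ_pow_le4 (n : nat) : (n.+1 ^ n <= 4 * n ^ n)%N.
Proof.
have half m : (2 * m <= n.+1)%N -> (n.+1 ^ m <= 2 * n ^ m)%N.
  move=> mn; have mn1 : (m <= n.+1)%N by lia.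
  have H := bernoulli_nat mn1; rewrite -(@leq_pmul2r n.+1) // -mulnA.
  apply: leq_trans (leq_mul (leqnn 2) H).
  rewrite [(2 * _)%N]mulnCA leq_mul2l; apply/orP; right; lia.
have sq m : (2 * m <= n.+1)%N -> (n.+1 ^ (2 * m) <= 4 * n ^ (2 * m))%N.
  move=> mn; rewrite ![(2 * m)%N]mulnC !expnM -!mulnn.
  by apply: (leq_trans (leq_mul (half m mn) (half m mn))); move: (n ^ m)%N => x; nia.
have [en|on] := boolP (odd n); last first.
  have E : (2 * n./2 = n)%N by rewrite mul2n even_halfK.
  by have := sq n./2; rewrite E; apply.
have E : (2 * (n.+1)./2 = n.+1)%N by rewrite mul2n even_halfK //= negbK.
have := sq (n.+1)./2; rewrite E => /(_ (leqnn _)); rewrite !expnS.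
move: (n.+1 ^ n)%N (n ^ n)%N => x y H.
by rewrite -(@leq_pmul2l n.+1) //; apply: (leq_trans H); nia.
Qed.

Lemma pow_fact (n : nat) : (n ^ n <= 4 ^ n * n`!)%N.
Proof.
elim: n => // n IH; rewrite expnS factS expnS.
apply: (@leq_trans (n.+1 * (4 * n ^ n))); first by rewrite leq_mul2l succ_pow_le4 orbT.
by move: IH; move: (n ^ n)%N (4 ^ n)%N (n`!)%N => x y z; nia.
Qed.

Lemma fact_ratio d t N : (t + d <= N)%N -> ((t + d)`! <= t`! * N ^ d)%N.
Proof.
elim: d => [|d IH] H; first by rewrite addn0 expn0 muln1.
rewrite addnS factS expnS mulnCA; apply: leq_mul; first by rewrite -addnS.
by apply: IH; lia.
Qed.

(** [Q] will be a product of scales bounded by $\prod_{j \le t} 2n/j$. Extending the product to $j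
    \le n$ gives at most $(2n)^n/n! \le 8^n$. *)
Lemma scale_product_le n t Q : (0 < n)%N -> (t <= n)%N -> (Q * t`! <= (2 * n) ^ t)%N -> (Q <= 8 ^ n)%N.
Proof.
move=> n0 tn H; rewrite -(@leq_pmul2r (n`! * t`!)) ?muln_gt0 ?fact_gt0 //.
have h1 : (n`! <= t`! * (2 * n) ^ (n - t))%N.
  have := @fact_ratio (n - t) t (2 * n)%N; rewrite subnKC //; apply; lia.
apply: (@leq_trans ((2 * n) ^ t * (t`! * (2 * n) ^ (n - t)))).
  by rewrite [(n`! * _)%N]mulnC mulnA; apply: leq_mul.
have -> : ((2 * n) ^ t * (t`! * (2 * n) ^ (n - t)) = (2 * n) ^ n * t`!)%N.
  by rewrite mulnCA -expnD subnKC // mulnC.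
rewrite mulnA; apply: leq_mul => //; rewrite expnMn.
apply: (leq_trans (leq_mul (leqnn _) (pow_fact n))).
by rewrite mulnA -expnMn.
Qed.

Lemma scale_choice n T : (0 < T <= n)%N -> exists mu, (n <= 2 ^ mu * T)%N /\ (2 ^ mu * T <= 2 * n)%N.
Proof.
move=> /andP[T0 Tn]; have ex : exists mu, (n <= 2 ^ mu * T)%N.
  by exists n; apply: (leq_trans (ltnW (ltn_expl n (isT : 1 < 2)%N))); rewrite leq_pmulr.
case: (ex_minnP ex) => -[|mu] H1 H2; [exists 0%N|exists mu.+1]; split=> //.
  by rewrite expn0 mul1n (leq_trans Tn) // leq_pmull.
have : ~~ (n <= 2 ^ mu * T)%N by apply/negP => /H2; rewrite ltnn.
by rewrite -ltnNge => /ltnW h; rewrite expnS -mulnA leq_mul2l.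
Qed.

(** * Contours *)

Section Contours.
Local Open Scope fset_scope.
Variables (V : choiceType) (nb : V -> {fset V}).

(** Connectedness, and below the absence of finite complementary pieces, are expressed by edges
    leaving finite sets, which is the form required by the growth of the level sets. *)
Definition connected_in (A : {fset V}) := forall S : {fset V}, S `<=` A -> S != fset0 -> S != A ->
  exists v w, [/\ v \in S, w \in nb v, w \in A & w \notin S].
Definition no_holes (A : {fset V}) := forall S : {fset V}, S != fset0 ->
  (forall v, v \in S -> v \notin A) -> exists v w, [/\ v \in S, w \in nb v, w \notin S & w \notin A].
Definition contour o m (A : {fset V}) :=
  [/\ o \in A, connected_in A, no_holes A & bd nb A = m].
End Contours.

(** * Removing all exits but one *)

Section Amortize.
Local Open Scope fset_scope.
Local Open Scope ring_scope.
Variables (V : choiceType) (nb : V -> {fset V}).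
Hypothesis nbC : forall x y, (y \in nb x) = (x \in nb y).
Variable k : nat.
Hypothesis nbk : forall x, (#|` nb x| <= k)%N.
Variables (R : realFieldType) (Gam : nat) (vv : nat -> nat).
Hypotheses (Gam1 : (1 <= Gam)%N) (Gamk : (k <= Gam)%N).
Hypothesis Gam_big : exists2 j, (2 * j + 3 <= Gam)%N & (Gam * Gam <= 2 ^ j)%N.
Hypothesis v_card : forall x r, (#|` B nb x r| <= vv r)%N.
Hypothesis v_mono : forall r s, (r <= s)%N -> (vv r <= vv s)%N.
Hypothesis v_quad : forall r, (r * r <= Gam * vv r)%N.
Hypothesis v_lin : forall j r, (0 < r)%N -> (2 ^ j * vv r <= Gam * vv (4 ^ j * r))%N.
Hypothesis v_iso : forall (P : {fset V}) r, (0 < r)%N -> (Gam * #|` P| <= vv r)%N ->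
  (#|` P| <= Gam * r * bd nb P)%N.
Hypothesis v_transport : forall (F : V -> R) r (X U : {fset V}),
  (forall x, x \in X -> {subset B nb x r <= U}) ->
  \sum_(x <- X) \sum_(y <- B nb x r) `|F x - F y| <=
  (Gam * (r * vv r))%:R * \sum_(z <- U) grad nb F z.
Variables hc0 hc1 Ch : nat.
Hypothesis c0big : (Gam + 2 <= hc0)%N.
Hypotheses (c1A : c1A_cond Gam hc0 hc1) (c1B : c1B_cond R Gam hc0 hc1) (crho_small : crho_cond Gam hc0 hc1).
Hypotheses (ChA : ChA_cond Gam hc0 hc1 Ch) (ChB : ChB_cond R Gam hc0 Ch).
Hypothesis conn : forall x y, exists r, y \in B nb x r.
Hypothesis inf : forall A : {fset V}, exists x, x \notin A.

Variables (o : V) (A : {fset V}) (b : nat).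
Hypotheses (oA : o \in A) (cA : connected_in nb A) (hA : no_holes nb A).
Hypothesis Ab : A `<=` B nb o (2 ^ b).
Hypothesis bmin : b = 0%N \/ ~~ (A `<=` B nb o (2 ^ b.-1)).
Let n := bd nb A.
Let W := B nb o (2 ^ b).+1.
Let cr := cross nb (mem A).
Let M ka := \det (Mx nb R W (mem A) ka).
Definition side (sd : bool) v := (v \in A) == sd.
(** Since [A] is not contained in the ball of radius [2^(b-1)] about [o], no ball of radius at most
    [2^(b-2)] contains [A]; on the other hand the radius of [W] is at most [8 (rs + 1)]. *)
Let rs := if (1 < b)%N then (2 ^ b.-2)%N else 0%N.
Definition tot sd (ka : V -> nat) := (\sum_(v <- W | side sd v) ka v)%N.

Lemma W_bound : (#|` W| <= vv (8 * rs.+1))%N.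
Proof.
apply: (leq_trans (v_card _ _)); apply: v_mono; rewrite /rs.
have [b1|b1] := ltnP 1 b; last by move: b1; case: (b) => [|[|]].
by move: b1; case: (b) => [|[|c]] // _ /=; rewrite !expnS; move: (2 ^ c)%N => x; lia.
Qed.

Lemma A_sub_W : A `<=` W.
Proof. by apply: (fsubset_trans Ab); apply/fsubsetP => v; apply: B_mono. Qed.

Lemma cr_side sd v : side sd v -> cr v = (\sum_(w <- nb v) ~~ side sd w)%N.
Proof. by rewrite /side => /eqP vs; apply: eq_bigr => w _; rewrite /= vs. Qed.

Lemma tot_cr_true : tot true cr = n.
Proof.
rewrite /tot /n /bd [LHS](eq_bigl (mem A)); last by move=> v; rewrite /side eqb_id.
transitivity (\sum_(x <- [fset x in W | x \in A]) cr x)%N; first by rewrite big_fset.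
have -> : [fset x in W | x \in A] = A.
  apply/fsetP => v; rewrite in_sep; apply/andP/idP => [[]//|vA]; split=> //.
  exact: (fsubsetP A_sub_W).
rewrite big_seq [RHS]big_seq; apply: eq_bigr => v vA; rewrite (@cr_side true) ?/side ?vA //.
by apply: eq_bigr => w _; rewrite eqb_id.
Qed.

Lemma tot_cr_false : (tot false cr <= n)%N.
Proof.
rewrite -(ler_nat R) /tot.
pose T v w : R := ((v \notin A) && (w \in A))%:R.
have -> : (\sum_(v <- W | side false v) cr v)%:R = \sum_(v <- [fset v in W | side false v]) \sum_(w <- nb v) T v w.
  rewrite big_fset /= natr_sum; apply: eq_bigr => v vs; rewrite (cr_side vs) natr_sum.
  by apply: eq_bigr => w _; move: vs; rewrite /T /side; case: (v \in A); case: (w \in A).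
apply: (le_trans (@sum_swap_le _ _ nbC R T _ A _ _)).
- by move=> v w; rewrite ler0n.
- by move=> v w /negPf; rewrite /T => ->; rewrite andbF.
rewrite /n /bd natr_sum big_seq [X in _ <= X]big_seq; apply: ler_sum => w wA; rewrite natr_sum.
by apply: ler_sum => v _; rewrite /T wA andbT.
Qed.

Lemma tot_cr sd : (tot sd cr <= n)%N.
Proof. by case: sd; [rewrite tot_cr_true|exact: tot_cr_false]. Qed.

Lemma tot_dec sd ka y : y \in W -> side sd y -> (0 < ka y)%N -> tot sd ka = (tot sd (dec ka y)).+1.
Proof.
move=> yW sy ky; rewrite /tot ![in LHS]big_mkcond ![in RHS]big_mkcond (big_fsetD1 y) //= [in RHS](big_fsetD1 y) //=.
rewrite sy /dec eqxx -addSn prednK //; congr (_ + _)%N; rewrite big_seq [RHS]big_seq.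
by apply: eq_bigr => v; rewrite in_fsetD1 => /andP[/negPf -> _].
Qed.

Section Step.
Variables (sd : bool) (ka : V -> nat).
Hypothesis kacr : forall v, (ka v <= cr v)%N.
Hypothesis totsd : (sd < tot sd ka)%N.
Hypothesis Mpos : 0 < M ka.
Variable mu : nat.
Hypothesis mutot : (n <= 2 ^ mu * tot sd ka)%N.
Let c := (2 * Ch * pw8 (2 ^ mu))%N.
Let Z := [fset y in W | side sd y && (0 < ka y)%N].

Lemma c_ge2 : (2 <= c)%N.
Proof.
have C0 : (0 < Ch)%N by apply: (Ch_gt0 Gam1 ChA).
by rewrite /c -mulnA leq_pmulr // muln_gt0 C0 pw8_gt0 // expn_gt0.
Qed.

Lemma strip_finish y g : y \in Z -> M (dec ka y) = M ka * (1 - g y) -> 1 <= c%:R * (1 - g y) ->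
  exists y, [/\ y \in W, side sd y, (0 < ka y)%N, 0 < M (dec ka y) & M ka <= c%:R * M (dec ka y)].
Proof.
rewrite in_sep => /and3P[yW sy ky] E H; exists y; split=> //.
  rewrite E mulr_gt0 //; have c0 : 0 < c%:R :> R by rewrite ltr0n (leq_trans _ c_ge2).
  by rewrite -(pmulr_rgt0 _ c0) (lt_le_trans ltr01).
by rewrite E mulrCA -[X in X <= _]mulr1 ler_pM2l.
Qed.

Lemma side_pred v w : side sd v -> ((w \in A) == (v \in A)) = side sd w.
Proof. by rewrite /side => /eqP ->. Qed.

(** Outside [A] the absence of holes suffices. On the side of [A] a second exit, lying outside [P],
    is required, since [P] might otherwise be the whole of [A]; this is why the last exit on [A]
    cannot be removed. *)
Lemma exits_out (y : V) (g : V -> R) (P : {fset V}) : y \in P ->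
  {subset P <= Hi (side sd) W g} ->
  (sd -> exists2 y', y' \in A & y' \notin P) ->
  exists v w, [/\ v \in P, w \in nb v, side sd w & w \notin P].
Proof.
move=> yP PH other; have PA v : v \in P -> side sd v by move=> /PH; rewrite in_sep => /and3P[].
have P0 : P != fset0 by apply/fset0Pn; exists y.
case E: sd other => other.
  have [y' y'A y'P] := other isT.
  have PsA : P `<=` A by apply/fsubsetP => v /PA; rewrite /side E eqb_id.
  have PnA : P != A by apply: contraNneq y'P => ->.
  have [v [w [vP wv wA wP]]] := cA PsA P0 PnA; exists v, w; split=> //.
  by rewrite /side wA.
have [|v [w [vP wv wP wA]]] := hA P0.
  by move=> v /PA; rewrite /side E eqbF_neg.
by exists v, w; split=> //; rewrite /side (negPf wA).
Qed.

(** The opposite side is not exhausted by a small ball: the complement of [A] has no finite piece,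
    and [A] is too wide to fit in. *)
Lemma other_out (y x0 : V) (Q : {fset V}) rho : (rho < rs)%N -> x0 \in Q -> ~~ side sd x0 ->
  Q `<=` B nb y rho.+1 -> exists v w, [/\ v \in Q, w \in nb v, ~~ side sd w & w \notin Q].
Proof.
move=> rr xQ sx QB; case E: sd sx => sx.
  have S0 : [fset v in Q | v \notin A] != fset0.
    by apply/fset0Pn; exists x0; rewrite in_sep xQ; move: sx; rewrite /side eqb_id.
  have [|v [w [vS wv wS wA]]] := hA S0; first by move=> v; rewrite in_sep => /andP[].
  move: vS wS; rewrite !in_sep wA andbT => /andP[vQ _] wQ.
  by exists v, w; split=> //; rewrite /side (negPf wA).
have xA : x0 \in A by move: sx; rewrite /side eqbF_neg negbK.
have [u uA uQ] : exists2 u, u \in A & u \notin Q.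
  have b1 : (1 < b)%N by move: rr; rewrite /rs; case: (ltnP 1 b).
  have nAB : ~~ (A `<=` B nb o (2 ^ b.-1)) by case: bmin => // b0; rewrite b0 in b1.
  have rr2 : (rho.+1 <= 2 ^ b.-2)%N by move: rr; rewrite /rs b1.
  have /negP nall : ~~ (A `<=` Q).
    apply: contra nAB => AQ; apply/fsubsetP => v vA.
    have oB := fsubsetP QB _ (fsubsetP AQ _ oA); have vB := fsubsetP QB _ (fsubsetP AQ _ vA).
    rewrite (B_sym nbC) in oB; have := B_trans oB vB; apply: B_mono.
    by case: (b) b1 rr2 => [|[|c']] //= _ h; rewrite expnS mul2n -addnn leq_add.
  by move/negP/fsubsetPn: nall => [u uA uQ]; exists u.
have S1 : [fset v in Q | v \in A] `<=` A by apply/fsubsetP => v; rewrite in_sep => /andP[].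
have S0 : [fset v in Q | v \in A] != fset0 by apply/fset0Pn; exists x0; rewrite in_sep xQ.
have SA : [fset v in Q | v \in A] != A.
  by apply: contraNneq uQ => E2; move: uA; rewrite -{1}E2 in_sep => /andP[].
have [v [w [vS wv wA wS]]] := cA S1 S0 SA; exists v, w; split=> //.
- by move: vS; rewrite in_sep => /andP[].
- by rewrite /side wA.
- by move: wS; rewrite in_sep wA andbT.
Qed.

(** If some exit has [G y y <= 1/2], its removal costs at most 2. Otherwise [green_sum] forces the
    exits to be simple and the sets where [G y > 1/2] to be disjoint. These share at most [n] cut
    edges, so by averaging one of them meets at most [n / #|Z|], hence at most [2 ^ mu], and [heart]
    bounds the cost. *)
Lemma strip_step :
  exists y, [/\ y \in W, side sd y, (0 < ka y)%N, 0 < M (dec ka y) & M ka <= c%:R * M (dec ka y)].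
Proof.
have Mn0 : M ka != 0 by rewrite gt_eqF.
have ex y : exists g : V -> R, y \in Z ->
    [/\ forall v, v \notin W -> g v = 0, forall v, v \in W -> Lk nb (mem A) ka g v = (v == y)%:R &
     M (dec ka y) = M ka * (1 - g y)].
  have [|yZ] := boolP (y \in Z); last by exists (fun=> 0).
  rewrite in_sep => /and3P[yW sy ky]; have [g Hg] := green Mn0 yW ky; by exists g.
have [G GP] := boolp.choice ex.
have cR : 2 <= c%:R :> R by rewrite ler_nat c_ge2.
have ZW : Z `<=` W by apply/fsubsetP => y; rewrite in_sep => /andP[].
have gsum x : \sum_(z <- Z) (ka z)%:R * G z x <= 1.
  apply: (green_sum nbC Mn0 ZW) => z v zZ vW; have [h1 h2 _] := GP z zZ; [exact: h1|exact: h2].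
have G0 z v : z \in Z -> 0 <= G z v.
  by move=> zZ; have [h1 h2 _] := GP z zZ; apply: (green_ge0 nbC Mn0 h1 h2).
have [[y yZ gy]|big] := pselect (exists2 y, y \in Z & G y y <= 1 / 2).
  have [_ _ E] := GP y yZ; apply: (strip_finish yZ E).
  apply: (@le_trans _ _ (2 * (1 / 2))); first by lra.
  by apply: ler_pM => //; lra.
have big' y : y \in Z -> 1 / 2 < G y y.
  by move=> yZ; rewrite ltNge; apply/negP => h; apply: big; exists y.
have ka1 y : y \in Z -> ka y = 1%N.
  move=> yZ; have := gsum y; rewrite (big_fsetD1 y) //=.
  have r0 : 0 <= \sum_(z <- Z `\ y) (ka z)%:R * G z y.
    rewrite big_seq; apply: sumr_ge0 => z; rewrite in_fsetD1 => /andP[_ zZ].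
    by apply: mulr_ge0 => //; exact: G0.
  have gy := big' y yZ; move: (yZ); rewrite in_sep => /and3P[_ _ ky] H.
  apply/eqP; rewrite eqn_leq ky andbT leqNgt; apply/negP => k2.
  have k2R : 2 <= (ka y)%:R :> R by rewrite ler_nat.
  have : 2 * (1 / 2) < (ka y)%:R * G y y.
    apply: (@lt_le_trans _ _ (2 * G y y)); first by lra.
    by apply: ler_wpM2r => //; exact: G0.
  lra.
have disj y z x : y \in Z -> z \in Z -> y != z -> 1 / 2 < G y x -> 1 / 2 < G z x -> False.
  move=> yZ zZ yz gyx gzx; have := gsum x; rewrite (big_fsetD1 y) //= (big_fsetD1 z) /=; last first.
    by rewrite in_fsetD1 eq_sym yz.
  rewrite !ka1 // !mul1r => H.
  have r0 : 0 <= \sum_(u <- Z `\ y `\ z) (ka u)%:R * G u x.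
    rewrite big_seq; apply: sumr_ge0 => u; rewrite !in_fsetD1 => /and3P[_ _ uZ].
    by apply: mulr_ge0 => //; exact: G0.
  lra.
have totZ : (tot sd ka <= #|` Z|)%N.
  rewrite -sumb_card /tot big_mkcond big_seq [X in (_ <= X)%N]big_seq leq_sum // => v vW.
  case: ifP => // sv; case: (posnP (ka v)) => [->//|kv].
  by rewrite ka1 // in_sep vW sv kv.
have Z0 : (0 < #|` Z|)%N by apply: leq_trans totZ; exact: leq_ltn_trans totsd.
pose pi y := (\sum_(v <- Hi (side sd) W (G y)) \sum_(w <- nb v) ~~ side sd w)%N.
have piE y : pi y = (\sum_(v <- W | side sd v) (1 / 2 < G y v)%R * cr v)%N.
  rewrite /pi /Hi big_fset /= [LHS]big_mkcond [RHS]big_mkcond; apply: eq_bigr => v _.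
  case sv: (side sd v) => //=; rewrite (cr_side sv); case: (1 / 2 < G y v) => //=.
  by rewrite mul1n.
have pisum : (\sum_(y <- Z) pi y <= n)%N.
  apply: leq_trans (tot_cr sd); rewrite /tot.
  under eq_bigr do rewrite piE; rewrite exchange_big /= leq_sum // => v sv.
  rewrite -big_distrl /= -[X in (_ <= X)%N]mul1n leq_mul2r; apply/orP; right.
  rewrite sumb_card; rewrite leqNgt; apply/negP => two.
  have [y yS] : exists y, y \in [fset y in Z | 1 / 2 < G y v].
    by apply/fset0Pn; rewrite -cardfs_gt0; exact: ltnW.
  have [z zS] : exists z, z \in [fset y in Z | 1 / 2 < G y v] `\ y.
    by apply/fset0Pn; rewrite -cardfs_gt0; move: two; rewrite (cardfsD1 y) yS add1n ltnS.
  move: yS; rewrite in_sep => /andP[yZ gy]; move: zS; rewrite in_fsetD1 in_sep => /and3P[zy zZ gz].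
  by apply: (disj z y v).
have [y yZ piy] : exists2 y, y \in Z & (#|` Z| * pi y <= n)%N.
  have [//|H] := pselect (exists2 y, y \in Z & (#|` Z| * pi y <= n)%N).
  exfalso; have H2 y : y \in Z -> (n < #|` Z| * pi y)%N.
    by move=> yZ; rewrite ltnNge; apply/negP => h; apply: H; exists y.
  have : (\sum_(y <- Z) n.+1 <= \sum_(y <- Z) #|` Z| * pi y)%N.
    by rewrite big_seq [X in (_ <= X)%N]big_seq leq_sum.
  rewrite -big_distrr /= big_const_seq count_predT iter_addn_0 leqNgt => /negP; apply.
  apply: (@leq_ltn_trans (#|` Z| * n)); first by rewrite leq_mul2l pisum orbT.
  by rewrite mulnC ltn_pmul2r.
have pim : (pi y <= 2 ^ mu)%N.
  rewrite -(@leq_pmul2l #|` Z|) //; apply: (leq_trans piy); apply: (leq_trans mutot).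
  by rewrite mulnC leq_mul2r totZ orbT.
have [g0 gL E] := GP y yZ; apply: (strip_finish yZ E).
move: (yZ); rewrite in_sep => /and3P[yW sy ky].
have [x0 x0y sx0] : exists2 x0, x0 \in nb y & ~~ side sd x0.
  have : (0 < cr y)%N by exact: leq_trans (kacr y).
  rewrite (cr_side sy) sumb_card cardfs_gt0 => /fset0Pn[x0]; rewrite in_sep => /andP[? ?].
  by exists x0.
rewrite leNgt; apply/negP => small.
have C0 : (0 < Ch)%N by apply: (Ch_gt0 Gam1 ChA).
have c0 : 0 < c%:R :> R by rewrite ltr0n (leq_trans _ c_ge2).
have gy : 1 - G y y < hi R Ch mu / 2.
  rewrite /hi -invfM -ltr_pdivlMl // in small *.
  have -> : ((Ch * (2 ^ mu) ^ 8)%:R * 2)^-1 = c%:R^-1 :> R.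
    by rewrite -natrM; congr (_%:R^-1); rewrite /c /pw8 mulnC mulnA.
  by rewrite mulr1 in small.
have gL' v : v \in W -> side sd v ->
    \sum_(w <- nb v | side sd w) (G y v - G y w) + (ka v)%:R * G y v = (v == y)%:R.
  move=> vW sv; rewrite -(gL v vW) /Lk; congr (_ + _); apply: eq_bigl => w.
  by rewrite -(@side_pred v w sv).
apply: (@heart V nb nbC k nbk R Gam vv Gam1 Gamk Gam_big v_card v_mono v_quad v_lin v_iso v_transport
  hc0 hc1 Ch c0big c1A c1B crho_small ChA ChB mu (side sd) W ka (G y) y x0 rs yW sy ky g0 _ gL' x0y sx0 gy pim).
- by move=> v; exact: G0.
- move=> P yP PH; apply: (exits_out yP PH) => sdT.
  have [y' y'Z y'y] : exists2 y', y' \in Z & y' != y.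
    have : (0 < #|` Z `\ y|)%N.
      have := leq_trans totsd totZ; rewrite sdT (cardfsD1 y) yZ /=.
      by rewrite add1n ltnS.
    by rewrite cardfs_gt0 => /fset0Pn[y']; rewrite in_fsetD1 => /andP[? ?]; exists y'.
  exists y'; first by move: y'Z; rewrite in_sep /side sdT eqb_id => /and3P[].
  apply/negP => /PH; rewrite in_sep => /and3P[_ _ gy'].
  by apply: (disj y' y y') => //; exact: big'.
- by move=> Q rho rr xQ QB; exact: (other_out rr xQ sx0 QB).
- exact: W_bound.
Qed.

End Step.

(** With [t] exits still to remove, one is removed at a scale [2 ^ mu] of at most [2n/t], and [Q] is
    the product of these scales. The boolean [sd], read as a number, is the number of exits kept on
    that side. *)
Lemma strip sd t ka : (t <= n)%N -> (forall v, (ka v <= cr v)%N) -> tot sd ka = (t + sd)%N -> 0 < M ka ->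
  exists ka' Q, [/\ forall v, (ka' v <= ka v)%N, forall v, ~~ side sd v -> ka' v = ka v,
   tot sd ka' = sd & [/\ (Q * t`! <= (2 * n) ^ t)%N, 0 < M ka' &
   M ka <= ((2 * Ch) ^ t * pw8 Q)%:R * M ka']].
Proof.
elim: t ka => [|t IH] ka tn kacr tE Mp.
  by exists ka, 1%N; split=> //; split=> //; rewrite expn0 mul1n mul1r.
have [mu [mu1 mu2]] : exists mu, (n <= 2 ^ mu * t.+1)%N /\ (2 ^ mu * t.+1 <= 2 * n)%N by exact: scale_choice.
have totsd : (sd < tot sd ka)%N by rewrite tE addSn ltnS leq_addl.
have mut : (n <= 2 ^ mu * tot sd ka)%N by apply: (leq_trans mu1); rewrite leq_mul2l tE leq_addr orbT.
have [y [yW sy ky My Mle]] := strip_step kacr totsd Mp mut.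
have decle v : (dec ka y v <= ka v)%N by rewrite /dec; case: eqP => [->|//]; exact: leq_pred.
have [||||ka' [Q [h1 h2 h3 [h4 h5 h6]]]] := IH (dec ka y).
- exact: ltnW.
- by move=> v; exact: leq_trans (decle v) (kacr v).
- by apply/succn_inj; rewrite -(tot_dec yW sy ky) tE addSn.
- exact: My.
exists ka', (2 ^ mu * Q)%N; split=> //.
- by move=> v; exact: leq_trans (h1 v) (decle v).
- move=> v sv; rewrite h2 // /dec; case: eqP => // E; by rewrite E sy in sv.
split=> //.
  rewrite factS expnS.
  have -> : (2 ^ mu * Q * (t.+1 * t`!) = (2 ^ mu * t.+1) * (Q * t`!))%N.
    by move: (2 ^ mu)%N (t`!)%N => x z; ring.
  exact: leq_mul.
apply: (le_trans Mle); rewrite expnS pw8M.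
have -> : (2 * Ch * (2 * Ch) ^ t * (pw8 (2 ^ mu) * pw8 Q) = 2 * Ch * pw8 (2 ^ mu) * ((2 * Ch) ^ t * pw8 Q))%N.
  by move: (pw8 _) (pw8 _) ((2 * Ch) ^ t)%N => x z u; ring.
by rewrite (natrM _ (2 * Ch * pw8 (2 ^ mu))) -mulrA; apply: ler_wpM2l.
Qed.

Definition KK := ((2 * Ch * K8) * (2 * Ch * K8))%N.

(** All exits outside [A] go, then all but one on [A]. The final determinant counts forests with a
    single exit at [z], which may be realised by any cut edge from [z] to some [eta]. *)
Lemma amortized : (0 < n)%N -> exists z eta, [/\ z \in A, eta \in nb z, eta \notin A &
  (#|forests (@alW V nb W) (@tgW V nb W)| <= KK ^ n * #|@forests1 V nb W A z eta|)%N].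
Proof.
move=> n0.
have M0 : 0 < M cr.
  apply: lt_le_trans (det_cut nb R W (mem A)).
  by rewrite det_lap ltr0n; exact: forests_gt0.
have [||||ka1 [Q1 [a1 a2 a3 [a4 a5 a6]]]] := @strip false (tot false cr) cr.
- exact: tot_cr_false.
- by [].
- by rewrite addn0.
- exact: M0.
have t1 : tot true ka1 = (n.-1 + true)%N.
  rewrite addn1 prednK // -tot_cr_true /tot; apply: eq_bigr => v sv; apply: a2.
  by move: sv; rewrite /side; case: (v \in A).
have [||||ka2 [Q2 [b1 b2 b3 [b4 b5 b6]]]] := @strip true n.-1 ka1.
- exact: leq_pred.
- by move=> v; exact: a1.
- exact: t1.
- exact: a5.
have [z zA kz] : exists2 z, z \in A & (0 < ka2 z)%N.
  have [//|H] := pselect (exists2 z, z \in A & (0 < ka2 z)%N).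
  have : tot true ka2 = 0%N.
    rewrite /tot big1 // => v; rewrite /side eqb_id => vA; apply/eqP; rewrite -leqn0 leqNgt.
    by apply/negP => h; apply: H; exists v.
  by rewrite b3.
have zW := fsubsetP A_sub_W _ zA.
have ka2E v : v \in W -> ka2 v = root1 z v.
  move=> vW; rewrite /root1; have [vA|vA] := boolP (v \in A); last first.
    have -> : (v == z) = false by apply: contraNF vA => /eqP ->.
    rewrite b2 ?/side ?(negPf vA) //; apply/eqP; rewrite -leqn0.
    have := a3; rewrite /tot big_mkcond (big_fsetD1 v) //=.
    by rewrite /side (negPf vA) eqxx /= => /eqP; rewrite addn_eq0 => /andP[/eqP -> _].
  have sz : side true z by rewrite /side zA.
  have := b3; rewrite (tot_dec zW sz kz) => -[] t0.
  have dz u : u \in W -> u \in A -> dec ka2 z u = 0%N.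
    move=> uW uA; have := t0; rewrite /tot big_mkcond (big_fsetD1 u) //=.
    by rewrite /side uA eqxx /= => /eqP; rewrite addn_eq0 => /andP[/eqP -> _].
  have := dz v vW vA; rewrite /dec; case: eqVneq => [->|_]; last by move=> ->.
  by move=> h; rewrite /= -(prednK kz) h.
have M2 : M ka2 = M (root1 z).
  rewrite /M; congr (\det _); apply/matrixP => i j; rewrite !mxE.
  by rewrite ka2E //; exact: vtW.
have [eta ez eA] : exists2 eta, eta \in nb z & eta \notin A.
  have sz : side true z by rewrite /side zA.
  have : (0 < cr z)%N by apply: leq_trans (a1 z); apply: leq_trans (b1 z); exact: kz.
  rewrite (cr_side sz) sumb_card cardfs_gt0 => /fset0Pn[x0]; rewrite in_sep => /andP[h1 h2].
  by exists x0 => //; move: h2; rewrite /side eqb_id.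
exists z, eta; split=> //; rewrite -(ler_nat R) -det_lap.
apply: (le_trans (det_cut nb R W (mem A))); apply: (le_trans a6).
rewrite [X in _ <= X]natrM -(det_root1 R W zA ez eA) -/(M (root1 z)) -M2.
have Q1le : (Q1 <= 8 ^ n)%N by exact: scale_product_le tot_cr_false a4.
have Q2le : (Q2 <= 8 ^ n)%N by exact: scale_product_le (leq_pred n) b4.
have C0 : (0 < 2 * Ch)%N by rewrite muln_gt0 (Ch_gt0 Gam1 ChA).
have bnd t Q : (t <= n)%N -> (Q <= 8 ^ n)%N -> ((2 * Ch) ^ t * pw8 Q <= (2 * Ch * K8) ^ n)%N.
  by move=> tn Qn; rewrite /K8 -lock; exact: strip_bound.
have KKE : (KK ^ n)%:R = ((2 * Ch * K8) ^ n)%:R * ((2 * Ch * K8) ^ n)%:R :> R by rewrite /KK expnMn natrM.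
rewrite KKE -[X in _ <= X]mulrA.
apply: ler_pM; [exact: ler0n|exact: ltW|by rewrite ler_nat; apply: bnd => //; exact: tot_cr_false|].
apply: (le_trans b6); apply: ler_wpM2r; first exact: ltW.
by rewrite ler_nat; apply: bnd => //; exact: leq_pred.
Qed.

End Amortize.

(** * Counting contours from the volume and transport estimates *)

Lemma square_root_bound q X : ((q.-1) * (q.-1) < X * q)%N -> (q <= X + 2)%N.
Proof.
move=> H; rewrite leqNgt; apply/negP => qX; case: q H qX => // q /= H qX.
have : (X.+2 <= q)%N by lia.
by move=> h; have := leq_mul h (leqnn q); nia.
Qed.

Lemma size_bound_exp (G n : nat) : (0 < n)%N -> (0 < G)%N ->
  (G * G * n * (G * G * n + 2) <= (12 * (G * G * (G * G))) ^ n)%N.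
Proof.
move=> n0 G0; have n2 : (n <= 2 ^ n)%N by exact/ltnW/ltn_expl.
set g := (G * G)%N; have g0 : (0 < g)%N by rewrite muln_gt0 G0.
apply: (@leq_trans (3 * (g * g) * (2 ^ n * 2 ^ n))).
  apply: (@leq_trans (3 * (g * g) * (n * n))); last by apply: leq_mul => //; exact: leq_mul.
  have : (1 <= g * n)%N by rewrite muln_gt0 g0.
  have -> : (3 * (g * g) * (n * n) = 3 * (g * n * (g * n)))%N by ring.
  by move: (g * n)%N => x; nia.
have -> : (2 ^ n * 2 ^ n = 4 ^ n)%N by rewrite -expnMn.
have -> : (12 * (g * g) = 3 * (g * g) * 4)%N by ring.
rewrite expnMn; apply: leq_mul => //.
case: n n0 n2 => // n _ _; rewrite expnS leq_pmulr // expn_gt0.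
by rewrite (muln_gt0 3) (muln_gt0 g g) g0.
Qed.

Section Count.
Local Open Scope fset_scope.
Local Open Scope ring_scope.
Variables (V : choiceType) (nb : V -> {fset V}).
Hypothesis nbC : forall x y, (y \in nb x) = (x \in nb y).
Variable k : nat.
Hypothesis nbk : forall x, (#|` nb x| <= k)%N.
Variables (R : realFieldType) (Gam : nat) (vv : nat -> nat).
Hypotheses (Gam1 : (1 <= Gam)%N) (Gamk : (k <= Gam)%N).
Hypothesis Gam_big : exists2 j, (2 * j + 3 <= Gam)%N & (Gam * Gam <= 2 ^ j)%N.
Hypothesis v_card : forall x r, (#|` B nb x r| <= vv r)%N.
Hypothesis v_mono : forall r s, (r <= s)%N -> (vv r <= vv s)%N.
Hypothesis v_quad : forall r, (r * r <= Gam * vv r)%N.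
Hypothesis v_lin : forall j r, (0 < r)%N -> (2 ^ j * vv r <= Gam * vv (4 ^ j * r))%N.
Hypothesis v_iso : forall (P : {fset V}) r, (0 < r)%N -> (Gam * #|` P| <= vv r)%N ->
  (#|` P| <= Gam * r * bd nb P)%N.
Hypothesis v_transport : forall (F : V -> R) r (X U : {fset V}),
  (forall x, x \in X -> {subset B nb x r <= U}) ->
  \sum_(x <- X) \sum_(y <- B nb x r) `|F x - F y| <=
  (Gam * (r * vv r))%:R * \sum_(z <- U) grad nb F z.
Variables hc0 hc1 Ch : nat.
Hypothesis c0big : (Gam + 2 <= hc0)%N.
Hypotheses (c1A : c1A_cond Gam hc0 hc1) (c1B : c1B_cond R Gam hc0 hc1) (crho_small : crho_cond Gam hc0 hc1).
Hypotheses (ChA : ChA_cond Gam hc0 hc1 Ch) (ChB : ChB_cond R Gam hc0 Ch).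
Hypothesis conn : forall x y, exists r, y \in B nb x r.
Hypothesis inf : forall A : {fset V}, exists x, x \notin A.

Definition Msz n := ((12 * (Gam * Gam * (Gam * Gam))) ^ n)%N.

(** Isoperimetry at radius [Gam * q] with $q$ about $\sqrt{\#A}$, where quadratic growth makes [A]
    small enough, gives $\#A \le Gam^2 n q$. The resulting bound is polynomial in [n] and is only
    relaxed to an exponential. *)
Lemma contour_size o n A : (0 < n)%N -> contour nb o n A -> (#|` A| <= Msz n)%N.
Proof.
move=> n0 [oA _ _ bdA].
have ex : exists q, (#|` A| <= q * q)%N by exists #|` A|; case: #|` A| => // c; rewrite leq_pmulr.
case: (ex_minnP ex) => q Hq qmin.
have A0 : (0 < #|` A|)%N by exact: card_ge1 oA.
have q0 : (0 < q)%N by case: (q) Hq => //; rewrite leqNgt A0.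
have r0 : (0 < Gam * q)%N by rewrite muln_gt0 Gam1.
have h1 : (Gam * #|` A| <= vv (Gam * q))%N.
  rewrite -(@leq_pmul2l Gam) //; apply: leq_trans (v_quad _).
  by rewrite mulnACA mulnA leq_mul2l Hq orbT.
have h2 := v_iso r0 h1; rewrite bdA in h2.
have h3 : (q.-1 * q.-1 < #|` A|)%N.
  by rewrite ltnNge; apply/negP => /qmin; rewrite leqNgt prednK // leqnn.
have E : (Gam * (Gam * q) * n = Gam * Gam * n * q)%N by move: (Gam) => G; ring.
rewrite E in h2.
have h4 : (q <= Gam * Gam * n + 2)%N by apply: square_root_bound; exact: leq_trans h2.
apply: (leq_trans h2); apply: leq_trans (size_bound_exp n0 Gam1).
by rewrite leq_mul2l h4 orbT.
Qed.

Lemma connected_in_ball o A : o \in A -> connected_in nb A -> A `<=` B nb o #|` A|.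
Proof.
move=> oA cA; pose S r := [fset v in A | v \in B nb o r].
have SA r : S r `<=` A by apply/fsubsetP => v; rewrite in_sep => /andP[].
have S0 r : S r != fset0 by apply/fset0Pn; exists o; rewrite in_sep oA Bid.
have grow r : S r != A -> (#|` S r| < #|` S r.+1|)%N.
  move=> ne; have [v [w [vS wv wA wS]]] := cA _ (SA r) (S0 r) ne.
  apply: (@fset_lt _ _ _ w) => //.
    by apply/fsubsetP => u; rewrite !in_sep => /andP[-> uB]; rewrite (@B_mono _ nb o r r.+1 _ u uB).
  by move: vS; rewrite !in_sep wA => /andP[_ vB]; exact: nbB wv.
have mono r : S r = A -> S r.+1 = A.
  move=> E; apply/eqP; rewrite eqEfsubset SA -{1}E; apply/fsubsetP => u.
  by rewrite !in_sep => /andP[-> uB]; rewrite (@B_mono _ nb o r r.+1 _ u uB).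
have H r : S r = A \/ (r < #|` S r|)%N.
  elim: r => [|r [E|IH]]; first by right; rewrite cardfs_gt0.
    by left; exact: mono.
  have [E|ne] := eqVneq (S r) A; first by left; exact: mono.
  by right; exact: leq_ltn_trans (grow r ne).
have [E|lt] := H #|` A|; first by rewrite -{1}E; apply/fsubsetP => u; rewrite in_sep => /andP[].
by have := leq_ltn_trans (fsubset_leq_card (SA #|` A|)) lt; rewrite ltnn.
Qed.

Definition KC := (2 * (12 * (Gam * Gam * (Gam * Gam))) * (12 * (Gam * Gam * (Gam * Gam))) * KK Ch)%N.

(** Contours are sorted by the least [b] with [A] inside the ball of radius [2^b], so that a class
    shares one window [W]. Summing [amortized] over a class and comparing with [forests1_sum], the
    number of forests cancels; there are at most [M + 1] classes. *)
Lemma contour_count o n (F : seq {fset V}) : (0 < n)%N -> uniq F ->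
  (forall A, A \in F -> contour nb o n A) -> (size F <= KC ^ n)%N.
Proof.
move=> n0 uF HF; pose M := Msz n.
have exb A : exists b, (A \in F) ==> (A `<=` B nb o (2 ^ b)).
  exists #|` A|; apply/implyP => AF; have [oA cA _ _] := HF A AF.
  apply: (fsubset_trans (connected_in_ball oA cA)); apply/fsubsetP => v; apply: B_mono.
  exact/ltnW/ltn_expl.
pose bA A := ex_minn (exb A).
have bAM A : A \in F -> (bA A < M.+1)%N.
  move=> AF; rewrite ltnS /bA; case: ex_minnP => b _ bmin; apply: leq_trans (contour_size n0 (HF A AF)).
  apply: bmin; apply/implyP => _; have [oA cA _ _] := HF A AF.
  apply: (fsubset_trans (connected_in_ball oA cA)); apply/fsubsetP => v; apply: B_mono.
  exact/ltnW/ltn_expl.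
have one b : (size [seq A <- F | bA A == b] <= M * KK Ch ^ n)%N.
  set Fb := [seq A <- F | bA A == b]; pose W := B nb o (2 ^ b).+1.
  have ex A : exists zeta : V * V, A \in Fb -> [/\ zeta.1 \in A, zeta.2 \in nb zeta.1, zeta.2 \notin A &
     (#|forests (@alW V nb W) (@tgW V nb W)| <= KK Ch ^ n * #|@forests1 V nb W A zeta.1 zeta.2|)%N].
    have [|AF] := boolP (A \in Fb); last by exists (o, o).
    rewrite mem_filter => /andP[/eqP bE AF]; have [oA cA hA bdA] := HF A AF.
    have Ab : A `<=` B nb o (2 ^ b) by rewrite -bE /bA; case: ex_minnP => b' /implyP/(_ AF).
    have bmin : b = 0%N \/ ~~ (A `<=` B nb o (2 ^ b.-1)).
      rewrite -bE /bA; case: ex_minnP => -[|b'] _ bm; first by left.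
      by right; apply/negP => h; have := bm b'; rewrite AF h /= => /(_ isT); rewrite ltnn.
    have n0' : (0 < bd nb A)%N by rewrite bdA.
    have [z [eta [h1 h2 h3 h4]]] := @amortized V nb nbC k nbk R Gam vv Gam1 Gamk Gam_big v_card v_mono v_quad
      v_lin v_iso v_transport hc0 hc1 Ch c0big c1A c1B crho_small ChA ChB conn inf o A b oA cA hA Ab bmin n0'.
    by exists (z, eta) => _; split=> //; rewrite bdA in h4.
  have [ze zeP] := boolp.choice ex.
  have uFb : uniq Fb by exact: filter_uniq.
  have S := @forests1_sum V nb W o Fb (fun A => (ze A).1) (fun A => (ze A).2) M uFb.
  have {}S : (\sum_(A <- Fb) #|@forests1 V nb W A (ze A).1 (ze A).2| <= M * #|forests (@alW V nb W) (@tgW V nb W)|)%N.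
    apply: S => A AFb; have [h1 h2 h3 h4] := zeP A AFb.
    move: (AFb); rewrite mem_filter => /andP[/eqP bE AF]; have HA := HF A AF; have [oA _ _ _] := HA.
    split=> //; last exact: contour_size HA.
    have Ab : A `<=` B nb o (2 ^ b) by rewrite -bE /bA; case: ex_minnP => b' /implyP/(_ AF).
    by apply: (fsubset_trans Ab); apply/fsubsetP => v; apply: B_mono.
  have fpos : (0 < #|forests (@alW V nb W) (@tgW V nb W)|)%N by exact: forests_gt0.
  rewrite -(leq_pmul2r fpos).
  apply: (@leq_trans (\sum_(A <- Fb) KK Ch ^ n * #|@forests1 V nb W A (ze A).1 (ze A).2|)).
    rewrite -sum1_size big_distrl /= big_seq [X in (_ <= X)%N]big_seq leq_sum // => A AFb.
    by rewrite mul1n; have [_ _ _ ?] := zeP A AFb.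
  by rewrite -big_distrr /= mulnAC mulnC leq_mul2r S orbT.
have sz : (size F <= \sum_(b < M.+1) size [seq A <- F | bA A == b])%N.
  apply: (@leq_trans (\sum_(A <- F) \sum_(b < M.+1) (bA A == b))).
    rewrite -sum1_size big_seq [X in (_ <= X)%N]big_seq leq_sum // => A AF.
    by rewrite (bigD1 (Ordinal (bAM A AF))) //= eqxx.
  rewrite exchange_big /= leq_sum // => b _.
  rewrite size_filter -sum1_count [X in (_ <= X)%N]big_mkcond; apply: leq_sum => A _.
  by case: (bA A == nat_of_ord b).
apply: (leq_trans sz).
apply: (@leq_trans (\sum_(b < M.+1) M * KK Ch ^ n)); first by apply: leq_sum => b _; exact: one.
rewrite sum_nat_const card_ord /KC.
have M1 : (0 < M)%N by rewrite /M /Msz expn_gt0 !muln_gt0 Gam1.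
rewrite expnMn mulnA; apply: leq_mul => //.
rewrite expnMn -/(Msz n) -/M; apply: leq_mul => //; rewrite expnMn -/(Msz n) -/M.
apply: (@leq_trans (2 * M)); first by lia.
by apply: leq_mul => //; case: (n) n0 => // n' _; rewrite expnS leq_pmulr // expn_gt0.
Qed.

End Count.

Lemma parts_le (p1 p2 p3 p4 p5 p6 G : nat) : (p1 + p2 + p3 + p4 + p5 + p6 + 5 <= G)%N ->
  [/\ (p1 <= G)%N, (p2 <= G)%N, (p3 <= G)%N & [/\ (p4 <= G)%N, (p5 <= G)%N & (p6 <= G)%N]].
Proof. by move=> H; split; [lia..|split; lia]. Qed.

(** * Contour count when short pairs are balanced *)

Section Balanced.
Local Open Scope fset_scope.
Variables (V : choiceType) (nb : V -> {fset V}).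
Hypothesis nbC : forall x y, (y \in nb x) = (x \in nb y).
Variable k : nat.
Hypothesis nbk : forall x, (#|` nb x| <= k)%N.
Variables (reps : seq V).
Hypothesis repsP : forall v, exists r f, [/\ r \in reps, aut nb f & f r = v].
Hypothesis conn : forall x y, exists r, y \in B nb x r.
Hypothesis inf : forall A : {fset V}, exists x, x \notin A.

(** The graph being infinite and connected, some vertex lies at distance [2q + 1] from [x], and the
    ball of radius [4q] contains two disjoint balls of radius [q]. *)
Lemma vol_linear j r : (0 < r)%N ->
  forall x, (2 ^ j * vol nb reps r <= k.+1 ^ size reps * #|` B nb x (4 ^ j * r)|)%N.
Proof.
move=> r0; elim: j => [|j IH] x; first by rewrite !mul1n vol_card_B.
set q := (4 ^ j * r)%N; have q0 : (0 < q)%N by rewrite muln_gt0 expn_gt0.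
have [u uB] := inf (B nb x (2 * q)); have [s us] := conn x u.
have [w wO _] := exit (Bid nb x (2 * q)) us uB.
move: wO; rewrite obd_B in_fsetD => /andP[wn wB].
have Dis : [disjoint B nb x q & B nb w q]%fset.
  apply/fdisjointP => z zx; apply/negP => zw; case/negP: wn.
  by rewrite mul2n -addnn; apply: B_trans zx _; rewrite (B_sym nbC).
have sub : B nb x q `|` B nb w q `<=` B nb x (4 ^ j.+1 * r).
  have E : (4 ^ j.+1 * r = 4 * q)%N by rewrite expnS -mulnA.
  rewrite E; apply/fsubUsetP; split; apply/fsubsetP => z zB; first by apply: (@B_mono _ nb x q) zB; lia.
  by apply: (@B_mono _ nb x ((2 * q).+1 + q)); [lia|exact: B_trans wB zB].
have := fsubset_leq_card sub; rewrite cardfsU (eqP Dis) cardfs0 subn0 => h.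
rewrite expnS -mulnA mul2n -addnn; apply: leq_trans (leq_mul (leqnn _) h).
by rewrite mulnDr leq_add.
Qed.

Variable o : V.
Hypothesis SL : forall C, exists r, (C * r.+1 < #|` B nb o r|)%N.
Hypothesis short_bal : forall x z, orb nb x z -> z \in B nb x (2 * size reps).+1 ->
  a conn x z = a conn z x.

(** The sum of all constants that [Gam = 2 ^ Sconst] has to dominate; the last term 5 ensures $4S +
    3 \le 2^S$, which gives [Gam_big] with $j = 2S$. *)
Definition Sconst N := (k + k.+1 ^ N + 2 * k.+1 ^ N + k.+1 ^ N * N + 2 * (2 * k.+1 ^ N * (k.+1 ^ N * N)) +
   (9 * (2 * N).+1 * k + 4 * ((2 * N).+1 * (2 * N).+1)) + 5)%N.

(** Everything up to here is ordered field arithmetic and finite sums, so the rationals serve as the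
    field. *)
Lemma balanced_count Gam c0 c1 Ch : (Gam = 2 ^ Sconst (size reps))%N ->
  (Gam + 2 <= c0)%N -> c1A_cond Gam c0 c1 -> c1B_cond rat Gam c0 c1 -> crho_cond Gam c0 c1 ->
  ChA_cond Gam c0 c1 Ch -> ChB_cond rat Gam c0 Ch ->
  forall x n (F : seq {fset V}), (0 < n)%N -> uniq F ->
  (forall A, A \in F -> contour nb x n A) -> (size F <= KC Gam Ch ^ n)%N.
Proof.
move=> GE; set N := size reps in GE *.
have ex s : (s <= 2 ^ s)%N by exact/ltnW/ltn_expl.
have SG : (Sconst N <= Gam)%N by rewrite GE; exact: (ex (Sconst N)).
rewrite /Sconst in SG.
have [Gamk GK GK1 [GCT GK2 GCv]] := parts_le SG.
have Gam1 : (1 <= Gam)%N by rewrite GE expn_gt0.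
have Gam_big : exists2 j, (2 * j + 3 <= Gam)%N & (Gam * Gam <= 2 ^ j)%N.
  exists (2 * Sconst N)%N; last by rewrite GE mul2n -addnn expnD.
  have : (5 <= Sconst N)%N by apply: leq_addl.
  rewrite GE; move: (Sconst N); clear; elim=> // s IH; rewrite ltnS leq_eqVlt => /orP[/eqP <- //|s4].
  by have := IH s4; rewrite expnS; move: (2 ^ s)%N => X; lia.
have f1 := card_B_vol repsP.
have f3 r : (r * r <= Gam * vol nb reps r)%N.
  apply: (leq_trans (quadratic_growth nbC nbk repsP conn SL o r)).
  by apply: leq_mul => //; exact: card_B_vol.
have f4 j r : (0 < r)%N -> (2 ^ j * vol nb reps r <= Gam * vol nb reps (4 ^ j * r))%N.
  move=> r0; apply: (leq_trans (vol_linear j r0 o)).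
  by apply: leq_mul => //; exact: card_B_vol.
have f5 (P : {fset V}) r : (0 < r)%N -> (Gam * #|` P| <= vol nb reps r)%N -> (#|` P| <= Gam * r * bd nb P)%N.
  move=> r0 H; have H2 : (K1 k reps * #|` P| <= vol nb reps r)%N.
    by apply: leq_trans H; rewrite leq_mul2r GK1 orbT.
  apply: (leq_trans (isoperimetry nbC rat nbk repsP short_bal H2)).
  by rewrite !leq_mul2r GK2 !orbT.
have f6 (Fn : V -> rat) r (X U : {fset V}) : (forall x, x \in X -> {subset B nb x r <= U}) ->
  (\sum_(x <- X) \sum_(y <- B nb x r) `|Fn x - Fn y| <=
  (Gam * (r * vol nb reps r))%:R * \sum_(z <- U) grad nb Fn z)%R.
  move=> XU; apply: (le_trans (transport nbC nbk repsP short_bal Fn XU)).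
  apply: ler_wpM2r; first by apply: sumr_ge0 => z _; exact: grad_ge0.
  by rewrite ler_nat leq_mul2r GCT orbT.
move=> h1 h2 h3 h4 h5 h6 x n F n0 uF HF.
exact: (@contour_count V nb nbC k nbk rat Gam (vol nb reps) Gam1 Gamk Gam_big f1 (vol_mono repsP) f3 f4 f5 f6 c0 c1 Ch h1 h2 h3 h4 h5 h6 conn inf x n F n0 uF HF).
Qed.

End Balanced.

(** * Nonunimodular automorphism groups *)

Section Unbalanced.
Local Open Scope fset_scope.
Variables (V : choiceType) (nb : V -> {fset V}).
Hypothesis nbC : forall x y, (y \in nb x) = (x \in nb y).
Variable k : nat.
Hypothesis nbk : forall x, (#|` nb x| <= k)%N.
Variables (reps : seq V).
Hypothesis repsP : forall v, exists r f, [/\ r \in reps, aut nb f & f r = v].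
Hypothesis conn : forall x y, exists r, y \in B nb x r.
Let n := size reps.

Section Pair.
Variables (x z : V) (d : nat).
Hypotheses (xz : orb nb x z) (zB : z \in B nb x d) (azx : (a conn z x < a conn x z)%N).

(** An invariant orientation of the orbit of [x]: a point has [a x z] successors by [card_outs], but
    at most [a z x] predecessors by [card_ins]. *)
Definition rel_pair y y' := `[< exists g, [/\ aut nb g, g x = y & g z = y'] >].
Definition outs y := [fset y' in B nb y d | rel_pair y y'].

Lemma rel_pair_B y y' : rel_pair y y' -> y' \in B nb y d.
Proof. by move=> /asboolP[g [Hg <- <-]]; rewrite aut_B. Qed.

Lemma card_outs y : orb nb x y -> #|` outs y| = a conn x z.
Proof.
move=> [g Hg gx]; have gI := aut_inj Hg; have [h [Hh gK hK]] := aut_inv Hg.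
rewrite /a -[RHS](card_im _ gI); congr #|` _|; apply/fsetP => u; rewrite in_sep.
apply/andP/imfsetP => /= [[_ /asboolP[f [Hf fx fz]]]|[w /soP[f [Hf fx fz]] ->]].
  exists (h u); last by rewrite hK.
  by apply/soP; exists (h \o f); split; [exact: aut_comp|rewrite /= fx -gx gK|rewrite /= fz].
have E : rel_pair y (g w).
  apply/asboolP; exists (g \o f); split; [exact: aut_comp|by rewrite /= fx|by rewrite /= fz].
by split=> //; exact: rel_pair_B.
Qed.

Lemma card_ins y' (S : {fset V}) : (#|` [fset y in S | rel_pair y y']| <= a conn z x)%N.
Proof.
have [->|/fset0Pn[y0]] := eqVneq [fset y in S | rel_pair y y'] fset0; first by rewrite cardfs0.
rewrite in_sep => /andP[_ /asboolP[g [Hg _ gz]]].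
have gI := aut_inj Hg; have [h [Hh gK hK]] := aut_inv Hg.
rewrite /a -[X in (_ <= X)%N](card_im _ gI); apply: fsubset_leq_card; apply/fsubsetP => u.
rewrite in_sep => /andP[_ /asboolP[f [Hf fx fz]]]; apply/imfsetP => /=.
exists (h u); last by rewrite hK.
by apply/soP; exists (h \o f); split; [exact: aut_comp|rewrite /= fz -gz gK|rewrite /= fx].
Qed.

Variable A : {fset V}.
Let A' := [fset y in A | `[< orb nb x y >]].
Let A'' := [fset y in A' | [exists u : outs y, val u \notin A]].

(** The points of [A'] send [#A' * a x z] arrows and can receive only [#A' * a z x], so at least
    [#A'] arrows end outside [A]. The source of such an arrow is within [2 d] of the outer
    boundary. *)
Lemma orbit_part_bd : (#|` A'| <= k.+1 ^ (3 * d) * bd nb A)%N.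
Proof.
have pd : (a conn x z <= k.+1 ^ d)%N by apply: (leq_trans (a_le_card conn zB)); exact: card_B.
have tot : (\sum_(y <- A') #|` outs y| = #|` A'| * a conn x z)%N.
  rewrite (eq_big_seq (fun=> a conn x z)) => [|y]; last by rewrite in_sep => /andP[_ /asboolP]; exact: card_outs.
  by rewrite big_const_seq count_predT iter_addn_0 mulnC.
have inside : (\sum_(y <- A') #|` [fset u in outs y | u \in A]| <= #|` A'| * a conn z x)%N.
  apply: (@leq_trans (\sum_(y <- A') \sum_(u <- A') rel_pair y u)).
    rewrite big_seq [X in (_ <= X)%N]big_seq leq_sum // => y yA'; rewrite sumb_card.
    apply: fsubset_leq_card; apply/fsubsetP => u; rewrite !in_sep => /andP[/andP[_ E] uA].
    rewrite uA E andbT /=; apply/asboolP; move: E => /asboolP[g [Hg _ <-]].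
    by apply: orb_trans xz _; exists g.
  rewrite exchange_big /=.
  apply: (@leq_trans (\sum_(u <- A') a conn z x)).
    by apply: leq_sum => u _; rewrite sumb_card; exact: card_ins.
  by rewrite big_const_seq count_predT iter_addn_0 mulnC.
have outside : (\sum_(y <- A') #|` [fset u in outs y | u \notin A]| <= #|` A''| * k.+1 ^ d)%N.
  apply: (@leq_trans (\sum_(y <- A') [exists u : outs y, val u \notin A] * k.+1 ^ d)).
    rewrite big_seq [X in (_ <= X)%N]big_seq leq_sum // => y yA'.
    have [_|/existsPn no] := boolP [exists u : outs y, val u \notin A].
      rewrite mul1n; apply: leq_trans pd; move: yA'; rewrite in_sep => /andP[_ /asboolP/card_outs <-].
      by apply: fsubset_leq_card; apply/fsubsetP => u; rewrite in_sep => /andP[].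
    rewrite mul0n leqn0 cardfs_eq0; apply/eqP/fsetP => u; rewrite in_sep [RHS]in_fset0.
    by apply/negP => /andP[uo uA]; have := no [` uo]; rewrite uA.
  by rewrite -big_distrl /= sumb_card.
have split_ y : #|` outs y| = (#|` [fset u in outs y | u \in A]| + #|` [fset u in outs y | u \notin A]|)%N.
  rewrite card_fset_sum1 -(sumb_card (outs y) (fun u => u \in A)) -(sumb_card (outs y) (fun u => u \notin A)).
  by rewrite -big_split /=; apply: eq_bigr => u _; case: (u \in A).
have main : (#|` A'| <= #|` A''| * k.+1 ^ d)%N.
  move: tot; under eq_bigr do rewrite split_; rewrite big_split /= => E.
  have h := leq_mul (leqnn #|` A'|) azx; rewrite mulnS in h.
  by move: inside outside h E; move: (\sum_(_ <- _) _)%N (\sum_(_ <- _) _)%N (#|` A'| * a conn z x)%N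
    (#|` A'| * a conn x z)%N (_ * k.+1 ^ d)%N => *; lia.
have cover : A'' `<=` \bigcup_(u <- obd nb A) B nb u (2 * d).
  apply/fsubsetP => y; rewrite in_sep => /andP[]; rewrite in_sep => /andP[yA _].
  case/existsP => -[u uo] /= uA; move: uo; rewrite in_sep => /andP[uB _].
  have [w wO uw] := exit yA uB uA.
  apply/bigfcupP; exists w; rewrite ?wO //; rewrite mul2n -addnn.
  by apply: B_trans uw _; rewrite (B_sym nbC).
have := leq_trans (fsubset_leq_card cover) (card_bigfcup_le (c := k.+1 ^ (2 * d)) (fun u _ => card_B nbk u (2 * d))).
move=> A''le; apply: (leq_trans main).
have -> : (3 * d = 2 * d + d)%N by lia.
rewrite expnD; apply: (@leq_trans (#|` obd nb A| * k.+1 ^ (2 * d) * k.+1 ^ d)).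
  by rewrite leq_mul2r A''le orbT.
by rewrite -mulnA mulnC leq_mul2l (obd_bd nb A) orbT.
Qed.

(** A vertex of [A] is within [n] of an orbit point; if the latter is not in [A], the outer boundary
    is within [2 n]. *)
Lemma card_bd_le : (#|` A| <= (k.+1 ^ (n + 3 * d) + k.+1 ^ (2 * n)) * bd nb A)%N.
Proof.
have sub : A `<=` (\bigcup_(w <- A') B nb w n) `|` (\bigcup_(u <- obd nb A) B nb u (2 * n)).
  apply/fsubsetP => v vA; have [w xw wv] := orb_near repsP conn x v; rewrite in_fsetU.
  have [wA|wA] := boolP (w \in A).
    apply/orP; left; apply/bigfcupP; exists w; last by rewrite (B_sym nbC).
    by rewrite andbT in_sep wA; apply/asboolP.
  apply/orP; right; have [u uO wu] := exit vA wv wA.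
  apply/bigfcupP; exists u; rewrite ?uO // mul2n -addnn.
  by apply: B_trans wu _; rewrite (B_sym nbC).
apply: (leq_trans (fsubset_leq_card sub)); rewrite cardfsU; apply: (leq_trans (leq_subr _ _)).
rewrite mulnDl; apply: leq_add.
  apply: (leq_trans (card_bigfcup_le (c := k.+1 ^ n) (fun u _ => card_B nbk u n))).
  by rewrite mulnC expnD -mulnA leq_mul2l orbit_part_bd orbT.
apply: (leq_trans (card_bigfcup_le (c := k.+1 ^ (2 * n)) (fun u _ => card_B nbk u (2 * n)))).
by rewrite mulnC leq_mul2l (obd_bd nb A) orbT.
Qed.

End Pair.

(* Colour the sites of a large set independently: the event that the cluster of
   [o] is exactly [A] fixes [#A + #obd A] sites, and these events are disjoint. *)
Lemma connected_set_count o s (F : seq {fset V}) : uniq F ->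
  (forall A, A \in F -> [/\ o \in A, connected_in nb A & (#|` A| + #|` obd nb A| <= s)%N]) ->
  (size F <= 2 ^ s)%N.
Proof.
move=> uF HF; pose U := \bigcup_(A <- F) (A `|` obd nb A).
have AU A : A \in F -> A `|` obd nb A `<=` U.
  by move=> AF; apply/fsubsetP => v vA; apply/bigfcupP; exists A; rewrite ?AF.
pose ev A (S : {fset V}) := (A `<=` S) && [disjoint S & obd nb A]%fset.
have uniqev A C S : A \in F -> C \in F -> ev A S -> ev C S -> A `<=` C.
  move=> AF CF /andP[AS _] /andP[CS dC]; have [oA cA _] := HF A AF; have [oC _ _] := HF C CF.
  apply/fsetIidPl/eqP; apply: contraT => ne.
  have I0 : A `&` C != fset0 by apply/fset0Pn; exists o; rewrite in_fsetI oA oC.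
  have [v [w [vI wv wA wI]]] := cA _ (fsubsetIl A C) I0 ne.
  have wC : w \notin C by apply: contra wI => wC; rewrite in_fsetI wA wC.
  have wO : w \in obd nb C by apply/obdP; split=> //; exists v => //; move: vI; rewrite in_fsetI => /andP[].
  by have := fdisjointP dC w (fsubsetP AS _ wA); rewrite wO.
have low A : A \in F -> (2 ^ #|` U| <= 2 ^ s * #|` [fset S in fpowerset U | ev A S]|)%N.
  move=> AF; have [_ _ szA] := HF A AF; pose T := U `\` (A `|` obd nb A).
  have cT : (#|` U| <= s + #|` T|)%N.
    have := cardfsD U (A `|` obd nb A); rewrite (fsetIidPr (AU A AF)) -/T => E.
    have := fsubset_leq_card (AU A AF); have := cardfsU A (obd nb A); move: E szA.
    by move: #|` T| #|` U| #|` A `|` _| #|` A| #|` obd nb A| #|` _ `&` _| => *; lia.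
  apply: (@leq_trans (2 ^ (s + #|` T|))); first by rewrite leq_exp2l.
  rewrite expnD leq_mul2l; apply/orP; right; rewrite -card_fpowerset.
  have inj : {in fpowerset T &, injective (fun S => A `|` S)}.
    move=> S1 S2; rewrite !fpowersetE => S1T S2T E; apply/fsetP => v.
    have notA S : S `<=` T -> v \in S -> v \notin A.
      by move=> /fsubsetP ST /ST; rewrite in_fsetD in_fsetU negb_or => /andP[/andP[]].
    have := congr1 (fun X : {fset V} => v \in X) E; rewrite !in_fsetU.
    case vA: (v \in A) => //= _.
    by apply/idP/idP => h; [have := notA _ S1T h|have := notA _ S2T h]; rewrite vA.
  rewrite -[X in (X <= _)%N](card_in_imfset imfset_key inj); apply: fsubset_leq_card; apply/fsubsetP => S.
  case/imfsetP => /= S' ; rewrite inE fpowersetE => /fsubsetP S'T ->.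
  rewrite !inE /= fpowersetE /ev fsubsetUl /=; apply/andP; split.
    apply/fsubUsetP; split; first by apply: fsubset_trans (AU A AF); exact: fsubsetUl.
    by apply/fsubsetP => v /S'T; rewrite in_fsetD => /andP[].
  apply/fdisjointP => v; rewrite in_fsetU => /orP[vA|/S'T].
    by apply/negP => /obdP[]; rewrite vA.
  by rewrite in_fsetD in_fsetU negb_or => /andP[/andP[_ ->]].
have tot : (\sum_(A <- F) #|` [fset S in fpowerset U | ev A S]| <= 2 ^ #|` U|)%N.
  rewrite -card_fpowerset card_fset_sum1.
  have -> : (\sum_(A <- F) #|` [fset S in fpowerset U | ev A S]| = \sum_(A <- F) \sum_(S <- fpowerset U) ev A S)%N.
    apply: eq_bigr => A _; rewrite card_fset_sum1 big_fset /= [LHS]big_mkcond.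
    by apply: eq_bigr => S _; case: (ev A S).
  rewrite exchange_big /= leq_sum // => S _.
  have [/hasP[A AF evA]|/hasPn no] := boolP (has (fun A => ev A S) F); last first.
    by rewrite big_seq big1 // => A AF; rewrite (negPf (no A AF)).
  rewrite (bigD1_seq A) //= evA big1_seq ?addn0 // => C /andP[CA CF].
  have [evC|//] := boolP (ev C S); case/eqP: CA; apply/eqP; rewrite eqEfsubset.
  by rewrite (uniqev C A S) // (uniqev A C S).
rewrite -(@leq_pmul2r (2 ^ #|` U|)) ?expn_gt0 //.
apply: (@leq_trans (\sum_(A <- F) 2 ^ s * #|` [fset S in fpowerset U | ev A S]|)).
  rewrite -sum1_size big_distrl /= big_seq [X in (_ <= X)%N]big_seq leq_sum // => A AF.
  by rewrite mul1n low.
by rewrite -big_distrr /= leq_mul2l tot orbT.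
Qed.

Lemma unbalanced_count :
  ~ (forall x z, orb nb x z -> z \in B nb x (2 * n).+1 -> a conn x z = a conn z x) ->
  forall o m (F : seq {fset V}), uniq F -> (forall A, A \in F -> contour nb o m A) ->
  (size F <= (2 ^ (k.+1 ^ (n + 3 * (2 * n).+1) + k.+1 ^ (2 * n)).+1) ^ m)%N.
Proof.
move=> nbal.
have [x [z [xz zB lt]]] : exists x z, [/\ orb nb x z, z \in B nb x (2 * n).+1 & (a conn z x < a conn x z)%N].
  apply: contrapT => no; apply: nbal => x z xz zB; apply/eqP; rewrite eqn_leq.
  apply/andP; split; rewrite leqNgt; apply/negP => lt; apply: no; [by exists x, z|].
  by exists z, x; split=> //; [exact: orb_sym|rewrite (B_sym nbC)].
move=> o m F uF HF; rewrite -expnM; apply: (@connected_set_count o) => // A AF.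
have [oA cA _ bdA] := HF A AF; split=> //.
rewrite mulSn addnC; apply: leq_add; first by rewrite -bdA obd_bd.
by rewrite -bdA; exact: card_bd_le xz zB lt A.
Qed.

End Unbalanced.

(** The bound has to precede the graph: it is the sum of the constants of the balanced and
    unbalanced cases, which see the list of representatives only through its length. *)
Lemma contour_count_exists (k n : nat) : exists K : nat,
  forall (V : choiceType) (nb : V -> {fset V}),
  (forall x y, (y \in nb x) = (x \in nb y)) -> (forall x, (#|` nb x| <= k)%N) ->
  forall reps : seq V, size reps = n ->
  (forall v, exists r f, [/\ r \in reps, aut nb f & f r = v]) ->
  (forall x y, exists r, y \in B nb x r) -> (forall A : {fset V}, exists x, x \notin A) ->
  forall o, (forall C, exists r, (C * r.+1 < #|` B nb o r|)%N) ->
  forall x m (F : seq {fset V}), (0 < m)%N -> uniq F ->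
  (forall A, A \in F -> contour nb x m A) -> (size F <= K ^ m)%N.
Proof.
have [Gam GE] : exists G, G = (2 ^ Sconst k n)%N by eexists.
have Gam1 : (1 <= Gam)%N by rewrite GE expn_gt0.
have [c0 [c1 [C [h1 h2 h3 h4 [h5 h6]]]]] := heart_constants Gam1.
have [K2 K2E] : exists K, K = (2 ^ (k.+1 ^ (n + 3 * (2 * n).+1) + k.+1 ^ (2 * n)).+1)%N by eexists.
exists (KC Gam C + K2)%N => V nb nbC nbk reps sn repsP conn inf o SL x m F m0 uF HF.
have [bal|nbal] := pselect (forall x z, orb nb x z -> z \in B nb x (2 * size reps).+1 ->
    a conn x z = a conn z x).
  have := @balanced_count V nb nbC k nbk reps repsP conn inf o SL bal Gam c0 c1 C.
  rewrite sn => /(_ GE h1 h2 (h3 _) h4 h5 (h6 _) x m F m0 uF HF) h.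
  apply: (leq_trans h); rewrite leq_exp2r //; exact: leq_addr.
have h := @unbalanced_count V nb nbC k nbk reps repsP conn nbal x m F uF HF.
rewrite sn -K2E in h; apply: (leq_trans h); rewrite leq_exp2r //; exact: leq_addl.
Qed.

From mathcomp Require Import all_classical all_reals all_analysis.
From mathcomp Require Import Rstruct.
From Stdlib Require List.
From Stdlib Require Import Relations.
Require Import Defs.
Import Order.TTheory GRing.Theory Num.Theory.
Import numFieldNormedType.Exports.

(** * Bernoulli percolation *)

Lemma geometric_lt (R : realType) (q z : R) : (0 <= q < 1 -> 0 < z -> exists n, q ^+ n < z)%R.
Proof.
move=> /andP[q0 q1] z0.
have cv : ((fun n => (q ^+ n)%R) @ \oo --> (0 : R)%R)%classic.
  by apply: cvg_expr; rewrite ger0_norm.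
move/cvgrPdist_lt: cv => /(_ _ z0)[n _ /(_ n (leqnn n))] /=.
by rewrite sub0r normrN ger0_norm ?exprn_ge0 // => h; exists n.
Qed.

(* An i.i.d. Bernoulli(p) sequence on [0,1): the n-th bit says on which side of
   the p-splitting point of its n-th level interval the sample point lies. *)
Section Bits.
Local Open Scope classical_set_scope.
Local Open Scope ring_scope.
Variables (R : realType) (p : R).
Hypothesis p01 : 0 <= p <= 1.

(** An interval is stored as its left end and its length; [true] selects the left part, of
    proportion [p]. *)
Definition splitI (s : R * R) (b : bool) : R * R :=
  if b then (s.1, p * s.2) else (s.1 + p * s.2, (1 - p) * s.2).

Fixpoint st (x : R) n : R * R :=
  if n is n'.+1 then splitI (st x n') (x < (st x n').1 + p * (st x n').2) else (0, 1).

Definition bit x n := x < (st x n).1 + p * (st x n).2.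

Definition iv (w : seq bool) : R * R := foldl splitI (0, 1) w.
Definition Iw (w : seq bool) : set R := `[(iv w).1, (iv w).1 + (iv w).2[.

Lemma iv_rcons w b : iv (rcons w b) = splitI (iv w) b.
Proof. by rewrite /iv foldl_rcons. Qed.

Lemma iv_ge0 w : 0 <= (iv w).2.
Proof.
case/andP: p01 => p0 p1; elim/last_ind: w => [|w b IH]; first exact: ler01.
by rewrite iv_rcons /splitI; case: b; rewrite mulr_ge0 // subr_ge0.
Qed.

Lemma in_Iw w x : Iw w x <-> (iv w).1 <= x < (iv w).1 + (iv w).2.
Proof. by rewrite /Iw /= in_itv. Qed.

Lemma Iw_rcons w b x : Iw (rcons w b) x <-> Iw w x /\ (x < (iv w).1 + p * (iv w).2) = b.
Proof.
have l0 := iv_ge0 w; case/andP: p01 => p0 p1.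
have pl : p * (iv w).2 <= (iv w).2 by rewrite ler_piMl.
have pl0 : 0 <= p * (iv w).2 by rewrite mulr_ge0.
rewrite !in_Iw iv_rcons /splitI; case: b => /=.
  split=> [/andP[h1 h2]|[/andP[h1 h2] h3]]; last by rewrite h1 h3.
  by rewrite h1 h2; split=> //; apply: (lt_le_trans h2); rewrite lerD2l.
have E : (iv w).1 + p * (iv w).2 + (1 - p) * (iv w).2 = (iv w).1 + (iv w).2 by ring.
rewrite E; split=> [/andP[h1 h2]|[/andP[h1 h2] /negbT]].
  by rewrite h2 andbT ltNge h1; split=> //; apply: le_trans h1; rewrite lerDl.
by rewrite -leNgt h2 => ->.
Qed.

Lemma st_Iw w x : Iw w x -> st x (size w) = iv w.
Proof.
elim/last_ind: w => [//|w b IH] /Iw_rcons[/IH E h].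
by rewrite size_rcons /= E h iv_rcons.
Qed.

Definition cyl w N (c : nat -> option bool) : set R :=
  [set x | Iw w x /\ forall i b, (size w <= i < size w + N)%N -> c i = Some b -> bit x i = b].

Definition wt (o : option bool) : R := if o is Some b then (if b then p else 1 - p) else 1.

Lemma cyl_rcons w N c b x : cyl w N.+1 c x -> bit x (size w) = b -> cyl (rcons w b) N c x.
Proof.
move=> [xw H] hb; split.
  by apply/Iw_rcons; split=> //; move: hb; rewrite /bit (st_Iw xw).
by move=> i b' /andP[h1 h2]; apply: H; move: h1 h2; rewrite size_rcons; lia.
Qed.

Lemma rcons_cyl w N c b x : cyl (rcons w b) N c x ->
  (forall b', c (size w) = Some b' -> b' = b) -> cyl w N.+1 c x.
Proof.
move=> [/Iw_rcons[xw hb] H] cb; split=> // i b' /andP[h1 h2] ci.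
have [E|ne] := eqVneq i (size w).
  by rewrite E /bit (st_Iw xw) hb (cb b') // -E.
by apply: H => //; rewrite size_rcons; move/eqP: ne; lia.
Qed.

(** Induction on [N], lengthening the word by one bit: a prescribed bit keeps one part of the
    interval, a free bit keeps both. *)
Lemma cyl_measure N w c : measurable (cyl w N c) /\
  lebesgue_measure (cyl w N c) = ((iv w).2 * \prod_(i < N) wt (c (size w + i)%N))%:E.
Proof.
elim: N w => [|N IH] w.
  have -> : cyl w 0 c = Iw w.
    apply/seteqP; split=> [x []//|x xw]; split=> // i b; rewrite addn0; lia.
  split; first exact: measurable_itv.
  rewrite big_ord0 mulr1 /Iw lebesgue_measure_itv /= lte_fin ltrDl.
  have := iv_ge0 w; rewrite le_eqVlt => /orP[/eqP <-|->]; first by rewrite ltxx.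
  by rewrite -EFinB; congr (_%:E); ring.
have [m1 e1] := IH (rcons w true); have [m0 e0] := IH (rcons w false).
rewrite !size_rcons !iv_rcons /splitI /= in e1 e0.
have prodE : \prod_(i < N.+1) wt (c (size w + i)%N) =
    wt (c (size w)) * \prod_(i < N) wt (c ((size w).+1 + i)%N).
  by rewrite big_ord_recl /= addn0; congr (_ * _); apply: eq_bigr => i _; rewrite /bump /= addnCA add1n addSn.
rewrite prodE; case cw: (c (size w)) => [b|] /=.
  have -> : cyl w N.+1 c = cyl (rcons w b) N c.
    apply/seteqP; split=> x xc.
      by apply: (cyl_rcons xc); apply: (proj2 xc) => //; rewrite leqnn /=; lia.
    by apply: (rcons_cyl xc) => b'; rewrite cw => -[].
  by case: b cw => _; [split=> //; rewrite e1|split=> //; rewrite e0]; congr (_%:E); ring.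
have -> : cyl w N.+1 c = cyl (rcons w true) N c `|` cyl (rcons w false) N c.
  apply/seteqP; split=> x.
    by move=> xc; case hb: (bit x (size w)); [left|right]; exact: cyl_rcons hb.
  by case=> xc; apply: (rcons_cyl xc) => b'; rewrite cw.
split; first exact: measurableU.
have dj : cyl (rcons w true) N c `&` cyl (rcons w false) N c = set0.
  apply/seteqP; split=> // x [[/Iw_rcons[_ h1] _] [/Iw_rcons[_ h2] _]].
  by rewrite h1 in h2.
transitivity (lebesgue_measure (cyl (rcons w true) N c) + lebesgue_measure (cyl (rcons w false) N c))%E.
  by rewrite measureU.
by rewrite e1 e0 -EFinD; congr (_%:E); ring.
Qed.

Definition unitI : set (measurableTypeR R) := `[0, 1[%classic.
Lemma measurable_unitI : measurable unitI.
Proof. exact: measurable_itv. Qed.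

Definition unitP := mrestr (@lebesgue_measure R) measurable_unitI.
HB.instance Definition _ := Measure.on unitP.

Lemma unitP_setT : unitP [set: measurableTypeR R] = 1%:E.
Proof.
by rewrite /unitP /mrestr setTI /unitI lebesgue_measure_itv /= lte_fin ltr01 -EFinB subr0.
Qed.

HB.instance Definition _ := Measure_isProbability.Build _ _ _ unitP unitP_setT.

Definition unit_probability : probability (measurableTypeR R) R := unitP.

(** Bits are [false] outside $[0,1)$, a set of measure zero for the restricted measure. *)
Definition ubit (t : R) i := (0 <= t < 1) && bit t i.

Lemma Iw_nil x : Iw [::] x <-> 0 <= x < 1.
Proof. by rewrite in_Iw /iv /= add0r. Qed.

Lemma ubit_law (L M : seq nat) : uniq (L ++ M) ->
  unitP [set t | (forall i, i \in L -> ubit t i) /\ (forall i, i \in M -> ~~ ubit t i)]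
  = (p ^+ size L * (1 - p) ^+ size M)%:E.
Proof.
move=> uLM; pose N := (\max_(i <- L ++ M) i).+1.
have iN i : i \in L ++ M -> (i < N)%N by move=> iL; rewrite ltnS (big_rem i) //= leq_maxl.
pose c i := if i \in L then Some true else if i \in M then Some false else None.
have LM i : i \in L -> i \notin M.
  move=> iL; move: uLM; rewrite cat_uniq => /and3P[_ /hasPn H _]; apply/negP => /H.
  by rewrite /= iL.
have E : [set t | (forall i, i \in L -> ubit t i) /\ (forall i, i \in M -> ~~ ubit t i)] `&` unitI
    = cyl [::] N c.
  apply/seteqP; split=> t /=.
    rewrite /unitI /= in_itv /= => -[[hL hM] t01]; split; first exact/Iw_nil.
    move=> i b _; rewrite /c; case: ifP => [iL [<-]|_]; first by have := hL i iL; rewrite /ubit t01.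
    by case: ifP => // iM [<-]; have := hM i iM; rewrite /ubit t01 /= => /negbTE.
  move=> [/Iw_nil t01 H]; rewrite /unitI /= in_itv /= t01; split=> //; split=> i iX.
    rewrite /ubit t01 /=; apply: H; first by rewrite /= add0n iN // mem_cat iX.
    by rewrite /c iX.
  rewrite /ubit t01 /=; apply/negbT; apply: H; first by rewrite /= add0n iN // mem_cat iX orbT.
  by rewrite /c iX; case: ifP => // /LM; rewrite iX.
rewrite /unitP /mrestr E (proj2 (cyl_measure N [::] c)) /= mul1r; congr (_%:E).
have -> : \prod_(i < N) wt (c (0 + i)%N) = \prod_(0 <= i < N) wt (c i) by rewrite big_mkord.
have wtE i : wt (c i) = (if i \in L then p else 1) * (if i \in M then 1 - p else 1).
  rewrite /c; case: ifP => [iL|_]; first by rewrite (negPf (LM i iL)) mulr1.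
  by rewrite mul1r; case: ifP.
under eq_bigr do rewrite wtE; rewrite big_split /= -!big_mkcond /=.
have cnt (X : seq nat) (q : R) : uniq X -> {subset X <= L ++ M} ->
    \prod_(0 <= i < N | i \in X) q = q ^+ size X.
  move=> uX XLM; rewrite big_const_seq iter_mulr_1; congr (_ ^+ _).
  rewrite -size_filter; apply/perm_size; apply: uniq_perm => //; first by rewrite filter_uniq // iota_uniq.
  move=> i; rewrite mem_filter mem_index_iota /=; apply/andP/idP => [[]//|iX]; split=> //.
  exact/iN/XLM.
have uL : uniq L by move: uLM; rewrite cat_uniq => /and3P[].
have uM : uniq M by move: uLM; rewrite cat_uniq => /and3P[].
rewrite (cnt L p uL) ?(cnt M (1 - p) uM) // => i iX; rewrite mem_cat iX ?orbT //.
Qed.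

Lemma measurable_ubit i : measurable [set t : measurableTypeR R | ubit t i].
Proof.
pose c j := if j == i then Some true else None.
suff -> : [set t | ubit t i] = cyl [::] i.+1 c by exact: (proj1 (cyl_measure _ _ _)).
apply/seteqP; split=> t /=.
  rewrite /ubit => /andP[t01 ht]; split; first exact/Iw_nil.
  by move=> j b _; rewrite /c; case: eqP => // -> [<-].
move=> [/Iw_nil t01 H]; rewrite /ubit t01 /=; apply: H; first by rewrite /= add0n.
by rewrite /c eqxx.
Qed.

End Bits.

Lemma InP (T : eqType) (x : T) (s : seq T) : List.In x s <-> x \in s.
Proof.
elim: s => [|y s IH] //=; rewrite in_cons; split.
  by case=> [->|/IH ->]; rewrite ?eqxx ?orbT.
by case/orP => [/eqP ->|/IH]; [left|right].
Qed.

Lemma NoDupP (T : eqType) (s : seq T) : List.NoDup s <-> uniq s.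
Proof.
elim: s => [|y s IH] /=; first by split=> // _; constructor.
split=> [H|/andP[ys us]].
  by inversion H; subst; apply/andP; split; [apply/negP => /InP|apply/IH].
by constructor; [move/InP; exact/negP|apply/IH].
Qed.

(** * Closed contours around a finite cluster *)

Section BoundaryEdges.
Local Open Scope fset_scope.
Variables (V : choiceType) (nb : V -> {fset V}).
Hypothesis nbC : forall x y, (y \in nb x) = (x \in nb y).
Hypothesis conn : forall x y, exists r, y \in B nb x r.
Hypothesis inf : forall A : {fset V}, exists x, x \notin A.

Definition edges (A : {fset V}) : seq (V * V) :=
  [seq (v, w) | v <- enum_fset A, w <- [seq w <- enum_fset (nb v) | w \notin A]].

Lemma mem_edges A v w : ((v, w) \in edges A) = [&& v \in A, w \in nb v & w \notin A].
Proof.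
apply/allpairsPdep/and3P => [[v' [w' [vA]]]|[vA wv wA]].
  by rewrite mem_filter => /andP[wA wv] [-> ->].
by exists v, w; split=> //; rewrite mem_filter wA wv.
Qed.

Lemma edges_uniq A : uniq (edges A).
Proof.
apply: allpairs_uniq_dep; first exact: fset_uniq.
  by move=> v _; rewrite filter_uniq // fset_uniq.
by move=> [v w] [v' w'] _ _ /= [-> ->].
Qed.

Lemma size_edges A : size (edges A) = bd nb A.
Proof.
rewrite /edges size_allpairs_dep sumnE big_map /bd; apply: eq_bigr => v _.
rewrite size_filter -sum1_count big_mkcond /=; apply: eq_bigr => w _; by case: (w \in A).
Qed.

Lemma bd_lt A C x y : x \in C -> y \in nb x -> y \notin C -> ~~ [&& x \in A & y \notin A] ->
  (forall v w, v \in A -> w \in nb v -> w \notin A -> v \in C /\ w \notin C) ->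
  (bd nb A < bd nb C)%N.
Proof.
move=> xC yx yC nA H; rewrite -!size_edges.
have := @uniq_leq_size _ ((x, y) :: edges A) (edges C); apply.
  by rewrite /= edges_uniq andbT mem_edges yx andTb.
move=> [v w]; rewrite in_cons => /orP[/eqP[-> ->]|]; rewrite !mem_edges ?xC ?yx //.
by move=> /and3P[vA wv wA]; have [-> ->] := H v w vA wv wA; rewrite wv.
Qed.

Lemma exit_edge (S : {fset V}) : S != fset0 -> exists v w, [/\ v \in S, w \in nb v & w \notin S].
Proof.
move=> /fset0Pn[x xS]; have [u uS] := inf S; have [r ur] := conn x u.
have [w /obdP[wS [v vS wv]] _] := exit xS ur uS.
by exists v, w.
Qed.

Lemma bd_pos (S : {fset V}) : S != fset0 -> (0 < bd nb S)%N.
Proof. by move=> /exit_edge[v [w [vS wv wS]]]; exact: bd_gt0 vS wv wS. Qed.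

Variable cl : V -> V -> bool.
Definition closed_bd (S : {fset V}) := forall v w, v \in S -> w \in nb v -> w \notin S -> cl v w.

(** Minimise the edge boundary among finite sets containing [o] with closed boundary. A disconnected
    minimiser could drop the part without [o], and a hole could be filled in; both operations only
    remove boundary edges, and [exit_edge] provides one that is really lost. *)
Lemma closed_contour o (S0 : {fset V}) : o \in S0 -> closed_bd S0 ->
  exists A m, [/\ (0 < m)%N, contour nb o m A & closed_bd A].
Proof.
move=> oS0 cS0.
have ex : exists m, `[< exists S : {fset V}, [/\ o \in S, closed_bd S & bd nb S = m] >].
  by exists (bd nb S0); apply/asboolP; exists S0.
case: (ex_minnP ex) => m /asboolP[S [oS cS bS]] mmin.
have Smin (S' : {fset V}) : o \in S' -> closed_bd S' -> (bd nb S' < bd nb S)%N -> False.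
  move=> oS' cS' lt; have := mmin (bd nb S'); rewrite leqNgt -bS lt => H.
  by have : false by apply: H; apply/asboolP; exists S'.
have S0' : S != fset0 by apply/fset0Pn; exists o.
exists S, m; split=> //; first by rewrite -bS bd_pos.
split=> //.
  move=> S' S'S S'0 S'ne; apply: contrapT => no.
  have no' v w : v \in S' -> w \in nb v -> w \in S -> w \in S'.
    by move=> vS' wv wS; apply: contraT => wS'; case: no; exists v, w.
  have sub1 v w : v \in S' -> w \in nb v -> w \notin S' -> v \in S /\ w \notin S.
    move=> vS' wv wS'; split; first exact: (fsubsetP S'S).
    by apply: contra wS' => wS; exact: no' wv wS.
  have sub2 v w : v \in S `\` S' -> w \in nb v -> w \notin S `\` S' -> v \in S /\ w \notin S.
    rewrite !in_fsetD => /andP[vS' vS] wv; rewrite negb_and negbK => /orP[wS'|wS]; last by [].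
    by case/negP: vS'; apply: (no' w v) => //; rewrite nbC.
  have [oS'|oS'] := boolP (o \in S').
    have D0 : S `\` S' != fset0.
      by apply: contra S'ne; rewrite fsetD_eq0 => h; rewrite eqEfsubset S'S h.
    have [v [w [vD wv wD]]] := exit_edge D0; have [vS wS] := sub2 v w vD wv wD.
    apply: (Smin S' oS').
      by move=> v' w' h1 h2 h3; have [? ?] := sub1 v' w' h1 h2 h3; exact: cS.
    apply: (@bd_lt _ _ v w) => //; move: vD; rewrite in_fsetD => /andP[/negPf -> _]; by [].
  have [v [w [vD wv wD]]] := exit_edge S'0; have [vS wS] := sub1 v w vD wv wD.
  apply: (Smin (S `\` S')); first by rewrite in_fsetD oS' oS.
    by move=> v' w' h1 h2 h3; have [? ?] := sub2 v' w' h1 h2 h3; exact: cS.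
  by apply: (@bd_lt _ _ v w) => //; rewrite in_fsetD vD.
move=> S2 S20 dis; apply: contrapT => no.
have no' v w : v \in S2 -> w \in nb v -> w \notin S2 -> w \in S.
  by move=> vS2 wv wS2; apply: contraT => wS; case: no; exists v, w.
have sub v w : v \in S `|` S2 -> w \in nb v -> w \notin S `|` S2 -> v \in S /\ w \notin S.
  rewrite !in_fsetU negb_or => /orP[vS|vS2] wv /andP[wS wS2]; first by [].
  by case/negP: wS; exact: no' wv wS2.
have [v [w [vS2 wv wS2]]] := exit_edge S20; have wS := no' v w vS2 wv wS2.
apply: (Smin (S `|` S2)); first by rewrite in_fsetU oS.
  by move=> v' w' h1 h2 h3; have [? ?] := sub v' w' h1 h2 h3; exact: cS.
apply: (@bd_lt _ _ w v) => //; [by rewrite nbC|exact: dis|].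
by rewrite !in_fsetU vS2 orbT andbF.
Qed.

(** A vertex is coded by its distance to [o] and its position in the ball of that radius. *)
Lemma code_ex : V -> exists code : V -> nat, injective code.
Proof.
move=> o; pose rad v := ex_minn (conn o v).
have radP v : v \in B nb o (rad v) by rewrite /rad; case: ex_minnP.
exists (fun v => choice.pickle (rad v, index v (enum_fset (B nb o (rad v))))) => v w /(pcan_inj choice.pickleK)[rE iE].
have := nth_index v (radP v); rewrite rE in iE *; rewrite iE nth_index //; exact: radP.
Qed.

(** The bound on duplicate-free lists of contours makes a longest list exist, and a longest list is
    complete. *)
Lemma contours_finite o K : (forall m (F : seq {fset V}), (0 < m)%N -> uniq F ->
    (forall A, A \in F -> contour nb o m A) -> (size F <= K ^ m)%N) ->
  forall m, (0 < m)%N -> exists F : seq {fset V},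
    [/\ (size F <= K ^ m)%N, forall A, A \in F -> contour nb o m A & forall A, contour nb o m A -> A \in F].
Proof.
move=> count m m0.
pose Pn s := `[< exists F : seq {fset V}, [/\ uniq F, forall A, A \in F -> contour nb o m A & size F = s] >].
have ex : exists s, Pn s by exists 0%N; apply/asboolP; exists [::].
have ub s : Pn s -> (s <= K ^ m)%N by move=> /asboolP[F [uF HF <-]]; exact: count.
case: (ex_maxnP ex ub) => s /asboolP[F [uF HF sF]] smax; exists F; split=> //.
  by rewrite sF; apply: ub; apply/asboolP; exists F.
move=> A HA; apply: contraT => AF; have : Pn s.+1.
  apply/asboolP; exists (A :: F); split; rewrite /= ?AF ?uF ?sF //.
  by move=> C; rewrite in_cons => /orP[/eqP ->|/HF].
by move=> /smax; rewrite ltnn.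
Qed.

End BoundaryEdges.

(** * Peierls' argument *)

Section Percolation.
Local Open Scope classical_set_scope.
Local Open Scope ring_scope.
Variables (V : choiceType) (adj : V -> V -> Prop) (nb : V -> {fset V}).
Hypothesis nbP : forall x y, (y \in nb x) <-> adj x y.
Hypothesis nbC : forall x y, (y \in nb x) = (x \in nb y).
Hypothesis conn : forall x y, exists r, y \in B nb x r.
Hypothesis inf : forall A : {fset V}, exists x, x \notin A.

Section Field.
Variables (p : RR) (d : measure_display) (T : measurableType d) (P : probability T RR).
Variable X : V -> V -> T -> bool.
Hypothesis XB : bernoulli_bond adj p P X.

Definition all_closed (M : seq (V * V)) : set T := [set t | forall e, e \in M -> ~~ X e.1 e.2 t].

Lemma distinct_edges_edges A : distinct_edges adj (edges nb A).
Proof.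
split=> [[v w] /InP|]; first by rewrite mem_edges => /and3P[_ /nbP].
split; first by apply/NoDupP; exact: edges_uniq.
move=> [v w] [v' w'] /InP + /InP; rewrite !mem_edges /= => /and3P[vA _ wA] /and3P[v'A _ w'A] E1 E2.
by move: v'A; rewrite E1 (negPf wA).
Qed.

Lemma measurable_closed M : (forall e, e \in M -> adj e.1 e.2) -> measurable (all_closed M).
Proof.
have [_ [mX _]] := XB; elim: M => [|e M IH] HM.
  have -> : all_closed [::] = setT by apply/seteqP; split.
  exact: measurableT.
have -> : all_closed (e :: M) = ~` [set t | X e.1 e.2 t] `&` all_closed M.
  apply/seteqP; split=> t /=.
    by move=> H; split; [apply/negP; apply: H; rewrite mem_head|move=> e' h; apply: H; rewrite in_cons h orbT].
  by move=> [/negP h1 h2] e'; rewrite in_cons => /orP[/eqP ->//|]; exact: h2.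
apply: measurableI; last by apply: IH => e' h; apply: HM; rewrite in_cons h orbT.
by apply: measurableC; apply: mX; apply: HM; rewrite mem_head.
Qed.

Lemma prob_closed M : distinct_edges adj M -> P (all_closed M) = ((1 - p) ^+ size M)%:E.
Proof.
move=> dM; have [_ [_ law]] := XB; have := law [::] M dM; rewrite /= mul1r => <-.
congr (P _); apply/seteqP; split=> t /=; first by move=> H; split=> // e /InP; exact: H.
by move=> [_ H] e /InP; exact: H.
Qed.

Lemma cluster_closed o (t : T) : finite_set (cluster adj X t o) ->
  exists A m, [/\ (0 < m)%N, contour nb o m A & all_closed (edges nb A) t].
Proof.
move=> fC; have [S SE] := finite_fsetP.1 fC.
have memS v : (v \in S) <-> cluster adj X t o v by rewrite SE.
have [|//|A [m [m0 cA clA]]] := @closed_contour V nb nbC conn inf (fun v w => ~~ X v w t) o S.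
- by apply/memS; exact: rt_refl.
- move=> v w vS wv wS; apply/negP => Xvw; case/negP: wS; apply/memS.
  apply: (@rt_trans _ _ _ v); first exact/memS.
  by apply: rt_step; split=> //; exact/nbP.
by exists A, m; split=> // -[v w]; rewrite mem_edges => /and3P[vA wv wA] /=; exact: clA.
Qed.

Lemma prob_union_le (F : seq {fset V}) m : (forall A, A \in F -> bd nb A = m) ->
  measurable [set t | exists2 A, A \in F & all_closed (edges nb A) t] /\
  (P [set t | exists2 A, A \in F & all_closed (edges nb A) t] <= ((size F)%:R * (1 - p) ^+ m)%:E)%E.
Proof.
elim: F => [|A F IH] HF.
  have -> : [set t | exists2 A, A \in [::] & all_closed (edges nb A) t] = set0.
    by apply/seteqP; split=> // t [].
  by rewrite measure0 mul0r.
have [|mF leF] := IH; first by move=> C CF; apply: HF; rewrite in_cons CF orbT.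
set UF := [set t | _] in mF leF.
have -> : [set t | exists2 C, C \in A :: F & all_closed (edges nb C) t] = all_closed (edges nb A) `|` UF.
  apply/seteqP; split=> t /=.
    by move=> [C]; rewrite in_cons => /orP[/eqP ->|CF h]; [left|right; exists C].
  by case=> [h|[C CF h]]; [exists A; rewrite ?mem_head|exists C; rewrite // in_cons CF orbT].
have mA : measurable (all_closed (edges nb A)).
  by apply: measurable_closed => -[v w]; rewrite mem_edges => /and3P[_ /nbP].
split; first exact: measurableU.
apply: (le_trans (measureU2 _ mA mF)).
have hA : (P (all_closed (edges nb A)) <= ((1 - p) ^+ m)%:E)%E.
  by rewrite (prob_closed (distinct_edges_edges A)) size_edges HF ?mem_head.
have -> : ((size (A :: F))%:R * (1 - p) ^+ m)%:E =
    (((1 - p) ^+ m)%:E + ((size F)%:R * (1 - p) ^+ m)%:E)%E.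
  by rewrite -EFinD /= -natr1 mulrDl mul1r addrC.
exact: leeD hA leF.
Qed.

(** If all clusters were almost surely finite, closed contours around [o] would exist with
    probability 1, whereas their probabilities add up to at most $\sum_{m \ge 1} 3^{-m} = 1/2$. *)
Lemma infinite_cluster_positive o K : (forall m (F : seq {fset V}), (0 < m)%N -> uniq F ->
    (forall A, A \in F -> contour nb o m A) -> (size F <= K ^ m)%N) ->
  0 <= K%:R * (1 - p) <= 1 / 3 ->
  ~ {ae P, forall t, forall x, finite_set (cluster adj X t x)}.
Proof.
move=> count /andP[x0 x3] [N [mN PN subN]].
have fin := contours_finite count.
have exF m : exists F : seq {fset V}, [/\ (size F <= K ^ m)%N, forall A, A \in F -> contour nb o m A,
   (0 < m)%N -> forall A, contour nb o m A -> A \in F & (m = 0)%N -> F = [::]].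
  case: m => [|m]; first by exists [::].
  by have [F [h1 h2 h3]] := fin m.+1 isT; exists F.
have [F FP] := boolp.choice exF.
pose S m : set T := [set t | exists2 A, A \in F m & all_closed (edges nb A) t].
have SP m := @prob_union_le (F m) m (fun A AF => let: And4 _ h _ _ := FP m in let: And4 _ _ _ b := h A AF in b).
have mS m : measurable (S m) by case: (SP m).
pose q := K%:R * (1 - p).
have leS m : (P (S m) <= (if m is 0 then 0 else (1 / 3) ^+ m)%:E)%E.
  case: m => [|m]; last first.
    have [_ h] := SP m.+1; apply: (le_trans h); rewrite lee_fin.
    have [hs _ _ _] := FP m.+1.
    apply: (@le_trans _ _ (q ^+ m.+1)); last by apply: lerXn2r; rewrite ?nnegrE //; lra.
    rewrite /q exprMn -natrX; have [p1|p1] := leP 0 (1 - p).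
      by apply: ler_wpM2r; rewrite ?exprn_ge0 // ler_nat.
    (* For [1 - p < 0] the hypothesis [0 <= K%:R * (1 - p)] forces [K = 0], and then there are no
       contours at all. *)
    have K0 : K = 0%N.
      by case: (K) x0 => // K'; rewrite pmulr_rge0 ?ltr0n // leNgt p1.
    by move: hs; rewrite K0 exp0n // leqn0 => /eqP ->; rewrite !mul0r.
  have [_ _ _ F0] := FP 0%N; rewrite /S (F0 erefl).
  have -> : [set t | exists2 A, A \in [::] & all_closed (edges nb A) t] = set0 by apply/seteqP; split=> // t [].
  by rewrite measure0.
have cover : ~` N `<=` \bigcup_m S m.
  move=> t Nt; have /(_ o) fo : forall x, finite_set (cluster adj X t x).
    by apply: contrapT => h; apply: Nt; exact: subN.
  have [A [m [m0 cA clA]]] := cluster_closed fo.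
  by exists m => //; exists A => //; have [_ _ h _] := FP m; exact: h.
have mNC : measurable (~` N) by exact: measurableC.
have : (P (~` N) <= \sum_(0 <= m <oo) P (S m))%E by apply: measure_sigma_subadditive.
rewrite probability_setC // PN sube0.
suff H : (\sum_(0 <= m <oo) P (S m) <= (1 / 2)%:E)%E.
  by move=> h; have := le_trans h H; rewrite lee_fin; lra.
apply: lime_le; first exact: is_cvg_nneseries.
apply: nearW => n /=.
(* Closed form of the partial sums; the exponent is [n.-1] because the series starts at 1. *)
apply: (@le_trans _ _ (1 / 2 * (1 - (1 / 3) ^+ n.-1) : RR)%:E).
  elim: n => [|n IH]; first by rewrite big_nil lee_fin expr0; lra.
  rewrite big_nat_recr //=; case: n IH => [|n] IH.
    by rewrite big_nil add0e (le_trans (leS 0%N)) // lee_fin expr0; lra.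
  apply: (le_trans (leeD IH (leS n.+1))); rewrite -EFinD lee_fin /= exprS.
  by move: ((1 / 3) ^+ n) => z; lra.
rewrite lee_fin; have : 0 <= (1 / 3 : RR) ^+ n.-1 by rewrite exprn_ge0 //; lra.
by move: ((1 / 3) ^+ n.-1) => z; lra.
Qed.

End Field.

(** [all_clusters_finite] quantifies over all realisations of the percolation, so refuting it
    requires an actual one. *)
Lemma bernoulli_field_ex (p : RR) (o : V) : 0 <= p <= 1 ->
  exists (P : probability (measurableTypeR RR) RR) (X : V -> V -> RR -> bool), bernoulli_bond adj p P X.
Proof.
move=> p01; have [code codeI] := code_ex conn o.
(* Sorting the two vertex codes makes the code of an edge independent of its orientation. *)
pose ec (e : V * V) : nat := choice.pickle (minn (code e.1) (code e.2), maxn (code e.1) (code e.2)).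
have ecS x y : ec (x, y) = ec (y, x) by rewrite /ec /= minnC maxnC.
have ecI e e' : ec e = ec e' -> e = e' \/ (e'.1 = e.2 /\ e'.2 = e.1).
  case: e e' => [x y] [x' y'] /(pcan_inj choice.pickleK)[] /= E1 E2.
  have : (code x = code x' /\ code y = code y') \/ (code x' = code y /\ code y' = code x).
    by move: E1 E2; rewrite /minn /maxn; case: ltnP => ?; case: ltnP => ?; lia.
  by case=> -[/codeI -> /codeI ->]; [left|right].
exists (unit_probability _), (fun x y t => ubit p t (ec (x, y))).
split; first by move=> x y t; rewrite ecS.
split; first by move=> x y _; exact: measurable_ubit.
move=> L M dLM; have [adjLM [ndLM revLM]] := dLM.
have uC : uniq (map ec L ++ map ec M).
  rewrite -map_cat map_inj_in_uniq; first exact/NoDupP.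
  move=> e e' /InP eL /InP e'L /ecI[//|[E1 E2]].
  by case: (revLM e e' eL e'L E1 E2).
transitivity (unitP [set t | (forall i, i \in map ec L -> ubit p t i) /\
  (forall i, i \in map ec M -> ~~ ubit p t i)]); last by rewrite (ubit_law p01 uC) !size_map.
apply: (congr1 (@unitP _)).
apply/seteqP; split=> t /=.
  move=> [hL hM]; split=> i /mapP[[x y] eX ->].
    by have := hL (x, y); apply; exact/InP.
  by have := hM (x, y); apply; exact/InP.
move=> [hL hM]; split=> -[x y] /InP eX /=; [apply: hL|apply: hM]; apply/mapP; by exists (x, y).
Qed.

Lemma peierls o K (p : RR) : (forall m (F : seq {fset V}), (0 < m)%N -> uniq F ->
    (forall A, A \in F -> contour nb o m A) -> (size F <= K ^ m)%N) ->
  0 <= p <= 1 -> K%:R * (1 - p) <= 1 / 3 -> ~ all_clusters_finite adj p.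
Proof.
move=> count p01 Kp acf; have [P [X XB]] := bernoulli_field_ex o p01.
apply: (infinite_cluster_positive XB count); last exact: (acf _ _ _ _ XB).
by rewrite Kp andbT mulr_ge0 // subr_ge0; case/andP: p01.
Qed.

End Percolation.

(** * Graphs without superlinear growth *)

Section LinearGrowth.
Local Open Scope classical_set_scope.
Local Open Scope ring_scope.
Variables (V : choiceType) (adj : V -> V -> Prop) (nb : V -> {fset V}).
Hypothesis nbP : forall x y, (y \in nb x) <-> adj x y.
Hypothesis nbC : forall x y, (y \in nb x) = (x \in nb y).
Hypothesis conn : forall x y, exists r, y \in B nb x r.
Variable k : nat.
Hypothesis nbk : forall x, (#|` nb x| <= k)%N.
Variables (o : V) (C M0 : nat).
Hypothesis lin : forall m, (M0 <= m)%N -> (#|` B nb o m| <= C * m)%N.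

(** If all spheres beyond radius [M] had more than [C] vertices, balls would grow by at least
    [C + 1] per step and eventually exceed [C * m]. *)
Lemma thin_sphere M : exists r, (M <= r)%N /\ (bd nb (B nb o r) <= k * C)%N.
Proof.
apply: contrapT => no.
have big r : (M <= r)%N -> (#|` B nb o r| + C.+1 <= #|` B nb o r.+1|)%N.
  move=> Mr; have : ~~ (#|` obd nb (B nb o r)| <= C)%N.
    apply/negP => h; apply: no; exists r; split=> //.
    by apply: (leq_trans (bd_obd nbC nbk _)); rewrite leq_mul2l h orbT.
  rewrite obd_B -ltnNge => h.
  have sub : (B nb o r `<=` B nb o r.+1)%fset by apply/fsubsetP => v; exact: B_mono.
  by have := cardfsID (B nb o r) (B nb o r.+1); rewrite (fsetIidPr sub) => <-; rewrite leq_add2l.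
have grow j : (j * C.+1 <= #|` B nb o (M + j)|)%N.
  elim: j => // j IH; rewrite addnS mulSn; apply: leq_trans (big (M + j)%N (leq_addr _ _)).
  by rewrite addnC leq_add2r.
pose j := (C * M + M0).+1.
have := leq_trans (grow j) (lin (m := (M + j)%N) _); rewrite mulnS mulnDr [(j * C)%N]mulnC => h.
have : (j <= C * M)%N.
  have /h : (M0 <= M + j)%N by rewrite /j; lia.
  by rewrite leq_add2r.
by rewrite /j; lia.
Qed.

Lemma thin_radii : exists rd : nat -> nat, [/\ forall j, (j <= rd j)%N,
  forall i j, (i < j)%N -> (rd i < rd j)%N & forall j, (bd nb (B nb o (rd j)) <= k * C)%N].
Proof.
have [f fP] := boolp.choice thin_sphere.
pose rd := fix rd j := if j is j'.+1 then f (maxn j'.+1 (rd j').+1) else f 0%N.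
have step j : (rd j < rd j.+1)%N.
  by have [h _] := fP (maxn j.+1 (rd j).+1); apply: leq_trans h; exact: leq_maxr.
exists rd; split.
- by case=> // j; have [h _] := fP (maxn j.+1 (rd j).+1); apply: leq_trans h; exact: leq_maxl.
- move=> i j; elim: j => // j IH; rewrite ltnS leq_eqVlt => /orP[/eqP ->|/IH h]; first exact: step.
  exact: ltn_trans h (step j).
- by case=> [|j] /=; [case: (fP 0%N)|case: (fP (maxn j.+1 (rd j).+1))].
Qed.

Section Field.
Variables (p : RR) (d : measure_display) (T : measurableType d) (P : probability T RR).
Variable X : V -> V -> T -> bool.
Hypotheses (p01 : 0 <= p < 1) (XB : bernoulli_bond adj p P X).
Notation all_closed := (all_closed X).

Lemma distinct_edges_sub (L L' : seq (V * V)) : distinct_edges adj L -> uniq L' ->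
  {subset L' <= L} -> distinct_edges adj L'.
Proof.
move=> [h1 [h2 h3]] uL' sub; split; first by move=> e /InP/sub/InP; exact: h1.
split; first exact/NoDupP.
by move=> e e' /InP/sub/InP H /InP/sub/InP H'; exact: h3.
Qed.

Lemma distinct_uniq L : distinct_edges adj L -> uniq L.
Proof. by move=> [_ [/NoDupP]]. Qed.

Lemma distinct_adj L e : distinct_edges adj L -> e \in L -> adj e.1 e.2.
Proof. by move=> [h _] /InP; exact: h. Qed.

Definition none_closed (Es : seq (seq (V * V))) : set T :=
  [set t | forall E, E \in Es -> ~ all_closed E t].

(** Independence by induction on the list. The event that [E] is closed is taken away by a
    difference, and in the subtracted term the edges of [E] join [M]; this is why [M] is carried
    along. *)
Lemma prob_none_closed (Es : seq (seq (V * V))) M : distinct_edges adj (M ++ flatten Es) ->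
  measurable (all_closed M `&` none_closed Es) /\
  P (all_closed M `&` none_closed Es) =
  ((1 - p) ^+ size M * \prod_(E <- Es) (1 - (1 - p) ^+ size E))%:E.
Proof.
elim: Es M => [|E Es IH] M dM.
  have -> : all_closed M `&` none_closed [::] = all_closed M.
    by apply/seteqP; split=> [t []//|t h]; split.
  rewrite cats0 in dM; split; first by apply: (measurable_closed XB) => e; exact: distinct_adj.
  by rewrite big_nil mulr1 (prob_closed XB dM).
have uM := distinct_uniq dM.
have d1 : distinct_edges adj (M ++ flatten Es).
  apply: (distinct_edges_sub dM).
    by move: uM; rewrite /= catA -!catA !cat_uniq /= has_cat negb_or => /and3P[-> /andP[_ ->] /and3P[_ _ ->]].
  by move=> e; rewrite /= !mem_cat => /orP[->|->]; rewrite ?orbT.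
have d2 : distinct_edges adj ((M ++ E) ++ flatten Es) by rewrite -catA.
have [m1 e1] := IH M d1; have [m2 e2] := IH (M ++ E) d2.
have mE : measurable (all_closed E).
  apply: (measurable_closed XB) => e eE; apply: (distinct_adj dM).
  by rewrite /= !mem_cat eE orbT.
set G := all_closed M `&` none_closed Es in m1 e1.
have E1 : all_closed M `&` none_closed (E :: Es) = G `\` all_closed E.
  apply/seteqP; split=> t /=.
    move=> [hM hE]; split; last by apply: hE; rewrite mem_head.
    by split=> // E' E'Es; apply: hE; rewrite in_cons E'Es orbT.
  by move=> [[hM hE] hEt]; split=> // E'; rewrite in_cons => /orP[/eqP ->|]; [|exact: hE].
have E2 : G `&` all_closed E = all_closed (M ++ E) `&` none_closed Es.
  apply/seteqP; split=> t /=.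
    by move=> [[hM hE] hEt]; split=> // e; rewrite mem_cat => /orP[/hM|/hEt].
  by move=> [h hE]; split; [split=> // e eM|move=> e eE]; apply: h; rewrite mem_cat ?eM ?eE ?orbT.
rewrite E1; split; first exact: measurableD.
have fG : (P G < +oo)%E by rewrite e1 ltry.
transitivity (P G - P (G `&` all_closed E))%E; first by apply: measureD.
rewrite E2 e1 e2 -EFinB big_cons size_cat exprD; congr (_%:E); ring.
Qed.

(** Spheres at the radii [rd j] have disjoint edge sets of bounded size, so almost surely closed
    ones occur beyond every index. One beyond the distance from [o] to [x] confines the cluster of
    [x]. *)
Lemma all_finite_linear : {ae P, forall t, forall x, finite_set (cluster adj X t x)}.
Proof.
have [p0 p1] := andP p01; have [rd [rd1 rd2 rd3]] := thin_radii.
pose E j := edges nb (B nb o (rd j)).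
(* Bounds the probability that a given thin sphere is not entirely closed; it is less than 1 because
   [p < 1]. *)
pose q := 1 - (1 - p) ^+ (k * C).
have a01 : 0 < 1 - p <= 1 by apply/andP; split; lra.
have q01 : 0 <= q < 1.
  case/andP: a01 => a0 a1; rewrite /q; apply/andP; split; first by rewrite subr_ge0 exprn_ile1 // ltW.
  by rewrite ltrBlDr ltrDl exprn_gt0.
have sphere v w j : (v, w) \in E j -> [/\ v \in B nb o (rd j), w \notin B nb o (rd j) & w \in B nb o (rd j).+1].
  by rewrite mem_edges => /and3P[vB wv wB]; split=> //; exact: nbB wv.
have Bsub i j : (i < j)%N -> {subset B nb o (rd i).+1 <= B nb o (rd j)}.
  by move=> ij; apply: B_mono; exact: rd2.
have Bsub0 i j : (i < j)%N -> {subset B nb o (rd i) <= B nb o (rd j)}.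
  by move=> ij; apply: B_mono; exact: ltnW (rd2 _ _ ij).
have dE J n : distinct_edges adj (flatten [seq E j | j <- iota J n]).
  split; first by move=> [v w] /InP/flattenP[l /mapP[j _ ->]]; rewrite mem_edges => /and3P[_ /nbP].
  split; last first.
    move=> [v w] [v' w'] /InP/flattenP[l /mapP[i _ ->] e1] /InP/flattenP[l' /mapP[j _ ->] e2] /= Ev Ew.
    have [h1 h2 h3] := sphere v w i e1; have [h1' h2' h3'] := sphere v' w' j e2.
    rewrite Ev Ew in h1' h2' h3'.
    case: (ltngtP i j) => ij.
    - by case/negP: h2'; exact: (Bsub0 i j ij).
    - by case/negP: h2; exact: (Bsub0 j i ij).
    - by case/negP: h2; rewrite ij.
  apply/NoDupP; elim: n J => [|n IH] J //=; rewrite cat_uniq edges_uniq IH andbT /=.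
  apply/hasPn => -[v w] /flattenP[l /mapP[j]]; rewrite mem_iota => /andP[Jj _] -> e1.
  apply/negP => e2; have [h1 h2 h3] := sphere v w j e1; have [h1' h2' h3'] := sphere v w J e2.
  by case/negP: h2; exact: (Bsub J j Jj).
have le_q J n : (P (none_closed [seq E j | j <- iota J n]) <= (q ^+ n)%:E)%E.
  have [_] := @prob_none_closed [seq E j | j <- iota J n] [::] (dE J n).
  have -> : all_closed [::] `&` none_closed [seq E j | j <- iota J n] = none_closed [seq E j | j <- iota J n].
    by apply/seteqP; split=> [t []//|t h]; split.
  rewrite mul1r => ->; rewrite lee_fin big_map.
  apply: (@le_trans _ _ (\prod_(j <- iota J n) q)); last first.
    by rewrite big_const_seq count_predT size_iota iter_mulr_1.
  case/andP: a01 => a0 a1; apply: ler_prod => j _; apply/andP; split.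
    by rewrite subr_ge0 exprn_ile1 // ltW.
  rewrite lerD2l lerN2; apply: ler_wiXn2l => //; first exact: ltW.
  by rewrite size_edges rd3.
pose Z J : set T := [set t | forall j, (J <= j)%N -> ~ all_closed (E j) t].
have mE j : measurable (all_closed (E j)).
  by apply: (measurable_closed XB) => -[v w]; rewrite mem_edges => /and3P[_ /nbP].
have mZ J : measurable (Z J).
  have -> : Z J = \bigcap_(j in [set j | (J <= j)%N]) ~` all_closed (E j).
    by apply/seteqP; split=> t /= h j Jj; exact: h.
  apply: bigcap_measurable; first by exists J => /=.
  by move=> j _; exact: measurableC.
have PZ J : P (Z J) = 0.
  have fz : P (Z J) \is a fin_num by exact: fin_num_measure.
  have z0 : 0 <= fine (P (Z J)) by apply: fine_ge0; exact: measure_ge0.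
  have zle n : fine (P (Z J)) <= q ^+ n.
    rewrite -lee_fin fineK //; apply: le_trans (le_q J n); apply: le_measure; rewrite ?inE //.
      have [h _] := @prob_none_closed [seq E j | j <- iota J n] [::] (dE J n).
      suff <- : all_closed [::] `&` none_closed [seq E j | j <- iota J n] = none_closed [seq E j | j <- iota J n] by [].
      by apply/seteqP; split=> [t []//|t h']; split.
    move=> t h l /mapP[j]; rewrite mem_iota => /andP[Jj _] ->; exact: h.
  suff z : fine (P (Z J)) = 0 by rewrite -(fineK fz) z.
  apply/eqP; rewrite eq_le z0 andbT leNgt; apply/negP => zpos.
  by have [n] := geometric_lt q01 zpos; rewrite ltNge zle.
have negl : P.-negligible (\bigcup_J Z J).
  by apply: negligible_bigcup => J; exists (Z J); split; [exact: mZ|exact: PZ|].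
apply: negligibleS negl => t /= bad.
have [x xinf] : exists x, ~ finite_set (cluster adj X t x).
  by apply: contrapT => h; apply: bad => x; apply: contrapT => h'; apply: h; exists x.
have [r xr] := conn o x; exists r => // j rj clE; apply: xinf.
apply: (@sub_finite_set _ _ [set` B nb o (rd j)]); last exact: finite_fset.
have xB : x \in B nb o (rd j) by apply: (@B_mono _ nb o r) xr; exact: leq_trans rj (rd1 j).
move=> u /=; rewrite /cluster /= => xu.
have : x \in B nb o (rd j) -> u \in B nb o (rd j).
  elim: xu => {xB} [a b [ab Xab] aB|//|a b c _ h1 _ h2 aB]; last exact/h2/h1.
  apply: contraT => bB; have := clE (a, b); rewrite mem_edges aB bB andbT => /(_ (iffRL (nbP a b) ab)).
  by rewrite Xab.
exact.
Qed.

End Field.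
End LinearGrowth.

Local Open Scope ring_scope.

(** * From adjacency relations to finite neighbour sets *)

Section Translation.
Local Open Scope classical_set_scope.
Variables (V : choiceType) (adj : V -> V -> Prop) (k n : nat).
Hypotheses (simp : simple_graph adj) (infV : infinite_vertex_set V) (connV : graph_connected adj).
Hypotheses (qt : quasitransitive adj n) (deg : max_degree_le adj k).

Lemma neighbourhoods : exists nb : V -> {fset V},
  (forall x y, (y \in nb x) <-> adj x y) /\ (forall x, (#|` nb x| <= k)%N).
Proof.
have [l lP] := boolp.choice deg.
exists (fun x => seq_fset tt [seq w <- l x | `[< adj x w >]]); split=> x.
  move=> y; rewrite seq_fsetE mem_filter; split=> [/andP[/asboolP]//|xy].
  by apply/andP; split; [exact/asboolP|apply/InP; case: (lP x) => _; apply].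
rewrite size_seq_fset; apply: (leq_trans (size_undup _)); rewrite size_filter.
by apply: (leq_trans (count_size _ _)); case: (lP x).
Qed.

Variable nb : V -> {fset V}.
Hypothesis nbP : forall x y, (y \in nb x) <-> adj x y.
Hypothesis nbk : forall x, (#|` nb x| <= k)%N.

Lemma adj_nbC x y : (y \in nb x) = (x \in nb y).
Proof. by case: simp => sym _; apply/idP/idP => /nbP/sym/nbP. Qed.

Lemma adj_conn x y : exists r, y \in B nb x r.
Proof.
elim: (connV x y) => [a b /nbP ab|a|a b c _ [r ar] _ [s bs]].
- by exists 1%N; rewrite B1 in_cnb ab orbT.
- by exists 0%N; exact: Bid.
- by exists (r + s)%N; exact: B_trans ar bs.
Qed.

Lemma adj_inf (A : {fset V}) : exists x, x \notin A.
Proof.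
apply: contrapT => no; apply: infV; apply: (@sub_finite_set _ _ [set` A]); last exact: finite_fset.
by move=> x _ /=; apply: contraT => xA; case: no; exists x.
Qed.

(** The list is padded to length exactly [n], since the constant of the contour count is attached to
    that length. *)
Lemma adj_reps : exists reps : seq V, size reps = n /\
  forall v, exists r f, [/\ r \in reps, aut nb f & f r = v].
Proof.
have [reps [sr H]] := qt; have [v0 _] := adj_inf fset0; have [r0 [f0 [r0R _]]] := H v0.
exists (reps ++ nseq (n - size reps) r0); split.
  by rewrite size_cat size_nseq subnKC.
move=> v; have [r [f [rR [[bf Hf] fr]]]] := H v; exists r, f; split=> //.
  by rewrite mem_cat; apply/orP; left; exact/InP.
split=> // x y; apply/idP/idP => [/nbP h|/nbP h]; apply/nbP; [exact: (iffRL (Hf x y))|exact: (iffLR (Hf x y))].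
Qed.

Lemma ballE o m v : ball adj o m v <-> v \in B nb o m.
Proof.
elim: m v => [|m IH] v; first by rewrite /= in_fset1; split=> [->|/eqP].
split=> [[/IH h|[x [/IH xB /nbP xv]]]|].
- exact: (@B_mono _ nb o m m.+1 _ v h).
- exact: nbB xB xv.
move=> /in_BS[y yB]; rewrite in_cnb => /orP[/eqP ->|vy]; first by left; exact/IH.
by right; exists y; split; [exact/IH|exact/nbP].
Qed.

Lemma superlinear_nat : superlinear_growth adj ->
  exists o, forall C, exists r, (C * r.+1 < #|` B nb o r|)%N.
Proof.
move=> [x0 H]; exists x0 => C.
(* The factor 2 absorbs [m.+1 <= 2 * m], valid as [m] is positive. *)
have [m [_ [m0 [s [ns [sb lt]]]]]] := H (2 * C%:R) 1%N.
exists m; have us : uniq s by exact/NoDupP.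
have sB : {subset s <= B nb x0 m} by move=> v /InP/sb/ballE.
apply: (@leq_trans (length s)); last exact: uniq_leq_size us sB.
move: lt; rewrite -natrM -natrM ltr_nat; apply: leq_trans; rewrite ltnS.
by rewrite -mulnA mulnCA leq_mul2l; apply/orP; right; lia.
Qed.

Lemma linear_nat o : ~ superlinear_growth adj ->
  exists C M, forall m, (M <= m)%N -> (#|` B nb o m| <= C * m)%N.
Proof.
move=> nsl; have : ~ forall (C : RR) (M : nat), exists m : nat, (M <= m)%N /\ (0 < m)%N /\
    exists s : list V, List.NoDup s /\ (forall v, List.In v s -> ball adj o m v) /\
      C * m%:R < (length s)%:R by move=> h; apply: nsl; exists o.
move=> /existsNP[C] /existsNP[M] no.
(* The real [C] may be negative or fractional, hence a natural number above its absolute value;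
   [M.+1] makes [m] positive. *)
exists (Num.truncn `|C|).+1, M.+1 => m Mm; rewrite leqNgt; apply/negP => lt; apply: no; exists m.
split; first exact: ltnW.
split; first exact: leq_ltn_trans Mm.
exists (enum_fset (B nb o m)); split; first by apply/NoDupP; exact: fset_uniq.
split; first by move=> v /InP h; exact/ballE.
apply: (@le_lt_trans _ _ ((Num.truncn `|C|).+1 * m)%:R); last by rewrite ltr_nat.
rewrite natrM; apply: ler_wpM2r => //; apply: (le_trans (ler_norm C)); apply: ltW.
exact: truncnS_gt.
Qed.

End Translation.

(** * The bound on [p_c] *)

Lemma p_c_dichotomy (k n : nat) : exists eps : RR, 0 < eps /\
  forall (V : choiceType) (adj : V -> V -> Prop),
    simple_graph adj -> infinite_vertex_set V -> graph_connected adj ->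
    quasitransitive adj n -> max_degree_le adj k ->
    (superlinear_growth adj -> p_c adj <= 1 - eps) /\
    (p_c adj <= 1 - eps \/ p_c adj = 1).
Proof.
have [K HK] := contour_count_exists k n.
(* Gives [K%:R * (1 - p) <= 1 / 3] whenever [p > 1 - eps]; the successor keeps the denominator
   positive and [eps] at most 1. *)
pose eps : RR := (3 * K.+1%:R)^-1.
have K1 : 0 < 3 * K.+1%:R :> RR by rewrite mulr_gt0 // ltr0n.
have e0 : 0 < eps by rewrite invr_gt0.
have e1 : eps <= 1.
  rewrite invf_le1 //; have : 1 <= K.+1%:R :> RR by rewrite ler1n.
  by lra.
have Ke : K%:R * eps <= 1 / 3.
  rewrite /eps ler_pdivrMr //; have E : K.+1%:R = K%:R + 1 :> RR by rewrite natr1.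
  by rewrite E; have : 0 <= K%:R :> RR; [by []|lra].
exists eps; split=> // V adj simp infV connV qt deg.
have [nb [nbP nbk]] := neighbourhoods deg.
have nbC := adj_nbC simp nbP; have conn := adj_conn connV nbP; have inf := adj_inf infV.
have [reps [sr repsP]] := adj_reps infV qt nbP.
have super : superlinear_growth adj -> p_c adj <= 1 - eps.
  move=> sl; have [x0 SL] := superlinear_nat nbP sl.
  have count := HK V nb nbC nbk reps sr repsP conn inf x0 SL x0.
  have ub p : 0 <= p <= 1 /\ all_clusters_finite adj p -> p <= 1 - eps.
    move=> [p01 acf]; rewrite leNgt; apply/negP => lt.
    apply: (peierls nbP nbC conn inf count p01 _ acf).
    apply: le_trans Ke; apply: ler_wpM2l => //; lra.
  rewrite /p_c; have [->|/set0P ne] := eqVneq [set p : RR | 0 <= p <= 1 /\ all_clusters_finite adj p]%classic set0.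
    by rewrite sup0; lra.
  by apply: ge_sup.
split=> //; have [sl|nsl] := pselect (superlinear_growth adj); first by left; exact: super.
right; have [v0 _] := inf fset0; have [C [M lin]] := linear_nat nbP v0 nsl.
have acf p : 0 <= p < 1 -> all_clusters_finite adj p.
  by move=> p01 d T P X XB; exact: (all_finite_linear nbP nbC conn nbk lin p01 XB).
set S := [set p : RR | 0 <= p <= 1 /\ all_clusters_finite adj p]%classic.
have Sp p : 0 <= p < 1 -> S p.
  by move=> p01; split; [case/andP: p01 => -> /ltW ->|exact: acf].
have ubS : (ubound S 1)%classic by move=> p [/andP[]].
have S0 : (S !=set0)%classic by exists 0; apply: Sp; rewrite lexx ltr01.
apply/eqP; rewrite eq_le; apply/andP; split; first exact: ge_sup.
rewrite leNgt; apply/negP => lt1.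
have s0 : 0 <= sup S by apply: ub_le_sup; [exists 1|apply: Sp; rewrite lexx ltr01].
(* Were the supremum less than 1, its midpoint with 1 would still belong to [S]. *)
have : (sup S + 1) / 2 <= sup S.
  apply: ub_le_sup; first by exists 1.
  by apply: Sp; rewrite /p_c -/S in lt1; apply/andP; split; lra.
by rewrite /p_c -/S in lt1; lra.
Qed.

Theorem theorem1p6 (k n : nat) :
  exists eps : RR, 0 < eps /\
    forall (V : Type) (adj : V -> V -> Prop),
      simple_graph adj -> infinite_vertex_set V -> graph_connected adj ->
      quasitransitive adj n -> max_degree_le adj k ->
      (superlinear_growth adj -> p_c adj <= 1 - eps) /\
      (p_c adj <= 1 - eps \/ p_c adj = 1).
Proof.
have [eps [e0 H]] := p_c_dichotomy k n.
(* An arbitrary vertex type becomes a choice type classically. *)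
by exists eps; split=> // V adj; exact: (H {classic V} adj).
Qed.
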